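(* Let $p$ be an odd prime, $m\ge 6$, $q=p^m$, and let $l$ be an integer with $1\le l\le m-1$ and $l\notin\{\frac m6,\frac m4,\frac m2,\frac{3m}4,\frac{5m}6\}$. Put $d=\gcd(m,l)$, $d'=\gcd(m,2l)$ and assume $m\ne 3d$. If $m$ is even put $s=m/2$; if moreover $d'=2d$ put $\mu=(-1)^{s/d}$. Let $$\mathcal D=\{(\mathrm{Tr}(ax^{p^{3l}+1}+bx^{p^l+1}+cx)+h)_{x\in\mathbb F_q}: a,b,c\in\mathbb F_q,\ h\in\mathbb F_p\}.$$ Then $\mathcal D$ is a linear code over $\mathbb F_p$ of length $p^m$ and dimension $3m+1$, and its weight distribution is given by the following lists of pairs (weight : multiplicity), where every line containing $\varepsilon$ stands for two lines, one for $\varepsilon=1$ and one for $\varepsilon=-1$. (i) If $d'=d$ is odd: - $0$ : $1$ - $p^{m-1}(p-1)$ : $p\,(p^{2m+2d-1}+p^{2m+d}-p^{2m+d-1}-p^{2m}-p^{2m-1}+p^{2m-2d}-p^{2m-3d}+p^{2m-3d-1}+p^{m+2d-1}-p^m+p^{m-2d}-p^{m-2d-1}+p^{2d}-1)(p^m-1)/(p^{2d}-1)$ - $p^{\frac{m-1}2}\big(p^{\frac{m+1}2}-p^{\frac{m-1}2}+\varepsilon(-1)^{\frac{p-1}2}\big)$ : $\dfrac{p^{m+2d}(p-1)(p^m-p^{m-d}-p^{m-2d}+1)(p^m-1)}{2(p^{2d}-1)}$ - $p^{\frac{m+d-2}2}(p-1)\big(p^{\frac{m-d}2}+\varepsilon\big)$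 : $\frac12p^{\frac{3m-3d}2}\big(p^{\frac{m-d}2}-\varepsilon\big)(p^m-1)$ - $p^{\frac{m+d-2}2}\big(p^{\frac{m-d+2}2}-p^{\frac{m-d}2}+\varepsilon\big)$ : $\frac12p^{\frac{3m-3d}2}(p-1)\big(p^{\frac{m-d}2}+\varepsilon\big)(p^m-1)$ - $p^{\frac{m+2d-1}2}\big(p^{\frac{m-2d+1}2}-p^{\frac{m-2d-1}2}+\varepsilon(-1)^{\frac{p-1}2}\big)$ : $\dfrac{p^{m-2d}(p-1)(p^{m-d}-1)(p^m-1)}{2(p^{2d}-1)}$ - $p^m$ : $p-1$ (ii) If $d'=d$ is even: - $0$ : $1$ - $p^{s-1}(p-1)(p^s+\varepsilon)$ : $\dfrac{p^{m+2d}(p^m-p^{m-d}-p^{m-2d}+1)(p^m-1)}{2(p^{2d}-1)}$ - $p^{s-1}(p^{s+1}-p^s+\varepsilon)$ : $\dfrac{p^{m+2d}(p-1)(p^m-p^{m-d}-p^{m-2d}+1)(p^m-1)}{2(p^{2d}-1)}$ - $p^{\frac{m+d-2}2}(p-1)\big(p^{\frac{m-d}2}+\varepsilon\big)$ : $\frac12p^{\frac{3m-3d}2}\big(p^{\frac{m-d}2}-\varepsilon\big)(p^m-1)$ - $p^{\frac{m+d-2}2}\big(p^{\frac{m-d+2}2}-p^{\frac{m-d}2}+\varepsilon\big)$ : $\frac12p^{\frac{3m-3d}2}(p-1)\big(p^{\frac{m-d}2}+\varepsilon\big)(p^m-1)$ - $p^{\frac{m+2d-2}2}(p-1)\big(p^{\frac{m-2d}2}+\varepsilon\big)$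 : $\dfrac{p^{m-2d}(p^{m-d}-1)(p^m-1)}{2(p^{2d}-1)}$ - $p^{\frac{m+2d-2}2}\big(p^{\frac{m-2d+2}2}-p^{\frac{m-2d}2}+\varepsilon\big)$ : $\dfrac{p^{m-2d}(p-1)(p^{m-d}-1)(p^m-1)}{2(p^{2d}-1)}$ - $p^{m-1}(p-1)$ : $p\,(p^{2m-d}-p^{2m-2d}+p^{2m-3d}-p^{m-2d}+1)(p^m-1)$ - $p^m$ : $p-1$ (iii) If $d'=2d$: put $$Q_0=\frac{(p^{m+6d}-p^{m+4d}-p^{m+d}+\mu p^{s+5d}-\mu p^{s+4d}+p^{6d})(p^m-1)}{(p^d+1)(p^{2d}-1)(p^{3d}+1)},$$ $$Q_1=\frac{(p^{m+3d}+p^{m+2d}-p^m-p^{m-d}-p^{m-2d}-\mu p^{s+3d}+\mu p^s+p^{3d})(p^m-1)}{(p^d+1)^2(p^{2d}-1)},$$ $$Q_2=\frac{(p^{s-d}+\mu)(p^{s+d}+p^s-p^{s-2d}-\mu p^d)(p^m-1)}{(p^d+1)^2(p^{2d}-1)},\qquad Q_3=\frac{(p^{s-2d}-\mu)(p^{s-d}+\mu)(p^m-1)}{(p^d+1)(p^{2d}-1)(p^{3d}+1)}.$$ Then: - $0$ : $1$ - $p^{s-1}(p-1)(p^s-\mu)$ : $p^mQ_0$ - $p^{s-1}(p^{s+1}-p^s+\mu)$ : $p^m(p-1)Q_0$ - $p^{s+d-1}(p-1)(p^{s-d}+\mu)$ : $p^{m-2d}Q_1$ - $p^{s+d-1}(p^{s-d+1}-p^{s-d}-\mu)$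 : $p^{m-2d}(p-1)Q_1$ - $p^{s+2d-1}(p-1)(p^{s-2d}-\mu)$ : $p^{m-4d}Q_2$ - $p^{s+2d-1}(p^{s-2d+1}-p^{s-2d}+\mu)$ : $p^{m-4d}(p-1)Q_2$ - $p^{s+3d-1}(p-1)(p^{s-3d}+\mu)$ : $p^{m-6d}Q_3$ - $p^{s+3d-1}(p^{s-3d+1}-p^{s-3d}-\mu)$ : $p^{m-6d}(p-1)Q_3$ - $p^{m-1}(p-1)$ : $p\Big(1-\mu p^{3s-d}-\mu p^{3s-8d}+p^{m-d}+\dfrac{p^{2m}+p^{2m-9d}+\mu p^{3s-3d}-\mu p^{3s-5d}-p^{m-4d}-p^{m-6d}}{p^d+1}\Big)(p^m-1)$ - $p^m$ : $p-1$
   Context: $\mathrm{Tr}$ is the trace map from $\mathbb F_q$ to $\mathbb F_p$, $\mathrm{Tr}(x)=x+x^p+\cdots+x^{p^{m-1}}$. Codewords of $\mathcal D$ are vectors in $\mathbb F_p^{\,q}$ with coordinates indexed by $x\in\mathbb F_q$. The (Hamming) weight of a codeword is its number of nonzero coordinates; the weight distribution records, for each $i$, the number $A_i$ of codewords of weight $i$. The code $\mathcal D$ is the code the paper denotes $\overline{\mathbb C^{\bot}}^{\bot}$: the dual of the extended code of the dual of the cyclic code $\mathbb C$ of length $q-1$ over $\mathbb F_p$ with parity-check polynomial $h_1(x)h_{p^l+1}(x)h_{p^{3l}+1}(x)$, where $h_i$ is the minimal polynomial over $\mathbb F_p$ of $\alpha^i$ for a primitive element $\alpha$ of $\mathbb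 F_q$.
   Formalization: In case (iii), in the multiplicity of weight p^{m-1}(p-1), the terms -μp^{3s-d}-μp^{3s-8d}+p^{m-d} are multiplied by (p^d-1)/(p^d+1); as printed, the multiplicities do not sum to p^{3m+1} (e.g. p=3, m=8, l=1). *)

(* Defs.v *)
From HB Require Import structures.
From mathcomp Require Import all_boot all_order all_algebra all_field.

Set Implicit Arguments.
Unset Strict Implicit.
Unset Printing Implicit Defensive.

Import GRing.Theory.
Local Open Scope ring_scope.

Section Code.

(* A word with coordinates indexed by I is a function {ffun I -> K^o}; the    *)
(* regular module K^o makes words a vectType over K.                          *)
Variables (K : finFieldType) (I : finType).
Implicit Types (c : {ffun I -> K^o}) (C : {set {ffun I -> K^o}}).

Definition is_linear_code C (n k : nat) : Prop :=
  #|I| = n /\ exists2 V : {vspace {ffun I -> K^o}}, C =i V & \dim V = k.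

Definition weight c : nat := #|[set x | c x != 0]|.

(* T lists pairs (weight, multiplicity). Distinct lines of such a list may    *)
(* carry the same weight, in which case their multiplicities add up; a weight *)
(* that is not listed does not occur.                                         *)
Definition has_weight_distribution C (T : seq (rat * rat)) : Prop :=
  forall w : nat,
    #|[set c in C | weight c == w]|%:R = \sum_(t <- T | t.1 == w%:R) t.2.

End Code.

Section Trace.

Variables (p m : nat) (F : finFieldType).

Definition trace_sum (x : F) : F := \sum_(i < m) x ^+ (p ^ i).

(* The trace as an element of 'F_p, which embeds in F by t |-> (t : nat)%:R;  *)
(* by TrP below the default value 0 is never used when #|F| = p ^ m.          *)
Definition Tr (x : F) : 'F_p :=
  odflt 0 [pick t : 'F_p | (t : nat)%:R == trace_sum x].

Lemma TrP (x : F) : prime p -> #|F| = (p ^ m)%N ->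
  (Tr x : nat)%:R = trace_sum x.
Proof.
move=> p_pr cardF; rewrite /Tr; case: pickP => [t /eqP // | noT].
have pF : p \in [pchar F] by exact: card_finPcharP cardF p_pr.
have m_gt0 : (0 < m)%N.
  by case: m cardF => // card1; have := finNzRing_gt1 F; rewrite card1.
set y := trace_sum x in noT *.
have yp : y ^+ p = y.
  rewrite -(pFrobenius_autE pF) /y /trace_sum rmorph_sum /=.
  case: m m_gt0 cardF => // k _ cardF.
  rewrite big_ord_recr big_ord_recl /= addrC; congr (_ + _).
    by rewrite pFrobenius_autE -exprM -expnSr -cardF expf_card expn0 expr1.
  by apply: eq_bigr => i _; rewrite pFrobenius_autE -exprM -expnSr.
pose rs := y :: [seq (t : nat)%:R | t : 'F_p].
have pP : 'X^p - 'X != 0 :> {poly F}.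
  rewrite -size_poly_eq0 size_polyDl ?size_polyXn //.
  by rewrite size_polyN size_polyX ltnS prime_gt1.
have root_rs : all (root ('X^p - 'X)) rs.
  apply/allP => z; rewrite inE rootE !hornerE subr_eq0.
  case/predU1P => [->|/mapP[t _ ->]]; first exact/eqP.
  by rewrite -(pFrobenius_autE pF) rmorph_nat.
have uniq_rs : uniq rs.
  rewrite /= map_inj_uniq ?enum_uniq ?andbT.
    by apply/negP => /mapP[t _ yt]; have := noT t; rewrite yt eqxx.
  have aux (t u : 'F_p) : (t <= u)%N -> (t : nat)%:R = (u : nat)%:R :> F -> t = u.
    move=> le_tu /eqP; rewrite eq_sym -subr_eq0 -natrB // -(dvdn_pcharf pF) => dv.
    apply/val_inj/eqP; rewrite eqn_leq le_tu -subn_eq0 /=.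
    apply: contraTT dv; rewrite -lt0n => /gtnNdvd -> //.
    by rewrite (leq_ltn_trans (leq_subr _ _)) // -{2}(Fp_cast p_pr) ltn_ord.
  move=> t u tu; have [le_tu|le_ut] := leqP t u; first exact: aux.
  by apply/esym/aux; rewrite ?(ltnW le_ut).
have := max_poly_roots pP root_rs uniq_rs.
rewrite /= size_map -cardE card_Fp // size_polyDl ?size_polyXn ?ltnn //.
by rewrite size_polyN size_polyX ltnS prime_gt1.
Qed.

Variable l : nat.

Definition codeword (a b c : F) (h : 'F_p) : {ffun F -> ('F_p)^o} :=
  [ffun x => Tr (a * x ^+ (p ^ (3 * l) + 1) + b * x ^+ (p ^ l + 1) + c * x) + h].

Definition codeD : {set {ffun F -> ('F_p)^o}} :=
  [set f | [exists a, exists b, exists c, exists h, f == codeword a b c h]].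

End Trace.

(* Natural-number exponents below use truncated subtraction and halving. In   *)
(* the situations where the tables are used (m <> 3d, the excluded values of  *)
(* l, and the condition on d') m / d is odd and >= 5 for the first two, even  *)
(* and >= 8 for the third, so every difference is nonnegative and every       *)
(* halved number is even.                                                     *)
Section Tables.

Variables p m d : nat.

Local Notation P k := ((p%:R : rat) ^+ k%N).
Local Notation s := (m./2).
Local Notation signs := [:: 1; -1].
Local Notation eta := ((-1) ^+ ((p - 1)./2)).

Definition table_odd : seq (rat * rat) :=
  [:: (0, 1);
      (P (m - 1) * (P 1 - 1),
       P 1 * (P (2 * m + 2 * d - 1) + P (2 * m + d) - P (2 * m + d - 1)
              - P (2 * m) - P (2 * m - 1) + P (2 * m - 2 * d)
              - P (2 * m - 3 * d) + P (2 * m - 3 * d - 1)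
              + P (m + 2 * d - 1) - P m + P (m - 2 * d) - P (m - 2 * d - 1)
              + P (2 * d) - 1) * (P m - 1) / (P (2 * d) - 1))]
  ++ [seq (P (m - 1)./2 * (P (m + 1)./2 - P (m - 1)./2 + e * eta),
           P (m + 2 * d) * (P 1 - 1) * (P m - P (m - d) - P (m - 2 * d) + 1)
             * (P m - 1) / (2 * (P (2 * d) - 1))) | e <- signs]
  ++ [seq (P (m + d - 2)./2 * (P 1 - 1) * (P (m - d)./2 + e),
           1 / 2 * P (3 * m - 3 * d)./2 * (P (m - d)./2 - e) * (P m - 1))
     | e <- signs]
  ++ [seq (P (m + d - 2)./2 * (P (m - d + 2)./2 - P (m - d)./2 + e),
           1 / 2 * P (3 * m - 3 * d)./2 * (P 1 - 1) * (P (m - d)./2 + e)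
             * (P m - 1)) | e <- signs]
  ++ [seq (P (m + 2 * d - 1)./2
             * (P (m - 2 * d + 1)./2 - P (m - 2 * d - 1)./2 + e * eta),
           P (m - 2 * d) * (P 1 - 1) * (P (m - d) - 1) * (P m - 1)
             / (2 * (P (2 * d) - 1))) | e <- signs]
  ++ [:: (P m, P 1 - 1)].

Definition table_even : seq (rat * rat) :=
  [:: (0, 1)]
  ++ [seq (P (s - 1) * (P 1 - 1) * (P s + e),
           P (m + 2 * d) * (P m - P (m - d) - P (m - 2 * d) + 1) * (P m - 1)
             / (2 * (P (2 * d) - 1))) | e <- signs]
  ++ [seq (P (s - 1) * (P (s + 1) - P s + e),
           P (m + 2 * d) * (P 1 - 1) * (P m - P (m - d) - P (m - 2 * d) + 1)
             * (P m - 1) / (2 * (P (2 * d) - 1))) | e <- signs]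
  ++ [seq (P (m + d - 2)./2 * (P 1 - 1) * (P (m - d)./2 + e),
           1 / 2 * P (3 * m - 3 * d)./2 * (P (m - d)./2 - e) * (P m - 1))
     | e <- signs]
  ++ [seq (P (m + d - 2)./2 * (P (m - d + 2)./2 - P (m - d)./2 + e),
           1 / 2 * P (3 * m - 3 * d)./2 * (P 1 - 1) * (P (m - d)./2 + e)
             * (P m - 1)) | e <- signs]
  ++ [seq (P (m + 2 * d - 2)./2 * (P 1 - 1) * (P (m - 2 * d)./2 + e),
           P (m - 2 * d) * (P (m - d) - 1) * (P m - 1)
             / (2 * (P (2 * d) - 1))) | e <- signs]
  ++ [seq (P (m + 2 * d - 2)./2 * (P (m - 2 * d + 2)./2 - P (m - 2 * d)./2 + e),
           P (m - 2 * d) * (P 1 - 1) * (P (m - d) - 1) * (P m - 1)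
             / (2 * (P (2 * d) - 1))) | e <- signs]
  ++ [:: (P (m - 1) * (P 1 - 1),
          P 1 * (P (2 * m - d) - P (2 * m - 2 * d) + P (2 * m - 3 * d)
                 - P (m - 2 * d) + 1) * (P m - 1));
         (P m, P 1 - 1)].

Definition mu : rat := (-1) ^+ (s %/ d).

Definition Q0 : rat :=
  (P (m + 6 * d) - P (m + 4 * d) - P (m + d) + mu * P (s + 5 * d)
   - mu * P (s + 4 * d) + P (6 * d)) * (P m - 1)
  / ((P d + 1) * (P (2 * d) - 1) * (P (3 * d) + 1)).

Definition Q1 : rat :=
  (P (m + 3 * d) + P (m + 2 * d) - P m - P (m - d) - P (m - 2 * d)
   - mu * P (s + 3 * d) + mu * P s + P (3 * d)) * (P m - 1)
  / ((P d + 1) ^+ 2 * (P (2 * d) - 1)).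

Definition Q2 : rat :=
  (P (s - d) + mu) * (P (s + d) + P s - P (s - 2 * d) - mu * P d) * (P m - 1)
  / ((P d + 1) ^+ 2 * (P (2 * d) - 1)).

Definition Q3 : rat :=
  (P (s - 2 * d) - mu) * (P (s - d) + mu) * (P m - 1)
  / ((P d + 1) * (P (2 * d) - 1) * (P (3 * d) + 1)).

(* In the multiplicity of the weight p^(m-1) (p - 1), the factor              *)
(* (p^d - 1) / (p^d + 1) on the terms - mu p^(3s-d) - mu p^(3s-8d) + p^(m-d)  *)
(* corrects a misprint: without it the multiplicities do not add up to        *)
(* p^(3m+1), the number of codewords.                                         *)
Definition table_double : seq (rat * rat) :=
  [:: (0, 1);
      (P (s - 1) * (P 1 - 1) * (P s - mu), P m * Q0);
      (P (s - 1) * (P (s + 1) - P s + mu), P m * (P 1 - 1) * Q0);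
      (P (s + d - 1) * (P 1 - 1) * (P (s - d) + mu), P (m - 2 * d) * Q1);
      (P (s + d - 1) * (P (s - d + 1) - P (s - d) - mu),
       P (m - 2 * d) * (P 1 - 1) * Q1);
      (P (s + 2 * d - 1) * (P 1 - 1) * (P (s - 2 * d) - mu),
       P (m - 4 * d) * Q2);
      (P (s + 2 * d - 1) * (P (s - 2 * d + 1) - P (s - 2 * d) + mu),
       P (m - 4 * d) * (P 1 - 1) * Q2);
      (P (s + 3 * d - 1) * (P 1 - 1) * (P (s - 3 * d) + mu),
       P (m - 6 * d) * Q3);
      (P (s + 3 * d - 1) * (P (s - 3 * d + 1) - P (s - 3 * d) - mu),
       P (m - 6 * d) * (P 1 - 1) * Q3);
      (P (m - 1) * (P 1 - 1),
       P 1 * (1 + (- mu * P (3 * s - d) - mu * P (3 * s - 8 * d) + P (m - d))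
                  * ((P d - 1) / (P d + 1))
              + (P (2 * m) + P (2 * m - 9 * d) + mu * P (3 * s - 3 * d)
                 - mu * P (3 * s - 5 * d) - P (m - 4 * d) - P (m - 6 * d))
                / (P d + 1)) * (P m - 1));
      (P m, P 1 - 1)].

End Tables.

(* Main.v *)
(* For fixed (a, b) the words of D come from the quadratic form               *)
(* f = Tr(a x^(p^(3l)+1) + b x^(p^l+1)).  If Tr(c x) vanishes on the radical  *)
(* of f, completing the square turns f + Tr(c x) + h into f(x + u) - t with t *)
(* running over F_p together with h; otherwise the word is equidistributed.   *)
(* So only the numbers of solutions of f(x) = t matter, and these depend on   *)
(* the size of the radical and on a sign: counting pairs with f(x) = f(y)     *)
(* gives p u^2 + v^2 = p^e for the deviations u, v from equidistribution, and *)
(* descent leaves a single solution up to sign.                               *)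
(*                                                                            *)
(* With s : x |-> x^(p^l), the radical is the kernel of a polynomial of       *)
(* degree 3 in s^2, hence of dimension at most 3 over the fixed field of s^2. *)
(*                                                                            *)
(* If d' = 2d, f is invariant under the p^d + 1 elements of norm one of       *)
(* F_(p^(2d)), so its character sum is 1 modulo p^d + 1 and the corank        *)
(* determines the sign.  The four corank frequencies follow from the first    *)
(* three moments, i.e. from counting isotropic vectors v of length <= 3: if v *)
(* and s^2 v are both orthogonal to s v and s^3 v, then v is proportional to  *)
(* a vector fixed by s^2.                                                     *)
(*                                                                            *)
(* If d' = d, corank 3 is impossible by a norm computation.  For a nonsquare  *)
(* e of F_(p^d), f_(a,b)(x) - e f_(a,b)(y) is a Hermitian form in disguise,   *)
(* being invariant under the conic u^2 - e v^2 = 1 with p^d + 1 points, which *)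
(* determines its character sum; its moment, with those of f and of           *)
(* f(x) - f(y), determines all frequencies.                                   *)

Require Import Defs.
From HB Require Import structures.
From mathcomp Require Import all_boot all_order all_algebra all_field all_solvable.
From mathcomp Require Import ring lra zify.

Set Implicit Arguments.
Unset Strict Implicit.
Unset Printing Implicit Defensive.

Import Order.TTheory GRing.Theory Num.Theory.
Local Open Scope ring_scope.

(** * Additive maps and quadratic forms on finite groups *)

(** Completing the square makes the weights of the words with quadratic part [f = dform a b] depend
    only on the numbers of solutions of [f x = t] ([codeword_fiber]), and these depend only on the
    corank of [f] and, in even rank, on one sign ([quadratic_even], [quadratic_odd]). So the theorem
    is a census of the pairs [(a, b)] by corank and sign, each class being weighted by
    [even_rank_count] or [odd_rank_count]. Character sums are integers recorded by [flat], so no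
    roots of unity are needed.

    Coranks. With [s x = x^(p^l)], the identity [Tr (s x) = Tr x] exhibits the radical as the kernel
    of a skew polynomial of degree 3 in [s^2] ([polar_dform], [radical_dform]). Its dimension over
    the fixed field of [s^2], which has [p^(d')] elements, is at most 3 ([card_skew_ker],
    [radical_card]). If d' = d, dimension 3 contradicts a norm identity ([full_skew_ker],
    [radical_card_odd]).

    Signs. An even-rank sum is plus or minus a power of p. If [p^d + 1] symmetries act freely on the
    nonzero vectors, the sum is 1 modulo [p^d + 1], which decides the sign ([flat_sign]). If d' = 2d
    the form itself has such symmetries ([even_form_flat]). If d' = d they exist for the twisted sum
    of two forms, [f(x) - e f(y)] ([twisted_flat]).

    Frequencies. Averaging over all [(a, b)] counts the common zeros of two diagonal equations
    ([trace_moment]). If d' = d, the number of pairs, the mean sum, the mean radical size and the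
    twisted moment determine corank 1 with its signs and the totals of coranks 0 and 2; when d is
    even, these totals split evenly between the signs ([odd_class_balanced]). If d' = 2d, the corank
    determines the sign, and the moments of order 0 to 3 form a Vandermonde system for the four
    coranks; the third moment counts points of a Hermitian curve ([card_isotropic_triples]).

    By [gcd_double_cases], m/d is either odd and at least 5 with d' = d, or even and at least 8 with
    d' = 2d. In both cases a nonzero pair has a nonzero polar form, so that distinct parameters give
    distinct words ([codeword_of_inj]) and the dimension is 3m + 1. *)

HB.instance Definition _ (V W : finZmodType) := GRing.Zmodule.on (V * W)%type.

Lemma card_setE (R : pzSemiRingType) (T : finType) (A : {set T}) (P : pred T) :
  #|[set x in A | P x]|%:R = \sum_(x in A) (P x)%:R :> R.
Proof.
rewrite -sum1_card natr_sum big_mkcond [RHS]big_mkcond.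
by apply: eq_bigr => x _; rewrite inE; case: (x \in A); case: (P x).
Qed.

Lemma card_setTE (R : pzSemiRingType) (T : finType) (P : pred T) :
  #|[set x | P x]|%:R = \sum_x (P x)%:R :> R.
Proof.
rewrite -sum1_card natr_sum big_mkcond.
by apply: eq_bigr => x _; rewrite inE; case: (P x).
Qed.

Lemma Fp_nat (p : nat) (t : 'F_p) : (t : nat)%:R = t.
Proof. exact: natr_Zp. Qed.

Lemma addf0 (V W : zmodType) (f : V -> W) : {morph f : x y / x + y} -> f 0 = 0.
Proof. by move=> fD; apply: (@addrI _ (f 0)); rewrite -fD !addr0. Qed.

Lemma addfN (V W : zmodType) (f : V -> W) : {morph f : x y / x + y} ->
  {morph f : x / - x}.
Proof. by move=> fD x; apply: (@addrI _ (f x)); rewrite -fD !subrr addf0. Qed.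

Lemma addfB (V W : zmodType) (f : V -> W) : {morph f : x y / x + y} ->
  {morph f : x y / x - y}.
Proof. by move=> fD x y; rewrite fD addfN. Qed.

Lemma addfMn (V W : zmodType) (f : V -> W) n : {morph f : x y / x + y} ->
  {morph f : x / x *+ n}.
Proof.
by move=> fD x; elim: n => [|n IHn]; rewrite ?mulr0n ?addf0 // !mulrS fD IHn.
Qed.

(** Finiteness replaces closure under negation: translation by [x] permutes [A], so [A] contains 0,
    and then the preimage of 0, which is [- x]. *)
Lemma closed_opp (V : finZmodType) (A : {set V}) (x : V) :
  {in A &, forall x y, x + y \in A} -> x \in A -> - x \in A.
Proof.
move=> AD Ax.
have imA : [set x + y | y in A] = A.
  apply/eqP; rewrite eqEcard card_imset ?leqnn ?andbT; last exact: addrI.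
  by apply/subsetP => _ /imsetP[y Ay ->]; exact: AD.
have A0 : 0 \in A.
  by move: Ax; rewrite -{1}imA => /imsetP[y Ay /eqP]; rewrite -{1}[x]addr0
    => /eqP /addrI ->.
by move: A0; rewrite -{1}imA => /imsetP[y Ay /eqP]; rewrite eq_sym addrC addr_eq0
  => /eqP <-.
Qed.

(** * Orthogonality relations by counting fibers *)

Section Fibers.

Variables (p : nat) (p_pr : prime p).

(** Multiples of [a] carry each fiber injectively into any other, because the multiples of [v]
    exhaust ['F_p]; hence all p fibers have the same size. *)
Lemma translation_fiber (V : finZmodType) (A : {set V}) (f : V -> 'F_p) a v :
    {in A, forall x, x + a \in A} -> {in A, forall x, f (x + a) = f x + v} ->
    v != 0 ->
  forall t, (p * #|[set x in A | f x == t]| = #|A|)%N.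
Proof.
move=> Aa fa v0 t.
have An n x : x \in A -> x + a *+ n \in A /\ f (x + a *+ n) = f x + v *+ n.
  move=> Ax; elim: n => [|n [An fn]]; first by rewrite !mulr0n !addr0.
  by rewrite !mulrSr !addrA Aa // fa // fn.
have le_fib s s' : (#|[set x in A | f x == s]| <= #|[set x in A | f x == s']|)%N.
  pose b := a *+ nat_of_ord ((s' - s) / v : 'F_p).
  rewrite -(card_imset _ (addIr b)); apply: subset_leq_card.
  apply/subsetP => _ /imsetP[x Ax ->]; move: Ax; rewrite inE => /andP[Ax /eqP fx].
  have [Axb fxb] := An (nat_of_ord ((s' - s) / v : 'F_p)) _ Ax.
  by rewrite inE Axb fxb fx -[_ *+ _]mulr_natr Fp_nat mulrC divfK // addrC subrK eqxx.
rewrite -[RHS]sum1_card (partition_big f predT) //=.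
transitivity (\sum_(s : 'F_p) #|[set x in A | f x == t]|)%N.
  by rewrite sum_nat_const card_Fp.
apply: eq_bigr => s _.
have -> : #|[set x in A | f x == t]| = #|[set x in A | f x == s]|.
  by apply/eqP; rewrite eqn_leq !le_fib.
by rewrite -sum1_card; apply: eq_bigl => x; rewrite inE.
Qed.

Lemma additive_fiber (V : finZmodType) (A : {set V}) (f : V -> 'F_p) (a : V) :
    {in A &, forall x y, x + y \in A} -> {morph f : x y / x + y} ->
    a \in A -> f a != 0 ->
  forall t, (p * #|[set x in A | f x == t]| = #|A|)%N.
Proof.
move=> AD fD Aa fa0; apply: (translation_fiber (a := a)) fa0 => x Ax.
  exact: AD.
exact: fD.
Qed.

Lemma additive_kernel (V : finZmodType) (A : {set V}) (f : V -> 'F_p) :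
    {in A &, forall x y, x + y \in A} -> {morph f : x y / x + y} ->
  (p * #|[set x in A | f x == 0%R]| =
     #|A| + (p - 1) * (#|A| * [forall x in A, f x == 0%R]))%N.
Proof.
move=> AD fD; case: (boolP [forall x in A, f x == 0]) => [/forall_inP f0|].
  rewrite muln1 -mulSn -subSn ?prime_gt0 // subn1 /=; congr (_ * _)%N.
  by apply: eq_card => x; rewrite inE; case: (boolP (x \in A)) => //= /f0.
rewrite negb_forall_in => /exists_inP[a Aa fa].
by rewrite (additive_fiber AD fD Aa fa) !muln0 addn0.
Qed.

(** For fixed [x] the zeros of [b x] are all of [B] or one p-th of it, according to whether [b x]
    vanishes on [B]. Summing over [x] gives what orthogonality of characters would give. *)
Lemma biadditive_zeros (V W : finZmodType) (A : {set V}) (B : {set W})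
    (b : V -> W -> 'F_p) :
    {in B &, forall x y, x + y \in B} ->
    (forall x, {morph b x : y z / y + z}) ->
  (p * \sum_(x in A) #|[set y in B | b x y == 0%R]| = #|A| * #|B| +
     (p - 1) * (#|[set x in A | [forall y in B, b x y == 0%R]]| * #|B|))%N.
Proof.
move=> BD bDr; rewrite big_distrr /=.
under eq_bigr => x _ do rewrite (additive_kernel BD (bDr x)).
rewrite big_split /= sum_nat_const -big_distrr -big_distrr /=.
congr (_ + _ * _)%N; rewrite mulnC; congr (_ * _)%N.
by rewrite -[RHS]sum1dep_card big_mkcondr; apply: eq_bigr => x _; case: ifP.
Qed.

(** Counting the zeros of [b] along [A] and along [B] gives the index formula for annihilators,
    which serves as a dimension count. *)
Lemma biadditive_kernels (V W : finZmodType) (A : {set V}) (B : {set W})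
    (b : V -> W -> 'F_p) :
    {in A &, forall x y, x + y \in A} -> {in B &, forall x y, x + y \in B} ->
    (forall x, {morph b x : y z / y + z}) ->
    (forall y, {morph b^~ y : x z / x + z}) ->
  (#|A| * #|[set y in B | [forall x in A, b x y == 0%R]]| =
   #|[set x in A | [forall y in B, b x y == 0%R]]| * #|B|)%N.
Proof.
move=> AD BD bDr bDl.
have E1 := biadditive_zeros A BD bDr.
have E2 := biadditive_zeros (b := fun y x => b x y) B AD bDl.
have E : (\sum_(x in A) #|[set y in B | b x y == 0%R]| =
          \sum_(y in B) #|[set x in A | b x y == 0%R]|)%N.
  under eq_bigr => x _ do rewrite -sum1dep_card big_mkcondr.
  by rewrite exchange_big; apply: eq_bigr => y _; rewrite -sum1dep_card -big_mkcondr.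
move: E1; rewrite E E2 [(#|B| * _)%N]mulnC => /addnI/eqP.
by rewrite eqn_pmul2l ?subn_gt0 ?prime_gt1 // mulnC => /eqP.
Qed.

End Fibers.

(** All orbits have the size of [G]. The action is a bare function with its laws as hypotheses, so
    that translations, scalings and the conic action need no group structure. *)
Lemma free_orbits (T U : finType) (G : {set U}) (act : U -> T -> T)
    (S : {set T}) :
    (forall u x, u \in G -> x \in S -> act u x \in S) ->
    (exists2 e, e \in G & act e =1 id) ->
    (forall u v, u \in G -> v \in G ->
       exists2 w, w \in G & forall x, act u (act v x) = act w x) ->
    (forall u, u \in G -> exists2 w, w \in G & forall x, act w (act u x) = x) ->
    (forall x, x \in S -> {in G &, injective (act^~ x)}) ->
  (#|G| %| #|S|)%N.
Proof.
move=> GS [e Ge e1] GM GV Gfree.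
pose R x y := y \in [set act u x | u in G].
have eqvR : {in S & &, equivalence_rel R}.
  move=> x y z Sx Sy Sz; split=> [|/imsetP[u Gu ->]].
    by apply/imsetP; exists e => //; rewrite e1.
  apply/imsetP/imsetP => [[v Gv ->]|[v Gv ->]].
    have [u' Gu' uK] := GV _ Gu; have [w Gw wE] := GM _ _ Gv Gu'.
    by exists w => //; rewrite -wE uK.
  by have [w Gw wE] := GM _ _ Gv Gu; exists w.
have -> : #|S| = (#|equivalence_partition R S| * #|G|)%N.
  apply: card_uniform_partition (equivalence_partitionP eqvR).
  move=> _ /imsetP[x Sx ->]; rewrite -(card_in_imset (Gfree x Sx)).
  apply: eq_card => y; rewrite inE; apply/andP/idP => [[]//|Ry]; split=> //.
  by case/imsetP: Ry => u Gu ->; apply: GS.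
exact: dvdn_mull.
Qed.

(** For [e >= 2], p divides [v], hence also [u], and dividing both by p lowers [e] by 2. The parity
    of [e] decides which of the base cases 0 and 1 is reached. *)
Lemma descent p u v e : prime p -> odd p -> (p * u ^ 2 + v ^ 2 = p ^ e)%N ->
  if odd e then v = 0%N else u = 0%N.
Proof.
move=> p_pr p_odd; have p_gt0 := prime_gt0 p_pr; have p_gt1 := prime_gt1 p_pr.
have p_gt2 := odd_prime_gt2 p_odd p_pr.
have dvd_step a b k : (p * a ^ 2 + b ^ 2 = p ^ k.+1)%N ->
    exists2 b', b = (p * b')%N & (a ^ 2 + p * b' ^ 2 = p ^ k)%N.
  move=> E; have /dvdnP[b' b'E] : (p %| b)%N.
    have : (p %| b ^ 2)%N
      by rewrite -(dvdn_addr (b ^ 2) (dvdn_mulr (a ^ 2) (dvdnn p))) E expnS dvdn_mulr.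
    by rewrite Euclid_dvdX // => /andP[].
  exists b'; first by rewrite mulnC.
  by apply/eqP; rewrite -(eqn_pmul2l p_gt0) -expnS -E b'E; apply/eqP; ring.
elim/ltn_ind: e u v => -[|[|e]] IHe u v E /=.
- by case: u E => // u E; move: E; rewrite expn0; nia.
- have [v' vE] := dvd_step _ _ _ E; rewrite expn0 => E'.
  by case: v' vE E' => [-> //|v' _]; [rewrite muln0 | nia].
have [v' vE E'] := dvd_step _ _ _ E.
have {}E' : (p * v' ^ 2 + u ^ 2 = p ^ e.+1)%N by rewrite addnC.
have [u' uE E''] := dvd_step _ _ _ E'.
have := IHe e _ u' v'; rewrite ltnS leqnSn addnC => /(_ isT E'').
by rewrite negbK; case: ifP => _ H; rewrite ?vE ?uE H muln0.
Qed.

(** * Squares and nonsquares in a finite field *)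

Section SquareClasses.

Variables (K : finFieldType) (K2 : 2%:R != 0 :> K).

(** Squaring maps [A] to itself and identifies 1 with -1, so it is not onto. A subset is allowed so
    that the lemma also applies to the fixed field of an automorphism. *)
Lemma finfield_nonsquare (A : {set K}) :
    1 \in A -> -1 \in A -> {in A, forall c, c ^+ 2 \in A} ->
  exists2 e, e \in A & {in A, forall c, c ^+ 2 != e}.
Proof.
move=> A1 AN1 A_sq.
have ltA : (#|[set c ^+ 2 | c in A]| < #|A|)%N.
  rewrite ltn_neqAle leq_imset_card andbT; apply/negP => /imset_injP inj.
  have /inj : (-1) ^+ 2 = 1 ^+ 2 :> K by rewrite sqrrN.
  by move/(_ AN1 A1)/eqP; rewrite -subr_eq0 -opprD oppr_eq0 (negPf K2).
have /subsetPn[e Ae eA] : ~~ (A \subset [set c ^+ 2 | c in A]).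
  by apply/negP => /subset_leq_card; rewrite leqNgt ltA.
by exists e => // c Ac; apply: contraNneq eA => <-; exact: imset_f.
Qed.

Lemma card_sqrts (t : K) : t != 0 ->
  #|[set c | c ^+ 2 == t]| = (2 * [exists c, c ^+ 2 == t])%N.
Proof.
move=> t0; case: existsP => [[c /eqP ct]|no].
  have c0 : c != 0 by apply: contraNneq t0 => c0; rewrite -ct c0 expr0n.
  have -> : [set c | c ^+ 2 == t] = [set c; - c].
    by apply/setP => b; rewrite !inE -ct eqf_sqr.
  rewrite cards2 -subr_eq0 opprK -mulr2n -mulr_natl mulf_eq0 (negPf K2).
  by rewrite (negPf c0).
rewrite muln0; apply: eq_card0 => c; rewrite inE.
by apply/negP => H; case: no; exists c.
Qed.

(** The nonzero squares and their multiples by [e] are disjoint and each fill half of the nonzero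
    elements, so [t] lies in exactly one of them and has two roots there. *)
Lemma square_classes : exists2 e : K, e != 0 &
  forall t, t != 0 ->
    (#|[set c | c ^+ 2 == t]| + #|[set c | e * c ^+ 2 == t]%R| = 2)%N.
Proof.
have [|||e _ eN] := @finfield_nonsquare setT; try by rewrite ?inE.
  by move=> c _; rewrite inE.
have e0 : e != 0 by apply/eqP=> E; have := eN 0; rewrite inE expr0n E eqxx => /(_ isT).
exists e => // t t0.
pose S := [set c ^+ 2 | c in [set~ (0 : K)]].
have inS t' : t' != 0 -> [exists c, c ^+ 2 == t'] = (t' \in S).
  move=> t'0; apply/existsP/imsetP => [[c /eqP ct]|[c _ ->]]; last by exists c.
  by exists c; rewrite // !inE; apply: contraNneq t'0 => c0; rewrite -ct c0 expr0n.
have S0 t' : t' \in S -> t' != 0.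
  by case/imsetP=> c; rewrite !inE => c0 ->; rewrite expf_neq0.
have cardS : (#|[set~ (0%R : K)]| = 2 * #|S|)%N.
  rewrite -sum1_card (partition_big (fun c => c ^+ 2) (mem S)) /=; last first.
    by move=> c c0; exact: imset_f.
  rewrite mulnC -sum_nat_const; apply: eq_bigr => t' St'.
  have t'0 := S0 _ St'.
  transitivity #|[set c | c ^+ 2 == t']|; last by rewrite card_sqrts // inS // St'.
  rewrite -sum1_card; apply: eq_bigl => c; rewrite !inE.
  by apply: andb_idl => /eqP ct; apply: contraNneq t'0 => c0; rewrite -ct c0 expr0n.
pose S' := [set e * s | s in S].
have SS' : [disjoint S & S'].
  apply/pred0P => x /=; apply/negP => /andP[/imsetP[c _ xc] /imsetP[s /imsetP[b]]].
  rewrite !inE => b0 -> xb; have := eN (c / b); rewrite inE => /(_ isT)/eqP; apply.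
  by rewrite expr_div_n -xc xb mulfK // expf_neq0.
have USS' : S :|: S' = [set~ 0].
  apply/eqP; rewrite eqEcard; apply/andP; split.
    apply/subsetP => x; rewrite !inE => /orP[/S0//|/imsetP[s /S0 s0 ->]].
    by rewrite mulf_neq0.
  have /eqP -> : #|S :|: S'| == (#|S| + #|S'|)%N by rewrite (leq_card_setU S S').
  by rewrite cardS (card_imset _ (mulfI e0)) mul2n addnn leqnn.
have et0 : t / e != 0 by rewrite mulf_neq0 ?invr_eq0.
have -> : [set c | e * c ^+ 2 == t] = [set c | c ^+ 2 == t / e].
  by apply/setP => c; rewrite !inE -(can_eq (mulfK e0) _ (t / e)) divfK // mulrC.
rewrite !card_sqrts // !inS //.
have : t \in S :|: S' by rewrite USS' !inE.
rewrite inE; case: (boolP (t \in S)) => [tS _|_ /= /imsetP[s sS ->]].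
  case: (boolP (t / e \in S)) => // teS.
  have /pred0P/(_ t) := SS'; rewrite /= tS => /negP[].
  by apply/imsetP; exists (t / e) => //; rewrite mulrC divfK.
by rewrite mulrAC divff // mul1r sS.
Qed.

Lemma sum_square_classes : exists2 e : K, e != 0 &
  forall (R : comPzRingType) (f : K -> R),
    (forall c t, c != 0 -> f (c ^+ 2 * t) = f t) ->
  2%:R * \sum_(t | t != 0) f t = (#|K|.-1)%:R * (f 1 + f e).
Proof.
have [e e0 cls] := square_classes; exists e => // R f f_inv.
have sum2 x : x != 0 ->
    \sum_(c : K | c != 0) f (x * c ^+ 2) =
    \sum_(t | t != 0) f t * #|[set c | x * c ^+ 2 == t]|%:R.
  move=> x0; rewrite (partition_big (fun c => x * c ^+ 2) (fun t => t != 0)) /=.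
    apply: eq_bigr => t t0; rewrite mulr_natr -sumr_const; apply: congr_big => //.
      move=> c; rewrite !inE; apply: andb_idl => /eqP ct.
      by apply: contraNneq t0 => c0; rewrite -ct c0 expr0n mulr0.
    by move=> c /andP[_ /eqP ->].
  by move=> c c0; rewrite mulf_neq0 // expf_neq0.
have cardK : #|[pred c : K | c != 0]| = #|K|.-1.
  by rewrite -(cardC1 (0 : K)); apply: eq_card.
have sum1 x : \sum_(c : K | c != 0) f (x * c ^+ 2) = (#|K|.-1)%:R * f x.
  rewrite (eq_bigr (fun=> f x)) => [|c c0]; last by rewrite mulrC f_inv.
  by rewrite sumr_const cardK mulr_natl.
rewrite mulrDr -!sum1 !sum2 ?oner_neq0 // -big_split mulr_sumr /=.
apply: eq_bigr => t t0; rewrite -mulrDr -natrD mulrC.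
suff -> : [set c | 1 * c ^+ 2 == t] = [set c | c ^+ 2 == t] by rewrite cls.
by apply/setP => c; rewrite !inE mul1r.
Qed.

End SquareClasses.

(** * Value distribution of quadratic forms over the prime field *)

Definition polar (V W : zmodType) (Q : V -> W) (x y : V) : W :=
  Q (x + y) - Q x - Q y.

(** Evenness together with a biadditive polar form yields homogeneity under integer multiples
    ([quadraticMn]), which covers all scalars of ['F_p]. *)
Definition quadratic (V W : zmodType) (Q : V -> W) : Prop :=
  (forall x, Q (- x) = Q x) /\ (forall x, {morph polar Q x : y z / y + z}).

Definition radical (V : finZmodType) (W : zmodType) (Q : V -> W) : {set V} :=
  [set x | [forall y, polar Q x y == 0]].

(* Equivalently, the sum over x of zeta^(f x), for zeta a primitive p-th root *)
(* of unity, is the integer S.                                               *)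
Definition flat (V : finZmodType) p (f : V -> 'F_p) (S : int) : Prop :=
  forall t, p%:R * #|[set x | f x == t]|%:R =
    #|V|%:R + S * (p%:R * (t == 0)%:R - 1).

Lemma polarC (V W : zmodType) (Q : V -> W) x y : polar Q x y = polar Q y x.
Proof. by rewrite /polar addrAC [y + x]addrC. Qed.

Lemma quadratic0 (V W : zmodType) (Q : V -> W) : quadratic Q -> Q 0 = 0.
Proof.
case=> _ QD; have := addf0 (QD 0).
by rewrite /polar addr0 subrr sub0r => /eqP; rewrite oppr_eq0 => /eqP.
Qed.

Lemma quadraticMn (V W : zmodType) (Q : V -> W) x n :
  quadratic Q -> Q (x *+ n) = Q x *+ n ^ 2.
Proof.
move=> Qq; have [QN QD] := Qq; have Q0 := quadratic0 Qq.
have Qxx : polar Q x x = Q x *+ 2.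
  apply/eqP; rewrite -[X in polar Q x X]opprK addfN // /polar subrr Q0 QN.
  by rewrite sub0r opprD !opprK.
elim: n => [|n IHn]; first by rewrite Q0.
have -> : Q (x *+ n.+1) = Q x + Q (x *+ n) + polar Q x (x *+ n).
  by rewrite mulrS /polar -[_ - Q x - _]addrA -opprD [RHS]addrC subrK.
rewrite IHn (addfMn _ (QD x)) Qxx -mulrnA -mulrS -mulrnDr.
by congr (_ *+ _); lia.
Qed.

Lemma radicalD (V : finZmodType) (W : zmodType) (Q : V -> W) : quadratic Q ->
  {in radical Q &, forall x y, x + y \in radical Q}.
Proof.
case=> _ QD x y; rewrite !inE => /forallP Qx /forallP Qy; apply/forallP => z.
by rewrite polarC QD ![polar Q z _]polarC (eqP (Qx z)) (eqP (Qy z)) addr0.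
Qed.

Section QuadraticCounts.

Variables (p : nat) (p_pr : prime p) (p_odd : odd p).
Variables (V : finZmodType) (V_p : forall x : V, x *+ p = 0).
Variables (Q : V -> 'F_p) (Qq : quadratic Q).

Local Notation N t := #|[set x | Q x == t]|.

Lemma two_divides (x y : V) : x *+ 2 = y *+ 2 -> x = y.
Proof.
move=> xy; have D z : z = (z *+ 2) *+ (p.+1)./2 :> V.
  by rewrite -mulrnA mul2n halfK /= p_odd subn0 mulrS V_p addr0.
by rewrite (D x) (D y) xy.
Qed.

Lemma Fp_two_neq0 : 2%:R != 0 :> 'F_p.
Proof.
rewrite -(dvdn_pcharf (pchar_Fp p_pr)) gtnNdvd //.
exact: odd_prime_gt2.
Qed.

(** The substitution [(x - y, x + y)], bijective in odd characteristic, turns [Q x = Q y] into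
    orthogonality for the polar form. *)
Lemma count_pairs :
  (p * #|[set z : V * V | Q z.1 == Q z.2]| =
     #|V| ^ 2 + (p - 1) * (#|radical Q| * #|V|))%N.
Proof.
have [QN QD] := Qq.
pose phi (z : V * V) := (z.1 - z.2, z.1 + z.2).
have phiI : injective phi.
  move=> [x y] [x' y'] [/= E1 E2].
  have Ex : x = x'.
    have : (x - y) + (x + y) = (x' - y') + (x' + y') by rewrite E1 E2.
    by rewrite addrACA addNr addr0 addrACA addNr addr0 -!mulr2n => /two_divides.
  by move: E2; rewrite Ex => /addrI ->.
have -> : #|[set z : V * V | Q z.1 == Q z.2]| =
          #|[set z : V * V | polar Q z.1 z.2 == 0]|.
  rewrite -[RHS](on_card_preimset (f := phi)); last by apply: onW_bij; apply: injF_bij.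
  apply: eq_card => -[x y]; rewrite !inE /=.
  have -> : polar Q (x - y) (x + y) = (Q x - Q y) * 2%:R.
    rewrite polarC.
    have -> : polar Q (x + y) (x - y) = polar Q x x - polar Q y y.
      rewrite (QD _ x (- y)) (addfN (QD (x + y))) !(polarC Q (x + y)) !QD.
      by rewrite (polarC Q y x); ring.
    have Qxx z : polar Q z z = Q z * 2%:R.
      rewrite /polar -mulr2n quadraticMn // -[_ *+ _]mulr_natr; ring.
    by rewrite !Qxx mulrBl.
  by rewrite mulf_eq0 (negPf Fp_two_neq0) orbF subr_eq0.
have := biadditive_zeros p_pr [set: V] (B := [set: V]) (b := polar Q).
move=> /(_ (fun _ _ _ _ => in_setT _) QD); rewrite cardsT => E.
rewrite expnS expn1.
have -> : radical Q = [set x in [set: V] | [forall y in [set: V], polar Q x y == 0]].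
  by apply/setP => x; rewrite !inE /=; apply: eq_forallb => y; rewrite inE.
rewrite -E; congr (_ * _)%N.
rewrite -sum1_card (eq_bigl (fun z : V * V => predT z.1 && (polar Q z.1 z.2 == 0))).
  rewrite -(pair_big_dep predT (fun x y => polar Q x y == 0) (fun _ _ => 1%N)) /=.
  apply: eq_big => [x|x _]; rewrite ?inE //.
  by rewrite -[RHS]sum1_card; apply: eq_bigl => y; rewrite !inE.
by move=> z; rewrite inE.
Qed.

Lemma sum_count_squares :
  (p * \sum_t N t ^ 2 = #|V| ^ 2 + (p - 1) * (#|radical Q| * #|V|))%N.
Proof.
rewrite -count_pairs; congr (_ * _)%N.
rewrite -sum1_card (partition_big (fun z => Q z.1) predT) //=.
apply: eq_bigr => t _; rewrite expnS expn1 -cardsX -sum1_card; apply: eq_bigl.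
move=> z; rewrite !inE; case: (Q z.1 =P t) => [<-|_]; rewrite ?andbT ?andbF //.
Qed.

Lemma count_scale c t : c != 0 -> N (c ^+ 2 * t) = N t.
Proof.
move=> c0; pose phi (x : V) := x *+ nat_of_ord c.
have phiK : cancel phi (fun x => x *+ nat_of_ord c^-1).
  move=> x; rewrite /phi -mulrnA; set k := (_ * _)%N.
  have k1 : (k %% p = 1)%N.
    have kE : k%:R = 1%:R :> 'F_p by rewrite natrM !Fp_nat divff.
    by rewrite -(val_Fp_nat p_pr k) kE (val_Fp_nat p_pr 1) modn_small ?prime_gt1.
  by rewrite (divn_eq k p) k1 mulrnDr mulnC mulrnA V_p mul0rn add0r.
rewrite -[LHS](on_card_preimset (f := phi)).
  apply: eq_card => x; rewrite !inE /phi quadraticMn // -mulr_natl natrX Fp_nat.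
  by rewrite (inj_eq (mulfI _)) // expf_neq0.
by apply: onW_bij; apply: injF_bij; exact: can_inj phiK.
Qed.

Lemma count_even t : t != 0 -> (2 %| N t)%N.
Proof.
move=> t0; have [QN _] := Qq.
rewrite -card_bool -cardsT; pose act b (x : V) := if b then - x else x.
apply: (@free_orbits _ _ _ act).
- by move=> u x _; rewrite !inE /act; case: u => //; rewrite QN.
- by exists false.
- by move=> u v _ _; exists (u (+) v) => // x; case: u v => -[] //=; rewrite opprK.
- by move=> u _; exists u => // x; case: u => //=; rewrite opprK.
move=> x; rewrite inE => /eqP Qx.
have xx : x != - x.
  apply: contraNneq t0 => xx; have x0 : x = 0.
    by apply: two_divides; rewrite mul0rn mulr2n {2}xx subrr.
  by rewrite -Qx x0 (quadratic0 Qq) eqxx.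
by move=> [] [] _ _ //= /eqP; rewrite ?(negPf xx) // eq_sym (negPf xx).
Qed.

End QuadraticCounts.

Section ValueCounts.

Variables (p : nat) (p_pr : prime p) (p_odd : odd p).
Variables (V : finZmodType) (V_p : forall x : V, x *+ p = 0).
Variables (Q : V -> 'F_p) (Qq : quadratic Q).
Variables (n r : nat).
Hypotheses (n_gt0 : (0 < n)%N) (cardV : #|V| = (p ^ n)%N)
  (cardR : #|radical Q| = (p ^ r)%N).

Local Notation N t := (#|[set x | Q x == t]|).

Lemma sum_count : (\sum_t N t = p ^ n)%N.
Proof.
rewrite -cardV -[RHS]sum1_card (partition_big Q predT) //=.
by apply: eq_bigr => t _; rewrite -sum1_card; apply: eq_bigl => x; rewrite inE.
Qed.

Lemma count_classes : exists e : 'F_p, exists a b : nat,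
  [/\ e != 0, N 1 = a.*2, N e = b.*2
    & forall (R : comPzRingType) (g : nat -> R),
        2%:R * \sum_t g (N t) =
        2%:R * g (N 0%R) + (p%:R - 1) * (g (a.*2) + g (b.*2))].
Proof.
have [e e0 sumE] := sum_square_classes (Fp_two_neq0 p_pr p_odd).
have half t : t != 0 -> N t = (N t)./2.*2.
  move=> t0; have := count_even p_odd V_p Qq t0.
  by rewrite dvdn2 => ev; rewrite -{1}[N t]odd_double_half (negPf ev).
exists e, (N 1)./2, (N e)./2; split=> //; rewrite -?half ?oner_neq0 //.
move=> R g; rewrite (bigD1 0) //= mulrDr; congr (_ + _).
rewrite sumE ?card_Fp // => [|c t c0]; last by rewrite count_scale.
by rewrite -subn1 natrB ?prime_gt0.
Qed.


(** With counts [2a] and [2b] on the two square classes, [u = a + b - p^(n-1)] is the mean deviation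
    from equidistribution and [v = a - b] is half the difference. They are integers by [count_even],
    and the first two moments combine into the Diophantine equation. *)
Lemma count_descent : exists e : 'F_p, exists u v : int,
  [/\ p%:R * u ^+ 2 + v ^+ 2 = p%:R ^+ (n + r).-1 :> int,
      (N 0%R)%:R = p%:R ^+ n.-1 - (p%:R - 1) * u :> int
    & forall (R : comPzRingType) (g : int -> R),
        2%:R * \sum_t g (N t)%:R = 2%:R * g (N 0%R)%:R
          + (p%:R - 1) * (g (p%:R ^+ n.-1 + u + v) + g (p%:R ^+ n.-1 + u - v))].
Proof.
have [e [a [b [e0 Na Nb sumE]]]] := count_classes.
exists e, ((a + b)%:R - p%:R ^+ n.-1), (a%:R - b%:R).
have pn : p%:R ^+ n = p%:R * p%:R ^+ n.-1 :> int by rewrite -exprS prednK.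
have p0 : p%:R != 0 :> int by rewrite pnatr_eq0 -lt0n prime_gt0.
have p1 : (p%:R - 1 : int) != 0.
  by rewrite subr_eq0 -[1]/(1%:R) eqr_nat gtn_eqF ?prime_gt1.
have E1 : (N 0%R)%:R + (p%:R - 1) * (a + b)%:R = p%:R ^+ n :> int.
  have /(congr1 (fun k => 2%:R * k%:R : int)) := sum_count.
  rewrite natr_sum sumE natrX -!mul2n natrM natrM natrD => E.
  by apply: (@mulfI int 2%:R) => //; rewrite -E; ring.
have E2 : p%:R * ((N 0%R)%:R ^+ 2 + 2%:R * (p%:R - 1) * (a%:R ^+ 2 + b%:R ^+ 2)) =
    p%:R ^+ n ^+ 2 + (p%:R - 1) * (p%:R ^+ r * p%:R ^+ n) :> int.
  have /(congr1 (fun k => 2%:R * k%:R : int)) := sum_count_squares p_pr p_odd V_p Qq.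
  rewrite cardV cardR natrM natr_sum mulrCA.
  have := sumE int (fun k => k%:R ^+ 2) => /=.
  under eq_bigr => t _ do rewrite -natrX.
  move=> -> E; apply: (@mulfI int 2%:R) => //.
  have -> : p%:R ^+ n ^+ 2 + (p%:R - 1) * (p%:R ^+ r * p%:R ^+ n) =
    ((p ^ n) ^ 2 + (p - 1) * (p ^ r * p ^ n))%N%:R :> int.
    by rewrite natrD !natrM !natrX natrB ?prime_gt0.
  by rewrite -E -!mul2n !natrM; ring.
have E0 : (N 0%R)%:R = p%:R ^+ n.-1 - (p%:R - 1) * ((a + b)%:R - p%:R ^+ n.-1) :> int.
  by apply/eqP; rewrite eq_sym subr_eq -subr_eq0; apply/eqP; move: E1; rewrite pn; nia.
split=> //.
- have -> : (n + r).-1 = (n.-1 + r)%N by lia.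
  rewrite exprD; apply: (mulfI p1); apply: (mulfI p0).
  move: E2; rewrite E0 pn natrD; set P := p%:R ^+ n.-1; set A := a%:R; set B := b%:R.
  move=> E2; apply/eqP; rewrite -subr_eq0; apply/eqP.
  transitivity (p%:R * ((P - (p%:R - 1) * (A + B - P)) ^+ 2 +
      2%:R * (p%:R - 1) * (A ^+ 2 + B ^+ 2)) - ((p%:R * P) ^+ 2 +
      (p%:R - 1) * (p%:R ^+ r * (p%:R * P))) : int); first by ring.
  by rewrite E2 subrr.
move=> R g; have /= -> := sumE R (fun k => g k%:R).
congr (_ + _ * (g _ + g _)).
  by rewrite -mul2n natrM natrD; ring.
by rewrite -mul2n natrM natrD; ring.
Qed.

(** The exponent [n + r - 1] is odd, so descent kills [v]: both square classes are hit equally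
    often, and the character sum is [- p u]. *)
Lemma quadratic_even : ~~ odd (n + r) ->
  exists b : bool, flat Q ((-1) ^+ b * p%:R ^+ (n + r)./2).
Proof.
move=> ev; have [_ [u [v [uvE N0 sumE]]]] := count_descent.
have p0 := prime_gt0 p_pr.
have pn : p%:R ^+ n = p%:R * p%:R ^+ n.-1 :> int by rewrite -exprS prednK.
have uv_nat : (p * `|u| ^ 2 + `|v| ^ 2 = p ^ (n + r).-1)%N.
  apply/eqP; rewrite -(eqr_nat int) natrD natrM !natrX -uvE.
  by rewrite !natz !abszE !real_normK ?num_real.
have v0 : v = 0.
  apply/eqP; rewrite -absz_eq0; apply/eqP.
  have := descent p_pr p_odd uv_nat.
  by rewrite -[(n + r)%N]prednK ?addn_gt0 ?n_gt0 //= in ev *; rewrite negbK in ev; rewrite ev.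
have k_gt0 : (0 < (n + r)./2)%N by case: (n + r)%N ev (addn_gt0 n r) => [|[|]] //=; rewrite n_gt0.
have uE : `|u|%N = (p ^ (n + r)./2.-1)%N.
  have : (p * `|u| ^ 2 = p * (p ^ (n + r)./2.-1) ^ 2)%N.
    rewrite -expnM -expnS; move: uv_nat; rewrite v0 addn0 => ->; congr (_ ^ _)%N.
    by move: ev k_gt0; lia.
  by move/eqP; rewrite eqn_pmul2l // eqn_exp2r // => /eqP.
(* The sum is [- p u], so the sign bit is set when [u] is nonnegative. *)
exists (0 <= u)%R => t; rewrite cardV natrX pn.
have pu : (-1) ^+ (0 <= u)%R * p%:R ^+ (n + r)./2 = - (p%:R * u).
  rewrite -(prednK k_gt0) exprS -natrX -uE (natz `|u|%N) abszE.
  case: (lerP 0 u) => u0; first by rewrite ger0_norm //; ring.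
  by rewrite ltr0_norm //; ring.
rewrite pu; case: (eqVneq t 0) => [->|t0] /=; first by rewrite N0; ring.
have E : (N t)%:R = p%:R ^+ n.-1 + u :> int.
  apply/eqP; rewrite -subr_eq0 -sqrf_eq0.
  (* Applied to the squared deviation from [p^(n-1) + u], the formula leaves only the term of
     [t = 0], so the deviation vanishes at every nonzero [t]. *)
  have := sumE int (fun k => (k - (p%:R ^+ n.-1 + u)) ^+ 2).
  move=> sE0; have sE : 2%:R * \sum_t ((N t)%:R - (p%:R ^+ n.-1 + u)) ^+ 2 =
      2%:R * ((N 0%R)%:R - (p%:R ^+ n.-1 + u)) ^+ 2 :> int by rewrite sE0 v0; ring.
  have {}sE : \sum_(t : 'F_p | t != 0%R) ((N t)%:R - (p%:R ^+ n.-1 + u)) ^+ 2 = 0 :> int.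
    have := mulfI (isT : 2%:R != 0 :> int) sE; rewrite (bigD1 0) //= => /eqP.
    by rewrite -subr_eq0 addrAC subrr add0r => /eqP.
  have sq_ge0 (i : 'F_p) : i != 0%R ->
    0 <= ((N i)%:R - (p%:R ^+ n.-1 + u)) ^+ 2 :> int by rewrite sqr_ge0.
  by apply/eqP; apply: (psumr_eq0P sq_ge0 sE).
by rewrite E; ring.
Qed.

(** Now descent kills [u] and determines [v] up to sign. Which square class gets which sign stays
    open: only sums over all [t] enter the weight distribution. *)
Lemma quadratic_odd : odd (n + r) ->
  N 0 = (p ^ n.-1)%N /\ forall (R : comPzRingType) (g : int -> R),
    2%:R * \sum_t g (N t)%:R = 2%:R * g (p%:R ^+ n.-1) + (p%:R - 1) *
      (g (p%:R ^+ n.-1 + p%:R ^+ (n + r)./2) + g (p%:R ^+ n.-1 - p%:R ^+ (n + r)./2)).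
Proof.
move=> od; have [_ [u [v [uvE N0 sumE]]]] := count_descent.
have p0 := prime_gt0 p_pr.
have uv_nat : (p * `|u| ^ 2 + `|v| ^ 2 = p ^ (n + r).-1)%N.
  apply/eqP; rewrite -(eqr_nat int) natrD natrM !natrX -uvE.
  by rewrite !natz !abszE !real_normK ?num_real.
have u0 : u = 0.
  apply/eqP; rewrite -absz_eq0; apply/eqP.
  have := descent p_pr p_odd uv_nat.
  rewrite -[(n + r)%N]prednK ?addn_gt0 ?n_gt0 //= in od.
  by rewrite (negPf od).
have vE : `|v|%N = (p ^ (n + r)./2)%N.
  apply/eqP; rewrite -(eqn_exp2r _ _ (isT : 0 < 2)%N) -expnM; apply/eqP.
  move: uv_nat; rewrite u0 muln0 add0n => ->; congr (_ ^ _)%N.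
  by move: od; lia.
have N0E : N 0 = (p ^ n.-1)%N.
  by apply/eqP; rewrite -(eqr_nat int) N0 u0 mulr0 subr0 natrX.
split=> // R g; rewrite sumE N0E u0 natrX !addr0.
have pE : p%:R ^+ (n + r)./2 = `|v| by rewrite -natrX -vE natz abszE.
rewrite pE; case: (lerP 0 v) => v0; first by rewrite ger0_norm.
by rewrite ltr0_norm // opprK [X in (_ - 1) * X]addrC.
Qed.

End ValueCounts.

(** * Calculus of character sums *)

Section Flat.

Variables (p : nat) (p_pr : prime p).

(** The value counts of a direct sum are convolutions, so character sums multiply. *)
Lemma flat_conv (V W : finZmodType) (f : V -> 'F_p) (g : W -> 'F_p) S S' :
  flat f S -> flat g S' -> flat (fun z : V * W => f z.1 + g z.2) (S * S').
Proof.
move=> fS gS t; have p0 : p%:R != 0 :> int by rewrite pnatr_eq0 -lt0n prime_gt0.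
apply: (mulfI p0).
have -> : #|[set z : V * W | f z.1 + g z.2 == t]|%:R =
    \sum_(s : 'F_p) #|[set x | f x == s]|%:R * #|[set y | g y == t - s]|%:R :> int.
  rewrite (eq_bigr (fun s => #|setX [set x | f x == s] [set y | g y == t - s]|%:R)).
    rewrite -natr_sum; congr (_%:R).
    rewrite -sum1_card (partition_big (fun z => f z.1) predT) //=.
    apply: eq_bigr => s _; rewrite -sum1_card; apply: eq_bigl => z.
    rewrite !inE; case: (f z.1 =P s) => [->|]; rewrite ?andbF // andbT /=.
    by rewrite [RHS]eq_sym subr_eq eq_sym addrC.
  by move=> s _; rewrite cardsX natrM.
rewrite card_prod natrM mulrA mulr_sumr.
rewrite (eq_bigr (fun s : 'F_p => (#|V|%:R + S * (p%:R * (s == 0%R)%:R - 1)) *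
   (#|W|%:R + S' * (p%:R * (s == t)%:R - 1)))); last first.
  by move=> s _; rewrite mulrACA fS gS subr_eq0 [t == s]eq_sym.
have sum_const (c : int) : \sum_(s : 'F_p) c = p%:R * c.
  by rewrite sumr_const card_Fp // mulr_natl.
have sum_delta (u : 'F_p) (h : 'F_p -> int) : \sum_s (s == u)%:R * h s = h u.
  rewrite (bigD1 u) //= eqxx mul1r big1 ?addr0 // => s /negPf ->; exact: mul0r.
transitivity (\sum_(s : 'F_p) ((#|V|%:R - S) * (#|W|%:R - S')
    + (s == 0%R)%:R * (S * p%:R * (#|W|%:R - S' + S' * p%:R * (0%R == t)%:R))
    + (s == t)%:R * (S' * p%:R * (#|V|%:R - S)))).
  apply: eq_bigr => s _; case: (eqVneq s 0%R) => [->|_] /=; last by rewrite !mul0r; ring.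
  by rewrite !mul1r; ring.
rewrite !big_split /= sum_const (sum_delta 0%R (fun=> _)) (sum_delta t (fun=> _)).
by rewrite [0%R == t]eq_sym; ring.
Qed.

Lemma flat_zeros (V : finZmodType) (f : V -> 'F_p) S :
  flat f S -> p%:R * #|[set x | f x == 0]|%:R = #|V|%:R + (p%:R - 1) * S.
Proof. by move=> fS; rewrite fS eqxx mulr1 mulrC. Qed.

(** [S] is the number of zeros minus the number of solutions of [f x = 1]. All vectors but 0 are
    counted in multiples of [p^d + 1], so [S] is 1 modulo [p^d + 1]. Since [p^d] is -1 there, the
    wrong sign would make [p^d + 1] divide 2. *)
Lemma flat_sign (V : finZmodType) (f : V -> 'F_p) (b : bool) d i :
    odd p -> (0 < d)%N -> f 0 = 0 ->
    (forall t, (p ^ d).+1 %| #|[set x | (x != 0%R) && (f x == t)]|)%N ->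
    flat f ((-1) ^+ b * p%:R ^+ (d * i)) ->
  flat f ((- p%:R ^+ d) ^+ i).
Proof.
move=> p_odd d0 f0 dvd fS; set S := _ * _ in fS.
have p0 : p%:R != 0 :> int by rewrite pnatr_eq0 -lt0n prime_gt0.
have ES : S = #|[set x | f x == 0]|%:R - #|[set x | f x == 1]|%:R.
  apply: (mulfI p0); rewrite mulrBr fS fS eqxx oner_eq0 /=; ring.
have /dvdnP[k kE] := dvd 0; have /dvdnP[k' k'E] := dvd 1.
have N0 : #|[set x | f x == 0]| = (k * (p ^ d).+1).+1.
  rewrite (cardD1 0%R) inE f0 eqxx /= add1n -kE; congr _.+1.
  by apply: eq_card => x; rewrite !inE.
have N1 : #|[set x | f x == 1]| = (k' * (p ^ d).+1)%N.
  rewrite -k'E; apply: eq_card => x; rewrite !inE; case: (eqVneq x 0) => //= ->.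
  by rewrite f0 eq_sym oner_eq0.
have {}ES : S = 1 + (k%:R - k'%:R) * (p%:R ^+ d + 1).
  rewrite ES N0 N1 mulrS !natrM -[(p ^ d).+1]addn1 natrD natrX; ring.
have [w wE] : exists w : int, p%:R ^+ d ^+ i = (-1) ^+ i + w * (p%:R ^+ d + 1).
  exists (\sum_(j < i) p%:R ^+ d ^+ (i.-1 - j) * (-1) ^+ j).
  by rewrite -[LHS](subrK ((-1) ^+ i)) subrXX opprK addrC [in RHS]mulrC.
case: (boolP (odd b == odd i)) => [/eqP bi|bi].
  suff -> : (- p%:R ^+ d) ^+ i = S by [].
  by rewrite /S exprM exprNn -[in LHS]signr_odd -bi signr_odd.
have {}bi : (-1) ^+ i = - (-1) ^+ b :> int.
  rewrite -[LHS]signr_odd -[in RHS]signr_odd; by case: (odd i) (odd b) bi => -[].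
have E2 : 2%:R = - (k%:R - k'%:R - (-1) ^+ b * w) * (p%:R ^+ d + 1) :> int.
  have bb : (-1) ^+ b * (-1) ^+ b = 1 :> int by rewrite -expr2 sqrr_sign.
  move: ES; rewrite /S exprM wE bi mulrDr mulrN bb => ES.
  by transitivity (1 - (-1) : int) => //; apply/eqP; rewrite -subr_eq0; apply/eqP; move: ES; nia.
have := congr1 absz E2; rewrite abszM => E3.
have : ((p ^ d).+1 %| 2)%N.
  apply/dvdnP; exists `|- (k%:R - k'%:R - (-1) ^+ b * w)|%N.
  by rewrite -[2%N]/(`|2%:R : int|%N) E3; congr (_ * _)%N; rewrite -natrX natr1 natz.
move/dvdn_leq => /(_ isT) le2; have p2 := odd_prime_gt2 p_odd p_pr.
have : (p <= p ^ d)%N by rewrite -{1}[p]expn1 leq_exp2l ?prime_gt1.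
by move: le2 p2; lia.
Qed.

End Flat.

(** * Finite fields and linearized polynomials *)

Section FinFieldPowers.

Variable F : finFieldType.

Lemma finfield_unity (x : F) : x != 0 -> x ^+ #|F|.-1 = 1.
Proof.
move=> x0; apply: (mulfI x0).
by rewrite -exprS prednK ?expf_card ?mulr1 // ltnW // finNzRing_gt1.
Qed.

Lemma finfield_prim_root : exists z : F, (#|F|.-1).-primitive_root z.
Proof.
have gt1 := finNzRing_gt1 F.
have : has (#|F|.-1).-primitive_root (enum [pred x : F | x != 0]).
  apply: has_prim_root; rewrite ?enum_uniq -?subn1 ?subn_gt0 //.
    apply/allP => x; rewrite mem_enum inE unity_rootE subn1 => x0.
    by rewrite finfield_unity.
  rewrite -cardE subn1 -(cardC1 (0 : F)); apply: eq_leq; apply: eq_card => x.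
  by rewrite !inE.
by case/hasP=> z _ pz; exists z.
Qed.

Lemma card_unity_roots n :
  (n %| #|F|.-1)%N -> #|[set x : F | x ^+ n == 1]| = n.
Proof.
have [z pz] := finfield_prim_root => dvd_n.
have pn := dvdn_prim_root pz dvd_n; set w := z ^+ _ in pn.
have -> : [set x : F | x ^+ n == 1] = [set w ^+ nat_of_ord i | i : 'I_n].
  apply/setP => x; rewrite inE; apply/eqP/imsetP => [/(prim_rootP pn)[i ->]|[i _ ->]].
    by exists i.
  by rewrite exprAC (prim_expr_order pn) expr1n.
rewrite card_imset ?card_ord // => i j /eqP.
by rewrite (eq_prim_root_expr pn) !modn_small // => /eqP/val_inj.
Qed.

Lemma finfield_root n k (y : F) :
  (n * k)%N = #|F|.-1 -> y ^+ k = 1 -> exists x, x ^+ n = y.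
Proof.
have [z pz] := finfield_prim_root => nk yk.
have k_gt0 : (0 < k)%N.
  by case: k nk {yk} => //; rewrite muln0 => /esym; have := prim_order_gt0 pz; case: #|F|.-1.
have pk : k.-primitive_root (z ^+ n).
  by have := dvdn_prim_root pz (m := k); rewrite -{2}nk mulnK // -nk dvdn_mull // => ->.
by have [i ->] := prim_rootP pk yk; exists (z ^+ i); rewrite exprAC.
Qed.

Variables (p m : nat).
Hypotheses (p_pr : prime p) (cardF : #|F| = (p ^ m)%N).

Lemma pcharF : p \in [pchar F].
Proof. exact: card_finPcharP cardF p_pr. Qed.

Lemma expF_frob i : {morph (fun x : F => x ^+ (p ^ i)) : x y / x + y}.
Proof.
move=> x y; apply: exprDn_pchar.
by rewrite pnatX (pnatE _ p_pr) pcharF.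
Qed.

Definition fixed_field i : {set F} := [set x | x ^+ (p ^ i) == x].

Lemma fixed_field_iter i k x : x \in fixed_field i -> x \in fixed_field (k * i).
Proof.
rewrite !inE => /eqP xi; elim: k => [|k IHk]; first by rewrite expn0 expr1.
by rewrite mulSn expnD exprM xi.
Qed.

Lemma fixed_field_full x : x \in fixed_field m.
Proof. by rewrite inE -cardF expf_card. Qed.

(** Bezout, using that the [m]-th iterate of Frobenius is the identity. *)
Lemma fixed_field_gcd i : (0 < i)%N -> fixed_field i = fixed_field (gcdn m i).
Proof.
move=> i0; apply/setP => x; apply/idP/idP; last first.
  have /dvdnP[k {2}->] := dvdn_gcdr m i; exact: fixed_field_iter.
move=> xi; rewrite gcdnC; case: (egcdnP m i0) => a b abE _.
have := fixed_field_iter a xi; rewrite abE !inE expnD exprM.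
by have := fixed_field_iter b (fixed_field_full x); rewrite inE => /eqP ->.
Qed.

Lemma card_fixed_field g : (0 < g)%N -> (g %| m)%N -> #|fixed_field g| = (p ^ g)%N.
Proof.
move=> g0 /dvdnP[k mE].
have pg1 : (1 < p ^ g)%N by rewrite -(expn0 p) ltn_exp2l ?prime_gt1.
rewrite (cardD1 0) inE expr0n gtn_eqF ?expn_gt0 ?prime_gt0 // eqxx add1n.
rewrite -[RHS]prednK ?(ltnW pg1) //; congr _.+1.
have dv : (((p ^ g).-1) %| #|F|.-1)%N by rewrite cardF mE mulnC expnM dvdn_pred_predX.
rewrite -[RHS](card_unity_roots dv); apply: eq_card => x; rewrite !inE.
case: (eqVneq x 0) => [->|x0] /=.
  by rewrite expr0n eq_sym; case: (p ^ g)%N pg1 => [|[|n]] //= _; rewrite oner_eq0.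
by rewrite -{1}(prednK (ltnW pg1)) exprS -[X in _ == X]mulr1 (inj_eq (mulfI x0)).
Qed.

End FinFieldPowers.

(** * Skew polynomials and their kernels *)

Section SkewPolynomials.

Variables (F : finFieldType) (tau : {rmorphism F -> F}).
Implicit Types (s : seq F) (x y : F).

(** The list holds the coefficients of an element of the skew polynomial ring [F[tau]], constant
    term first. *)
Fixpoint skew_eval s x : F :=
  if s is c :: s' then c * x + skew_eval s' (tau x) else 0.

Definition skew_ker s : {set F} := [set x | skew_eval s x == 0].

Local Notation fixed := [set x | tau x == x].

Lemma skew_evalD s : {morph skew_eval s : x y / x + y}.
Proof.
elim: s => [|c s IHs] x y /=; first by rewrite addr0.
by rewrite rmorphD IHs mulrDr addrACA.
Qed.

(** Right multiplication by the scalar [x]; it moves a root [x] to the root 1. *)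
Fixpoint skew_shift s x : seq F :=
  if s is c :: s' then c * x :: skew_shift s' (tau x) else [::].

Lemma size_skew_shift s x : size (skew_shift s x) = size s.
Proof. by elim: s x => //= c s IHs x; rewrite IHs. Qed.

Lemma skew_shiftE s x y : skew_eval (skew_shift s x) y = skew_eval s (x * y).
Proof. by elim: s x y => //= c s IHs x y; rewrite IHs rmorphM mulrA. Qed.

Lemma skew_shift_neq0 s x :
  x != 0 -> has (fun c => c != 0) (skew_shift s x) = has (fun c => c != 0) s.
Proof.
elim: s x => //= c s IHs x x0.
by rewrite mulf_eq0 (negPf x0) orbF IHs // fmorph_eq0.
Qed.

Lemma last_skew_shift c s x :
  last (c * x) (skew_shift s (tau x)) = last c s * iter (size s) tau x.
Proof. by elim: s c x => //= c' s IHs c x; rewrite IHs -iterSr. Qed.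

(** Right division of [a :: s] by [tau - 1]: the quotient has the negated partial sums as
    coefficients, and the sum of all coefficients is the obstruction to exactness. *)
Fixpoint skew_quotient (a : F) s : seq F :=
  if s is c :: s' then - a :: skew_quotient (a + c) s' else [::].

Lemma skew_quotientE a s x :
  a * x + skew_eval s (tau x) =
  skew_eval (skew_quotient a s) (tau x - x)
    + (a + \sum_(c <- s) c) * iter (size s) tau x.
Proof.
elim: s a x => [|c s IHs] a x /=; first by rewrite big_nil !addr0 add0r.
have := IHs (a + c) (tau x); rewrite -iterSr -rmorphB mulrDl => E.
rewrite big_cons [a + (c + _)]addrA /=.
have -> : a * x + (c * tau x + skew_eval s (tau (tau x))) =
  - a * (tau x - x) + (a * tau x + c * tau x + skew_eval s (tau (tau x))) by ring.
by rewrite E addrA.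
Qed.

Lemma size_skew_quotient a s : size (skew_quotient a s) = size s.
Proof. by elim: s a => //= c s IHs a; rewrite IHs. Qed.

Lemma skew_quotient_neq0 a s : a + \sum_(c <- s) c = 0 ->
  has (fun c => c != 0) (a :: s) -> has (fun c => c != 0) (skew_quotient a s).
Proof.
elim: s a => [|c s IHs] a /=; first by rewrite big_nil addr0 => ->; rewrite eqxx.
rewrite big_cons oppr_eq0 addrA => sum0; case: (eqVneq a 0) => //= a0.
by move: sum0; rewrite a0 add0r => sum0 H; apply: IHs.
Qed.

Lemma last_skew_quotient a c s : a + \sum_(c' <- c :: s) c' = 0 ->
  last (- a) (skew_quotient (a + c) s) = last c s.
Proof.
elim: s a c => [|c' s IHs] a c /=.
  by rewrite big_cons big_nil addr0 => /eqP; rewrite addr_eq0 => /eqP ->; rewrite opprK.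
by rewrite big_cons addrA => /IHs.
Qed.

Lemma card_fixed_gt1 : (1 < #|fixed|)%N.
Proof.
apply/card_gt1P; exists 0, 1.
by rewrite !inE rmorph0 rmorph1 !eqxx eq_sym oner_neq0.
Qed.

Lemma skew_eval1 s : skew_eval s 1 = \sum_(c <- s) c.
Proof.
by elim: s => [|c s IHs] /=; rewrite ?big_nil // big_cons rmorph1 IHs mulr1.
Qed.

(** Once the root [x] is moved to 1, [tau - 1] splits off on the right. The map [phi] sends the
    kernel into that of the quotient, and its fibers lie in cosets of the fixed field times [x]; so
    a root costs at most one factor [#|fixed|]. *)
Lemma skew_ker_divide c s x : x != 0 -> skew_eval (c :: s) x = 0 ->
  let s' := skew_quotient (c * x) (skew_shift s (tau x)) in
  [/\ size s' = size s,
      c * x + \sum_(b <- skew_shift s (tau x)) b = 0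
    & (#|skew_ker (c :: s)| <= #|fixed| * #|skew_ker s'|)%N].
Proof.
move=> x0 sx s'.
have sum0 : c * x + \sum_(b <- skew_shift s (tau x)) b = 0.
  by rewrite -skew_eval1 skew_shiftE mulr1.
split=> //; first by rewrite size_skew_quotient size_skew_shift.
pose phi y := tau (y / x) - y / x.
have phiK y : y \in skew_ker (c :: s) -> phi y \in skew_ker s'.
  rewrite !inE => /eqP sy; have := skew_quotientE (c * x) (skew_shift s (tau x)) (y / x).
  rewrite sum0 mul0r addr0 skew_shiftE -mulrA -rmorphM [x * _]mulrC divfK // => <-.
  by rewrite -sy.
rewrite -[leqLHS]sum1_card (partition_big phi (mem (skew_ker s'))) //=.
rewrite mulnC -sum_nat_const; apply: leq_sum => z _.
rewrite sum1dep_card.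
case: (set_0Vmem [set y in skew_ker (c :: s) | phi y == z]) => [->|[y0]].
  by rewrite cards0.
rewrite inE => /andP[_ /eqP y0z].
have -> : #|fixed| = #|[set y0 + w * x | w in fixed]|.
  by rewrite card_imset // => u v /addrI/(mulIf x0).
apply: subset_leq_card; apply/subsetP => y; rewrite inE => /andP[_ /eqP yz].
apply/imsetP; exists ((y - y0) / x); last by rewrite divfK // addrC subrK.
rewrite inE mulrBl rmorphB -subr_eq0.
have -> : tau (y / x) - tau (y0 / x) - (y / x - y0 / x) = phi y - phi y0.
  by rewrite /phi; ring.
by rewrite yz y0z subrr.
Qed.

Lemma card_skew_ker s : has (fun c => c != 0) s ->
  (#|skew_ker s| <= #|fixed| ^ (size s).-1)%N.
Proof.
have [n] := ubnP (size s); elim: n s => // n IHn [//|c s] /= le_n nz.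
have fix0 : (0 < #|fixed|)%N by apply: ltnW; exact: card_fixed_gt1.
case: (set_0Vmem (skew_ker (c :: s) :\ 0)) => [E|[x]].
  apply: (@leq_trans 1%N); last by rewrite expn_gt0 fix0.
  by rewrite (cardsD1 0) E cards0 addn0 leq_b1.
rewrite !inE => /andP[x0 /eqP sx].
have [sz sum0 le] := skew_ker_divide x0 sx.
have nz' : has (fun c => c != 0) (skew_shift (c :: s) x) by rewrite skew_shift_neq0.
have nzq := skew_quotient_neq0 sum0 nz'.
apply: (leq_trans le); case: s le_n {nz} sx sz sum0 le nz' nzq => [|c' s] le_n sx sz _ _ _ nzq.
  by rewrite /= in nzq.
rewrite expnS leq_mul2l; apply/orP; right.
by have := IHn _ _ nzq; rewrite sz; apply.
Qed.

(* The product of the [tau y / y] over the successive right factors          *)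
(* [tau - tau y / y] is the constant term up to sign.                        *)
Lemma full_skew_ker c s : has (fun a => a != 0) (c :: s) ->
    #|skew_ker (c :: s)| = (#|fixed| ^ size s)%N ->
  c != 0 /\ exists2 w, w != 0 & c * w = (-1) ^+ size s * last c s * tau w.
Proof.
have fix1 := card_fixed_gt1.
move sz: (size s) => n; elim: n s c sz => [|n IHn] [|c' s] c //= sz nz full.
  by split; [rewrite orbF in nz | exists 1; rewrite ?oner_eq0 // rmorph1 expr0 mul1r].
have [E|[x]] := set_0Vmem (skew_ker [:: c, c' & s] :\ 0).
  have : (1 < #|fixed| ^ n.+1)%N by rewrite -(expn0 #|fixed|) ltn_exp2l.
  by rewrite -full (cardsD1 0) E cards0 addn0; case: (0 \in _).
rewrite !inE => /andP[x0 /eqP sx].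
have [sq sum0 le] := skew_ker_divide x0 sx.
have nz' : has (fun a => a != 0) (skew_shift [:: c, c' & s] x) by rewrite skew_shift_neq0.
pose q := skew_quotient (c * x + c' * tau x) (skew_shift s (tau (tau x))).
have nzq : has (fun a => a != 0) (- (c * x) :: q) := skew_quotient_neq0 sum0 nz'.
have lastq : last (- (c * x)) q = last (c' * tau x) (skew_shift s (tau (tau x))).
  exact: last_skew_quotient sum0.
have szq : size q = n by move: sz => [<-]; rewrite size_skew_quotient size_skew_shift.
have [|] := IHn q (- (c * x)) szq nzq.
  apply/eqP; rewrite eqn_leq; apply/andP; split.
    by have := card_skew_ker nzq; rewrite /= szq.
  by rewrite -(leq_pmul2l (ltnW fix1)) -expnS -full.
rewrite oppr_eq0 mulf_eq0 negb_or => /andP[c0 _] [w w0 wE].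
(* This product telescopes: [tau y] has the iterate [n + 1] of [x] where [y] has [x] itself. That
   iterate is the factor which moving the root to 1 puts on the leading coefficient. *)
split=> //; pose y := \prod_(i < n.+1) iter i tau x.
have y0 : y != 0.
  apply/prodf_neq0 => i _; elim: (i : nat) => //= j; by rewrite fmorph_eq0.
exists (w * y); first by rewrite mulf_neq0.
have yE : tau y * x = y * iter n.+1 tau x.
  transitivity (\prod_(i < n.+2) iter i tau x); last by rewrite big_ord_recr.
  by rewrite big_ord_recl mulrC rmorph_prod.
apply: (mulIf x0); rewrite rmorphM.
have -> : c * (w * y) * x = - (- (c * x) * w * y) by ring.
rewrite wE lastq last_skew_shift.
have -> : (-1) ^+ n.+1 * last c' s * (tau w * tau y) * x =
  (-1) ^+ n.+1 * last c' s * tau w * (tau y * x) by ring.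
have -> : size s = n by case: sz.
by rewrite yE exprS iterSr; ring.
Qed.

End SkewPolynomials.

(** * The trace as a nondegenerate pairing *)

Section TraceTheory.

Variables (p m : nat) (F : finFieldType).
Hypotheses (p_pr : prime p) (cardF : #|F| = (p ^ m)%N).

Local Notation Tr := (@Defs.Tr p m F).
Let pF := pcharF p_pr cardF.

Lemma card_exponent_gt0 : (0 < m)%N.
Proof. by case: m cardF => // F1; have := finNzRing_gt1 F; rewrite F1. Qed.

Lemma natrF_mod k : (k %% p)%N%:R = k%:R :> F.
Proof. by rewrite [in RHS](divn_eq k p) natrD natrM (pcharf0 pF) mulr0 add0r. Qed.

Lemma Fp_natD (t u : 'F_p) : ((t + u)%R : nat)%:R = (t : nat)%:R + (u : nat)%:R :> F.
Proof.
rewrite -natrD -natrF_mod -[in RHS]natrF_mod; congr (_%:R).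
by rewrite -(val_Fp_nat p_pr) -(val_Fp_nat p_pr (_ + _)) natrD !Fp_nat.
Qed.

Lemma Fp_nat_inj (t u : 'F_p) : (t : nat)%:R = (u : nat)%:R :> F -> t = u.
Proof.
have ND : {morph (fun t : 'F_p => (t : nat)%:R : F) : x y / x + y} := Fp_natD.
move=> tu; have : ((t - u)%R : nat)%:R = 0 :> F by rewrite (addfB ND) tu subrr.
move/eqP; rewrite -(dvdn_pcharf pF) => dv; apply/eqP; rewrite -subr_eq0; apply/eqP.
have lt : (nat_of_ord (t - u)%R < p)%N by rewrite [X in (_ < X)%N](esym (Fp_cast p_pr)) ltn_ord.
rewrite -[t - u]Fp_nat; case: (posnP (t - u)%R) => [-> //|gt0].
by have := dvdn_leq gt0 dv; rewrite leqNgt lt.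
Qed.

Lemma traceD : {morph Tr : x y / x + y}.
Proof.
move=> x y; apply: Fp_nat_inj; rewrite Fp_natD !TrP // /trace_sum -big_split /=.
by apply: eq_bigr => i _; apply: (expF_frob p_pr cardF).
Qed.

Lemma trace_frob (x : F) k : Tr (x ^+ (p ^ k)) = Tr x.
Proof.
elim: k => [|k IHk]; first by rewrite expn0 expr1.
rewrite expnSr exprM -[RHS]IHk; move: (x ^+ _) => {IHk}x.
apply: Fp_nat_inj; rewrite !TrP // /trace_sum.
case: m card_exponent_gt0 cardF => // k' _ cF.
rewrite big_ord_recr big_ord_recl /= addrC; congr (_ + _).
  by rewrite -exprM -expnS -cF expf_card expn0 expr1.
by apply: eq_bigr => i _; rewrite -exprM -expnS.
Qed.

(** Otherwise the trace polynomial, of degree at most [p^(m-1)], would vanish on all [p^m]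
    elements. *)
Lemma trace_surj : exists x : F, Tr x != 0.
Proof.
apply/existsP; apply: contraT; rewrite negb_exists => /forallP Tr0.
pose P : {poly F} := \sum_(i < m) 'X^(p ^ i).
have P0 : P != 0.
  apply/eqP => P0; have := congr1 (fun Q : {poly F} => Q`_1) P0.
  rewrite coef0 /P coef_sum; case: m card_exponent_gt0 => // k _.
  rewrite big_ord_recl expn0 coefXn eqxx big1 ?addr0 => [/eqP|i _].
    by rewrite oner_eq0.
  rewrite coefXn ltn_eqF // -(expn0 p) ltn_exp2l ?prime_gt1 //.
have /(max_poly_roots P0) : all (root P) (enum F).
  apply/allP => x _; rewrite rootE /P horner_sum; apply/eqP.
  transitivity (trace_sum p m x); first by apply: eq_bigr => i _; rewrite hornerXn.
  by rewrite -TrP //; have := Tr0 x; rewrite negbK => /eqP ->.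
rewrite enum_uniq -cardE cardF => /(_ isT); rewrite ltnNge => /negP[].
apply: (leq_trans (size_sum _ _ _)); apply/bigmax_leqP => i _.
by rewrite size_polyXn ltn_exp2l ?prime_gt1.
Qed.

Lemma trace_nondeg (x : F) : (forall y, Tr (x * y) = 0) -> x = 0.
Proof.
move=> Txy; apply/eqP; apply: contraT => x0; have [y] := trace_surj.
by rewrite -[y](mulVKf x0) Txy eqxx.
Qed.

Lemma mulrnF_p (x : F) : x *+ p = 0.
Proof. by rewrite -mulr_natl (pcharf0 pF) mul0r. Qed.

Lemma frob_rmorphism l : exists s : {rmorphism F -> F}, s =1 (fun x => x ^+ (p ^ l)).
Proof.
elim: l => [|l [s sE]]; first by exists idfun => x; rewrite expn0 expr1.
exists (pFrobenius_aut pF \o s : {rmorphism F -> F}) => x /=.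
by rewrite sE pFrobenius_autE -exprM -expnSr.
Qed.

End TraceTheory.

Lemma dvdn_pred_exp p a r :
  (1 < p)%N -> (0 < a)%N -> ((p ^ a).-1 %| (p ^ r).-1)%N -> (a %| r)%N.
Proof.
move=> p1 a0; have [n] := ubnP r; elim: n r => // n IHn r.
have pk k : (0 < p ^ k)%N by rewrite expn_gt0 ltnW.
case: (ltnP r a) => [lt_ra _|le_ar lt_rn].
  case: r lt_ra => // r lt_ra dv.
  have p1r : (1 < p ^ r.+1)%N by rewrite -(expn0 p) ltn_exp2l.
  have H : (p ^ r.+1 < p ^ a)%N by rewrite ltn_exp2l.
  have {}le : ((p ^ a).-1 <= (p ^ r.+1).-1)%N by apply: dvdn_leq dv; lia.
  by exfalso; move: (p ^ a)%N (p ^ r.+1)%N p1r le H => A B; lia.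
rewrite -[in X in X -> _](subnK le_ar).
have -> : ((p ^ (r - a + a)).-1 = p ^ (r - a) * (p ^ a).-1 + (p ^ (r - a)).-1)%N.
  by rewrite expnD; have := pk a; have := pk (r - a)%N; nia.
rewrite dvdn_addr ?dvdn_mull // => dv; rewrite -(subnK le_ar) dvdn_addl //.
by apply: IHn => //; lia.
Qed.

(** * The quadratic forms of the code *)

Section Forms.

Variables (p m l : nat) (F : finFieldType).
Hypotheses (p_pr : prime p) (p_odd : odd p) (cardF : #|F| = (p ^ m)%N).
Hypothesis (l_gt0 : (0 < l)%N).
Variable s : {rmorphism F -> F}.
Hypothesis sE : s =1 (fun x => x ^+ (p ^ l)).

Local Notation Tr := (@Defs.Tr p m F).
Let pF := pcharF p_pr cardF.
Let TrD : {morph Tr : x y / x + y} := traceD p_pr cardF.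

Definition frob2 : {rmorphism F -> F} := s \o s.
Local Notation tau := frob2.
Local Notation s3 x := (s (s (s x))).

Lemma s3E x : s3 x = x ^+ (p ^ (3 * l)).
Proof. by rewrite !sE -!exprM -!expnD; congr (_ ^+ (_ ^ _)); rewrite !mulSn addn0 addnA. Qed.

Definition dform (a b x : F) : 'F_p :=
  Tr (a * x ^+ (p ^ (3 * l) + 1) + b * x ^+ (p ^ l + 1)).

Lemma dformE a b x : dform a b x = Tr (a * (s3 x * x) + b * (s x * x)).
Proof. by rewrite /dform !exprD !expr1 s3E sE. Qed.

Lemma trace_s x : Tr (s x) = Tr x.
Proof. by rewrite sE trace_frob. Qed.

Definition radical_poly (a b : F) : seq F := [:: a; s (s b); s3 b; s3 a].

(** Each of the four terms is moved by [Tr (s x) = Tr x] until [y] occurs as [s3 y]. Only even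
    powers of [s] then act on [x], which is why the radical is a space over the fixed field of
    [s^2]. *)
Lemma polar_dform a b x y :
  polar (dform a b) x y = Tr (skew_eval tau (radical_poly a b) x * s3 y).
Proof.
have -> : polar (dform a b) x y =
    Tr (a * (s3 x * y) + a * (s3 y * x) + b * (s x * y) + b * (s y * x)).
  rewrite /polar !dformE -!(addfB TrD) !rmorphD; congr Tr; ring.
rewrite !TrD -[Tr (a * (s3 x * y))]trace_s -[Tr (s (a * _))]trace_s -[Tr (s (s (a * _)))]trace_s.
rewrite -[Tr (b * (s x * y))]trace_s -[Tr (s (b * _))]trace_s -[Tr (s (s (b * (s x * y))))]trace_s.
rewrite -[Tr (b * (s y * x))]trace_s -[Tr (s (b * _))]trace_s.
rewrite -!TrD !rmorphM /=; congr Tr; ring.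
Qed.

Lemma s_bij : bijective s.
Proof. exact/injF_bij/fmorph_inj. Qed.

Lemma s3_surj y : exists z, s3 z = y.
Proof.
by have [g _ gK] := s_bij; exists (g (g (g y))); rewrite !gK.
Qed.

Lemma quadratic_dform a b : quadratic (dform a b).
Proof.
split=> [x|x y z]; last by rewrite !polar_dform -TrD !rmorphD mulrDr.
by rewrite !dformE !rmorphN !mulrNN.
Qed.

Lemma radical_dform a b : radical (dform a b) = skew_ker tau (radical_poly a b).
Proof.
apply/setP => x; rewrite !inE; apply/forallP/eqP => [Rx|x0 y]; last first.
  by rewrite polar_dform x0 mul0r (addf0 TrD).
apply: (trace_nondeg p_pr cardF) => y; have [z <-] := s3_surj y.
by apply/eqP; rewrite -polar_dform.
Qed.

Lemma radical_poly_neq0 a b :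
  (a, b) != (0, 0) -> has (fun c => c != 0) (radical_poly a b).
Proof.
by rewrite xpair_eqE negb_and /= !fmorph_eq0; case: (a != 0) (b != 0) => -[].
Qed.

Local Notation D := (gcdn m (2 * l)).

Lemma D_gt0 : (0 < D)%N. Proof. by rewrite gcdn_gt0 muln_gt0 l_gt0 orbT. Qed.

Lemma tau_fixed : [set x | tau x == x] = fixed_field F p D.
Proof.
rewrite -(fixed_field_gcd cardF) ?muln_gt0 ?l_gt0 //; apply/setP => x.
by rewrite !inE /= !sE -exprM -expnD addnn mul2n.
Qed.

Lemma card_tau_fixed : #|[set x | tau x == x]| = (p ^ D)%N.
Proof. by rewrite tau_fixed (card_fixed_field p_pr cardF) ?D_gt0 ?dvdn_gcdl. Qed.

Lemma skew_evalZ (t : seq F) c x : tau c = c ->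
  skew_eval tau t (c * x) = c * skew_eval tau t x.
Proof.
move=> tc; elim: t x => [|e t IHt] x /=; first by rewrite mulr0.
by rewrite -[s (s (c * x))]/(tau (c * x)) rmorphM tc IHt mulrDr mulrCA.
Qed.

Lemma subgroup_card (A : {set F}) : 0 \in A ->
  {in A &, forall x y, x + y \in A} -> exists r, #|A| = (p ^ r)%N.
Proof.
move=> A0 AD; suff : (#|A| %| #|F|)%N.
  by rewrite cardF => /(dvdn_pfactor _ _ p_pr)[r _ ->]; exists r.
rewrite -cardsT; apply: (@free_orbits _ _ A (fun u x => u + x)).
- by move=> *; rewrite inE.
- by exists 0 => // x; rewrite add0r.
- by move=> u v Au Av; exists (u + v) => [|x]; rewrite ?AD ?addrA.
- by move=> u Au; exists (- u) => [|x]; rewrite ?closed_opp // addKr.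
by move=> x _ u v _ _ /addIr.
Qed.

(** The nonzero fixed elements act freely on the nonzero elements of [A], so [p^D - 1] divides
    [p^r - 1] and hence [D] divides [r]. *)
Lemma tau_subspace_card (A : {set F}) : 0 \in A ->
    {in A &, forall x y, x + y \in A} ->
    (forall c x, tau c = c -> x \in A -> c * x \in A) ->
  exists j, #|A| = (p ^ (D * j))%N.
Proof.
move=> A0 AD AZ; have [r cA] := subgroup_card A0 AD.
suff /dvdnP[j rE] : (D %| r)%N by exists j; rewrite cA rE mulnC.
apply: (dvdn_pred_exp (prime_gt1 p_pr) D_gt0).
have -> : (p ^ D).-1 = #|[set x | tau x == x] :\ 0|.
  by rewrite -card_tau_fixed (cardsD1 0) inE rmorph0 eqxx.
have -> : (p ^ r).-1 = #|A :\ 0| by rewrite -cA (cardsD1 0) A0.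
apply: (@free_orbits _ _ _ (fun u x => u * x)).
- move=> u x; rewrite !inE => /andP[u0 /eqP tu] /andP[x0 Ax].
  by rewrite mulf_neq0 // AZ.
- by exists 1 => [|x]; rewrite ?mul1r // !inE rmorph1 oner_eq0 eqxx.
- move=> u v; rewrite !inE => /andP[u0 /eqP tu] /andP[v0 /eqP tv].
  by exists (u * v) => [|x]; rewrite ?mulrA // !inE rmorphM tu tv mulf_neq0 //= eqxx.
- move=> u; rewrite !inE => /andP[u0 /eqP tu].
  by exists u^-1 => [|x]; rewrite ?mulKf // !inE fmorphV tu invr_eq0 u0 eqxx.
by move=> x; rewrite !inE => /andP[x0 _] u v _ _ /(mulIf x0).
Qed.

Lemma radical_card a b : (a, b) != (0, 0) ->
  exists2 j, (j <= 3)%N & #|radical (dform a b)| = (p ^ (D * j))%N.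
Proof.
move=> ab0; rewrite radical_dform.
have [||c x tc|j cR] := @tau_subspace_card (skew_ker tau (radical_poly a b)).
- by rewrite inE (addf0 (skew_evalD tau _)).
- move=> x y; rewrite !inE => /eqP Rx /eqP Ry.
  by rewrite skew_evalD Rx Ry addr0.
- by rewrite !inE skew_evalZ // => /eqP ->; rewrite mulr0.
exists j => //; have := card_skew_ker tau (radical_poly_neq0 ab0).
rewrite cR card_tau_fixed /= -expnM leq_exp2l ?prime_gt1 //.
by rewrite leq_pmul2l ?D_gt0.
Qed.

(* The norm of [w] over an odd number of iterates of [s] cannot satisfy      *)
(* [N = - N].                                                                *)
Lemma radical_card_odd k a b : odd k -> iter k s =1 id -> (a, b) != (0, 0) ->
  exists2 j, (j <= 2)%N & #|radical (dform a b)| = (p ^ (D * j))%N.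
Proof.
move=> k_odd sk ab0; have [j j3 cR] := radical_card ab0.
exists j => //; rewrite leqNgt; apply/negP => j2.
have {j2 j3} j3 : j = 3%N by lia.
have [||a0 [w w0 E]] := @full_skew_ker _ tau a [:: s (s b); s3 b; s3 a].
- exact: radical_poly_neq0.
- by rewrite -/(radical_poly a b) -radical_dform cR card_tau_fixed -expnM j3.
pose N x := \prod_(i < k) iter i s x.
have NM x y : N (x * y) = N x * N y.
  by rewrite -big_split; apply: eq_bigr => i _; elim: (i : nat) => //= n ->; rewrite rmorphM.
have Ns x : N (s x) = N x.
  case: k {k_odd} sk @N NM => [|k] sk N NM; first by rewrite /N !big_ord0.
  rewrite /N [RHS]big_ord_recl big_ord_recr mulrC.
  by congr (_ * _); [apply: eq_bigr => i _; rewrite -iterSr | rewrite -iterSr sk].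
have NN1 : N (-1) = -1.
  transitivity (\prod_(i < k) (-1 : F)); last first.
    by rewrite prodr_const card_ord -signr_odd k_odd.
  by apply: eq_bigr => i _; elim: (i : nat) => //= n ->; rewrite rmorphN1.
have N0 x : x != 0 -> N x != 0.
  by move=> x0; apply/prodf_neq0 => i _; elim: (i : nat) => //= n; rewrite fmorph_eq0.
have := congr1 N E; rewrite /= exprS expr2 mulrNN mulr1 mulr1 !NM !Ns NN1 mulN1r mulNr.
move/eqP; rewrite -subr_eq0 opprK -mulr2n -mulr_natl mulf_eq0 mulf_eq0.
rewrite (negPf (N0 _ a0)) (negPf (N0 _ w0)) !orbF -(dvdn_pcharf pF) gtnNdvd //.
exact: odd_prime_gt2.
Qed.

End Forms.

(** * Direct sums of forms and moments over all pairs [(a, b)] *)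

Section DirectSum.

Variables (V W : finZmodType) (U : zmodType) (f : V -> U) (g : W -> U).
Hypotheses (fq : quadratic f) (gq : quadratic g).

Definition dirsum (z : V * W) : U := f z.1 + g z.2.

Lemma polar_dirsum x y : polar dirsum x y = polar f x.1 y.1 + polar g x.2 y.2.
Proof. by rewrite /polar /dirsum !opprD [_ + (- f x.1 - _)]addrACA [LHS]addrACA. Qed.

Lemma quadratic_dirsum : quadratic dirsum.
Proof.
have [fN fD] := fq; have [gN gD] := gq.
split=> [x|x y z]; first by rewrite /dirsum fN gN.
by rewrite !polar_dirsum fD gD addrACA.
Qed.

Lemma card_radical_dirsum : #|radical dirsum| = (#|radical f| * #|radical g|)%N.
Proof.
have [fN fD] := fq; have [gN gD] := gq.
rewrite -cardsX; apply: eq_card => -[x y]; rewrite !inE /=.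
apply/forallP/andP => [R0|[/forallP Rx /forallP Ry] [x' y']].
  split; apply/forallP => z.
    by have := R0 (z, 0); rewrite polar_dirsum /= (addf0 (gD y)) addr0.
  by have := R0 (0, z); rewrite polar_dirsum /= (addf0 (fD x)) add0r.
by rewrite polar_dirsum /= (eqP (Rx x')) (eqP (Ry y')) addr0.
Qed.

End DirectSum.

Section Moments.

Variables (p m : nat) (F : finFieldType).
Hypotheses (p_pr : prime p) (cardF : #|F| = (p ^ m)%N).

Local Notation Tr := (@Defs.Tr p m F).

(** For fixed [x], the additive map sending [(a, b)] to [Tr (a * A x + b * B x)] is identically zero
    only if [A x = B x = 0], by nondegeneracy; exchange the two sums. When the function is flat, the
    summand on the left is [p - 1] times its character sum. *)
Lemma trace_moment (X : finType) (A B : X -> F) :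
  \sum_(ab : F * F)
     (p%:R * #|[set x | Tr (ab.1 * A x + ab.2 * B x) == 0%R]|%:R - #|X|%:R) =
  (p%:R - 1) * (#|F|%:R ^+ 2 * #|[set x | (A x == 0%R) && (B x == 0%R)]|%:R) :> int.
Proof.
have TrD := traceD p_pr cardF.
have ker x : p%:R * #|[set ab : F * F | Tr (ab.1 * A x + ab.2 * B x) == 0%R]|%:R =
    #|F|%:R ^+ 2 + (p%:R - 1) * (#|F|%:R ^+ 2 * ((A x == 0%R) && (B x == 0%R))%:R) :> int.
  have LD : {morph (fun ab : F * F => Tr (ab.1 * A x + ab.2 * B x)) : y z / y + z}.
    by move=> [a b] [a' b']; rewrite -TrD /=; congr Tr; ring.
  have E := additive_kernel p_pr (A := [set: F * F]) (fun _ _ _ _ => in_setT _) LD.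
  have -> : [set ab : F * F | Tr (ab.1 * A x + ab.2 * B x) == 0] =
    [set ab in [set: F * F] | Tr (ab.1 * A x + ab.2 * B x) == 0].
    by apply/setP => ab; rewrite !inE.
  rewrite -natrM E cardsT card_prod natrD !natrM natrB ?prime_gt0 // -expr2.
  congr (_ + _ * (_ * (nat_of_bool _)%:R)).
  apply/forall_inP/andP => [T0|[/eqP -> /eqP ->] ab _]; last by rewrite !mulr0 addr0 (addf0 TrD).
  split; apply/eqP; apply: (trace_nondeg p_pr cardF) => y; apply/eqP.
    by have := T0 (y, 0); rewrite inE mul0r addr0 mulrC; apply.
  by have := T0 (0, y); rewrite inE mul0r add0r mulrC; apply.
rewrite sumrB -mulr_sumr sumr_const card_prod.
under eq_bigr => ab _ do rewrite card_setTE.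
rewrite exchange_big mulr_sumr.
under eq_bigr => x _ do rewrite -card_setTE ker.
rewrite big_split /= sumr_const -!mulr_sumr -card_setTE -[_ *+ #|X|]mulr_natr.
by rewrite -[X in _ - X]mulr_natr natrM; ring.
Qed.

End Moments.

Lemma pair_mulrn (V W : zmodType) (z : V * W) n : z *+ n = (z.1 *+ n, z.2 *+ n).
Proof. by case: z => x y; elim: n => [|n IHn] //=; rewrite !mulrS IHn. Qed.

(** * The conic of norm one elements *)

Section Conic.

Variables (F : finFieldType) (s : {rmorphism F -> F}) (e : F).
Hypotheses (F2 : 2%:R != 0 :> F) (se : s e = e).
Hypothesis (e_nsq : forall c, s c = c -> c ^+ 2 != e).

(** The norm one elements [u.1 + u.2 sqrt e] of the quadratic extension of the fixed field of [s],
    in coordinates so that the extension need not be built. *)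
Definition conic : {set F * F} :=
  [set u | [&& s u.1 == u.1, s u.2 == u.2 & u.1 ^+ 2 - e * u.2 ^+ 2 == 1]].

Lemma conic_aniso x y : s x = x -> s y = y -> x ^+ 2 = e * y ^+ 2 -> x = 0 /\ y = 0.
Proof.
move=> sx sy E; suff y0 : y = 0.
  by split=> //; apply/eqP; rewrite -sqrf_eq0 E y0 expr0n mulr0.
apply/eqP; apply: contraT => y0; have := e_nsq (c := x / y).
by rewrite fmorph_div sx sy expr_div_n E mulfK ?expf_neq0 // eqxx => /(_ erefl).
Qed.

(* Stereographic projection from [(-1, 0)]: the line of slope [t] meets the  *)
(* conic again at [((1 + e t^2) / (1 - e t^2), 2 t / (1 - e t^2))].          *)
Lemma card_conic : #|conic| = #|[set x | s x == x]|.+1.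
Proof.
have den t : s t = t -> 1 - e * t ^+ 2 != 0.
  move=> st; rewrite subr_eq0; apply/eqP => E.
  have [] := @conic_aniso 1 t (rmorph1 s) st; first by rewrite expr1n.
  by move/eqP; rewrite oner_eq0.
pose f t : F * F := ((1 + e * t ^+ 2) / (1 - e * t ^+ 2), 2%:R * t / (1 - e * t ^+ 2)).
have f1 t : s t = t -> (f t).1 + 1 = 2%:R / (1 - e * t ^+ 2).
  by move=> st; rewrite /f /=; field; exact: den.
have fK t : s t = t -> (f t).2 / ((f t).1 + 1) = t.
  move=> st; rewrite f1 // /f /=; field.
  by rewrite den.
have N1 : (-1, 0) \in conic.
  by rewrite inE /= rmorphN1 rmorph0 !eqxx sqrrN expr0n mulr0 subr0 expr1n eqxx.
rewrite (cardsD1 (-1, 0)) N1 add1n; congr _.+1.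
have -> : conic :\ (-1, 0) = [set f t | t in [set x | s x == x]].
  apply/setP => -[x y]; rewrite !inE /= xpair_eqE.
  apply/andP/imsetP => [[nN1 /and3P[/eqP sx /eqP sy /eqP E]]|[t]].
    have x1 : x + 1 != 0.
      apply: contra nN1; rewrite addr_eq0 => /eqP x1; rewrite x1 eqxx /=.
      have : e * y ^+ 2 = 0 by rewrite -[LHS](subKr (x ^+ 2)) E x1 sqrrN expr1n subrr.
      move/eqP; rewrite mulf_eq0 sqrf_eq0 => /orP[/eqP e0|//].
      by have := e_nsq (rmorph0 s); rewrite e0 expr0n eqxx.
    have sxy : s (y / (x + 1)) = y / (x + 1) by rewrite fmorph_div rmorphD rmorph1 sx sy.
    exists (y / (x + 1)); first by rewrite inE sxy.
    have ey : e * y ^+ 2 = x ^+ 2 - 1 by rewrite -E; ring.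
    have dE : 1 - e * (y / (x + 1)) ^+ 2 = 2%:R / (x + 1).
      by rewrite expr_div_n mulrA ey; field.
    rewrite /f dE; congr (_, _).
      by rewrite expr_div_n mulrA ey; field; rewrite x1.
    by field; rewrite x1.
  rewrite inE => /eqP st [-> ->]; have dt := den t st; split.
    rewrite negb_and -subr_eq0 opprK -[X in X + 1]/((f t).1) f1 //.
    by rewrite mulf_neq0 // invr_eq0.
  rewrite !fmorph_div !(rmorphB, rmorphD, rmorphM, rmorphXn) /= !st se rmorph1 ?rmorph_nat !eqxx /=.
  by apply/eqP; field.
rewrite card_in_imset // => t u; rewrite !inE => /eqP st /eqP su fE.
by rewrite -(fK t st) fE fK.
Qed.

End Conic.

(** * Twisted forms for an automorphism of odd order *)

Section OddExtension.

Variables (p m l k : nat) (F : finFieldType).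
Hypotheses (p_pr : prime p) (p_odd : odd p) (cardF : #|F| = (p ^ m)%N).
Hypothesis (l_gt0 : (0 < l)%N).
Variable s : {rmorphism F -> F}.
Hypothesis sE : s =1 (fun x => x ^+ (p ^ l)).
Local Notation D := (gcdn m (2 * l)).
Hypotheses (k_odd : odd k) (sk : iter k s =1 id) (mE : m = (D * k)%N).

Local Notation dform := (@dform p m l F).
Local Notation s3 x := (s (s (s x))).

(** The even power [s^(k-1)] fixes [x], so [s x = s^k x = x]. *)
Lemma odd_fixed x : s (s x) = x -> s x = x.
Proof.
move=> s2; have : iter k s x = s x.
  rewrite -[k]odd_double_half k_odd add1n iterS; congr (s _).
  by elim: k./2 => //= n IHn; rewrite IHn.
by rewrite sk.
Qed.

Lemma odd_fixedE : [set x | s x == x] = [set x | frob2 s x == x].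
Proof.
apply/setP => x; rewrite !inE /=; apply/eqP/eqP => [sx|]; first by rewrite !sx.
exact: odd_fixed.
Qed.

Lemma F_two_neq0 : 2%:R != 0 :> F.
Proof.
by rewrite -(dvdn_pcharf (pcharF p_pr cardF)) gtnNdvd // odd_prime_gt2.
Qed.

Lemma nonsquare_fixed : exists e : F,
  [/\ e != 0, s e = e & forall c, s c = c -> c ^+ 2 != e].
Proof.
have [|||e] := finfield_nonsquare F_two_neq0 (A := [set x | s x == x]).
- by rewrite inE rmorph1.
- by rewrite inE rmorphN1.
- by move=> c; rewrite !inE rmorphXn => /eqP ->.
rewrite inE => /eqP se ens; exists e; split=> // [|c sc].
  by have := ens 0; rewrite inE rmorph0 eqxx expr0n eq_sym => ->.
by apply: ens; rewrite inE sc.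
Qed.

Lemma radical_scale c a b : s c = c -> c != 0 ->
  radical (dform (c * a) (c * b)) = radical (dform a b).
Proof.
move=> sc c0; rewrite !(radical_dform p_pr cardF sE); apply/setP => x; rewrite !inE.
rewrite -[RHS](inj_eq (mulfI c0)) mulr0; congr (_ == 0) => /=.
by rewrite !rmorphM !sc; ring.
Qed.

Variable e : F.
Hypotheses (e0 : e != 0) (se : s e = e) (e_nsq : forall c, s c = c -> c ^+ 2 != e).

(** This is [f(x) - e f(y)] with [e] inside the trace. Extending [s] by [sqrt e -> - sqrt e], it is
    the trace of the rational part of [a * s3 z * z + b * s z * z] at [z = x + y sqrt e], a
    Hermitian expression that scaling by norm one elements preserves. *)
Definition twisted a b : F * F -> 'F_p :=
  dirsum (dform a b) (dform (- e * a) (- e * b)).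

Lemma twisted_conic a b u z : u \in conic s e ->
  twisted a b (u.1 * z.1 + e * (u.2 * z.2), u.2 * z.1 + u.1 * z.2) = twisted a b z.
Proof.
case: u z => [u v] [x y]; rewrite inE /= => /and3P[/eqP su /eqP sv /eqP uv].
rewrite /twisted /dirsum /= !(dformE _ sE).
rewrite -!(traceD p_pr cardF); congr (@Defs.Tr p m F _).
rewrite !rmorphD !rmorphM !(su, sv, se).
transitivity ((u ^+ 2 - e * v ^+ 2) * (a * (s3 x * x) + b * (s x * x) +
  (- e * a * (s3 y * y) + - e * b * (s y * y)))); first by ring.
by rewrite uv mul1r.
Qed.

(** The conic acts freely on nonzero vectors: if two of its points act equally on one of them, their
    difference has norm zero and vanishes by anisotropy. *)
Lemma twisted_dvd a b t :
  ((p ^ D).+1 %| #|[set z | (z != 0%R) && (twisted a b z == t)]|)%N.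
Proof.
rewrite -(card_tau_fixed p_pr cardF l_gt0 sE) -odd_fixedE -(card_conic F_two_neq0 se e_nsq).
pose act (u z : F * F) := (u.1 * z.1 + e * (u.2 * z.2), u.2 * z.1 + u.1 * z.2).
pose inv (u : F * F) := (u.1, - u.2).
have invK u z : u \in conic s e -> act (inv u) (act u z) = z.
  case: u z => u v [x y]; rewrite inE /= => /and3P[_ _ /eqP uv]; rewrite /act /=.
  rewrite -[in RHS](mul1r x) -[in RHS](mul1r y) -uv; congr (_, _); ring.
have Ginv u : u \in conic s e -> inv u \in conic s e.
  by case: u => u v; rewrite !inE /= rmorphN eqr_opp sqrrN.
apply: (@free_orbits _ _ _ act).
- move=> u z Gu; rewrite !inE => /andP[z0 tz]; rewrite twisted_conic // tz andbT.
  by apply: contraNneq z0 => uz; rewrite -(invK u z Gu) uz /act /= !mulr0 addr0.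
- exists (1, 0); first by rewrite inE /= rmorph1 rmorph0 expr1n expr0n mulr0 subr0 !eqxx.
  by case=> x y; rewrite /act /= !mul1r !mul0r mulr0 addr0 add0r.
- case=> u v [u' v'] Gu Gv; exists (act (u, v) (u', v')).
    move: Gu Gv; rewrite !inE /= => /and3P[/eqP su /eqP sv /eqP uv].
    move=> /and3P[/eqP su' /eqP sv' /eqP uv'].
    rewrite !(rmorphD, rmorphM) /= !(su, sv, su', sv', se) !eqxx /=; apply/eqP.
    transitivity ((u ^+ 2 - e * v ^+ 2) * (u' ^+ 2 - e * v' ^+ 2)); first by ring.
    by rewrite uv uv' mul1r.
  by case=> x y; rewrite /act /=; congr (_, _); ring.
- by move=> u Gu; exists (inv u) => [|z]; [exact: Ginv | exact: invK].
case=> x y; rewrite inE => /andP[xy0 _] [u v] [u' v'].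
rewrite !inE /= => /and3P[/eqP su /eqP sv _] /and3P[/eqP su' /eqP sv' _].
rewrite /act /= => -[E1 E2].
have H1 : (u - u') * x + e * ((v - v') * y) = 0.
  transitivity ((u * x + e * (v * y)) - (u' * x + e * (v' * y))); first by ring.
  by rewrite E1 subrr.
have H2 : (v - v') * x + (u - u') * y = 0.
  transitivity ((v * x + u * y) - (v' * x + u' * y)); first by ring.
  by rewrite E2 subrr.
have N0 : (u - u') ^+ 2 - e * (v - v') ^+ 2 = 0.
  apply/eqP; apply: contraT => N0; case/negP: xy0; rewrite xpair_eqE.
  rewrite -(inj_eq (mulfI N0) x) -(inj_eq (mulfI N0) y) mulr0.
  apply/andP; split; apply/eqP.
    transitivity ((u - u') * ((u - u') * x + e * ((v - v') * y)) -
      e * (v - v') * ((v - v') * x + (u - u') * y)); first by ring.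
    by rewrite H1 H2 !mulr0 subrr.
  transitivity ((u - u') * ((v - v') * x + (u - u') * y) -
    (v - v') * ((u - u') * x + e * ((v - v') * y))); first by ring.
  by rewrite H1 H2 !mulr0 subrr.
have [] := @conic_aniso _ s e e_nsq (u - u') (v - v').
- by rewrite rmorphB su su'.
- by rewrite rmorphB sv sv'.
- by apply/eqP; rewrite -subr_eq0 N0.
by move/eqP; rewrite subr_eq0 => /eqP -> /eqP; rewrite subr_eq0 => /eqP ->.
Qed.

(** The radical is the product of two radicals of equal size, so the rank is even whatever [j] is,
    and [twisted_dvd] decides the sign. *)
Lemma twisted_flat a b j : #|radical (dform a b)| = (p ^ (D * j))%N ->
  flat (twisted a b) ((- p%:R ^+ D) ^+ (k + j)).
Proof.
move=> cR; have D0 := D_gt0 m l_gt0.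
have m0 := card_exponent_gt0 cardF.
have Tq : quadratic (twisted a b).
  by apply: quadratic_dirsum; exact: (quadratic_dform p_pr cardF sE).
have cV : #|{: F * F}| = (p ^ (2 * m))%N.
  by rewrite card_prod cardF -expnD addnn mul2n.
have cRT : #|radical (twisted a b)| = (p ^ (2 * (D * j)))%N.
  have qf := quadratic_dform p_pr cardF sE.
  have sNe : s (- e) = - e by rewrite rmorphN se.
  rewrite (card_radical_dirsum (qf _ _) (qf _ _)) radical_scale ?oppr_eq0 //.
  by rewrite cR -expnD addnn -mul2n.
have V_p (z : F * F) : z *+ p = 0.
  by rewrite pair_mulrn !(mulrnF_p p_pr cardF).
have ev : ~~ odd (2 * m + 2 * (D * j)) by rewrite -mulnDr oddM.
have m20 : (0 < 2 * m)%N by rewrite muln_gt0.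
have [b' fl] := quadratic_even p_pr p_odd V_p Tq m20 cV cRT ev.
have half : ((2 * m + 2 * (D * j))./2 = D * (k + j))%N.
  by rewrite -mulnDr mul2n doubleK mulnDr -mE.
rewrite half in fl.
apply: (flat_sign p_pr p_odd D0 (quadratic0 Tq) (twisted_dvd a b) fl).
Qed.

End OddExtension.

(** * Words with a fixed quadratic form *)

Lemma card_additive_image (V W : finZmodType) (f : V -> W) :
  {morph f : x y / x + y} -> (#|[set f x | x : V]| * #|[set x | f x == 0%R]| = #|V|)%N.
Proof.
move=> fD; rewrite -[RHS]sum1_card (partition_big f (mem [set f x | x : V])) /=; last first.
  by move=> x _; exact: imset_f.
rewrite -sum_nat_const; apply: eq_bigr => _ /imsetP[x0 _ ->].
rewrite sum1dep_card -[LHS](card_imset _ (addrI x0)); apply: eq_card => x; rewrite inE.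
apply/imsetP/eqP => [[y]|fx]; first by rewrite inE => /eqP fy ->; rewrite fD fy addr0.
exists (x - x0); last by rewrite addrC subrK.
by rewrite inE addfB // fx subrr.
Qed.

Section CodewordFibers.

Variables (p m l : nat) (F : finFieldType).
Hypotheses (p_pr : prime p) (p_odd : odd p) (cardF : #|F| = (p ^ m)%N).
Variable s : {rmorphism F -> F}.
Hypothesis sE : s =1 (fun x => x ^+ (p ^ l)).

Local Notation Tr := (@Defs.Tr p m F).
Local Notation dform := (@dform p m l F).
Local Notation s3 x := (s (s (s x))).

Lemma codewordE a b c (h : 'F_p) x : codeword m l a b c h x = dform a b x + Tr (c * x) + h.
Proof. by rewrite ffunE /dform (traceD p_pr cardF). Qed.

Lemma weight_codeword a b c (h : 'F_p) : weight (codeword m l a b c h) =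
  (p ^ m - #|[set x | (dform a b x + Tr (c * x) + h == 0)%R]|)%N.
Proof.
rewrite -cardF -(cardC [set x | dform a b x + Tr (c * x) + h == 0]) addKn.
by apply: eq_card => x; rewrite !inE codewordE.
Qed.

Variables (a b : F) (r : nat).
Hypothesis cardR : #|radical (dform a b)| = (p ^ r)%N.
Local Notation Q := (dform a b).
Let Qq : quadratic Q := quadratic_dform p_pr cardF sE a b.

Lemma radical_le : (r <= m)%N.
Proof.
rewrite -(leq_exp2l _ _ (prime_gt1 p_pr)) -cardR -cardF.
exact: max_card.
Qed.

(** The [c] whose linear form can be absorbed by completing the square. *)
Definition shifts : {set F} := [set c | [exists u, forall x, Tr (c * x) == polar Q u x]].

(** [shifts] is the image of an additive map [f] with the radical as kernel: the adjoint operator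
    [L] followed by three inverses of [s], so that [Tr (f u * x) = polar Q u x]. *)
Lemma card_shifts : (#|shifts| * p ^ r = p ^ m)%N.
Proof.
have TrD := traceD p_pr cardF.
have [g sK gK] := s_bij s.
pose L := skew_eval (frob2 s) (radical_poly s a b).
pose f u := g (g (g (L u))).
have s3f u : s3 (f u) = L u by rewrite !gK.
have fD : {morph f : x y / x + y}.
  move=> x y; do 3 apply: (can_inj sK).
  by rewrite !rmorphD !s3f /L skew_evalD.
have fE u x : Tr (f u * x) = polar Q u x.
  rewrite (polar_dform p_pr cardF sE) -/(L u) -s3f -!rmorphM.
  by rewrite !(trace_s p_pr cardF sE).
have -> : shifts = [set f x | x : F].
  apply/setP => c; rewrite inE; apply/existsP/imsetP => [[u /forallP cu]|[u _ ->]].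
    exists u => //; apply/eqP; rewrite -subr_eq0; apply/eqP.
    apply: (trace_nondeg p_pr cardF) => x.
    by rewrite mulrBl (addfB TrD) (eqP (cu x)) fE subrr.
  by exists u; apply/forallP => x; rewrite fE.
rewrite -cardR -cardF -(card_additive_image fD); congr (_ * _)%N.
rewrite (radical_dform p_pr cardF sE); apply: eq_card => x; rewrite !inE -/(L x).
by rewrite -s3f !fmorph_eq0.
Qed.

(** Polar functionals vanish on the radical; the index formula for annihilators gives both sets the
    same size. *)
Lemma shifts_radical c : (c \in shifts) = [forall y in radical Q, Tr (c * y) == 0].
Proof.
have TrD := traceD p_pr cardF; have p_gt0 := prime_gt0 p_pr.
suff -> : shifts = [set c in [set: F] | [forall y in radical Q, Tr (c * y) == 0]] by rewrite !inE.
apply/eqP; rewrite eqEcard; apply/andP; split.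
  apply/subsetP => c'; rewrite !inE => /existsP[u /forallP cu].
  apply/forall_inP => y; rewrite inE => /forallP Ry.
  by rewrite (eqP (cu y)) polarC Ry.
have := @biadditive_kernels p p_pr F F setT (radical Q) (fun x y => Tr (x * y)).
move=> /(_ (fun _ _ _ _ => in_setT _) (radicalD Qq)) E.
have {}E := E (fun x y z => etrans (congr1 Tr (mulrDr _ _ _)) (TrD _ _)).
have {}E := E (fun x y z => etrans (congr1 Tr (mulrDl _ _ _)) (TrD _ _)).
have pr0 : (0 < p ^ r)%N by rewrite expn_gt0 p_gt0.
rewrite -(leq_pmul2r pr0) card_shifts -{1}cardR -E cardsT cardF -[leqRHS]muln1 leq_mul2l.
apply/orP; right; rewrite -(cards1 (0 : F)); apply: subset_leq_card.
apply/subsetP => y; rewrite !inE => /andP[_ /forallP Ty].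
apply/eqP/(trace_nondeg p_pr cardF) => z.
by have := Ty z; rewrite inE /= mulrC => /eqP.
Qed.

Lemma zeros_shift c : c \in shifts ->
  exists v, forall h, #|[set x | Q x + Tr (c * x) + h == 0]| = #|[set x | Q x == v - h]|.
Proof.
rewrite inE => /existsP[u /forallP cu]; exists (Q u) => h.
rewrite -[RHS](card_imset _ (addIr (- u))); apply: eq_card => x; rewrite inE (eqP (cu x)).
have E : Q x + polar Q u x + h = Q (x + u) - (Q u - h).
  by rewrite polarC /polar; ring.
rewrite E subr_eq0; apply/eqP/imsetP => [xu|[y]]; first by exists (x + u); rewrite ?inE ?xu ?addrK.
by rewrite inE => /eqP yE ->; rewrite subrK.
Qed.

(** Some radical vector [y] has [Tr (c * y)] nonzero. As [Q] vanishes on its radical in odd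
    characteristic, translation by [y] changes the word by a nonzero constant, so all values are
    taken equally often. *)
Lemma zeros_no_shift c h : c \notin shifts ->
  (p * #|[set x | (Q x + Tr (c * x) + h == 0)%R]| = p ^ m)%N.
Proof.
have TrD := traceD p_pr cardF.
rewrite shifts_radical negb_forall_in => /exists_inP[y Ry Tcy].
have Qy : Q y = 0.
  have /eqP : polar Q y y = 0 by move: Ry; rewrite inE => /forallP/(_ y)/eqP.
  have -> : polar Q y y = Q y * 2%:R.
    by rewrite /polar -mulr2n (quadraticMn _ _ Qq) -[_ *+ _]mulr_natr; ring.
  by rewrite mulf_eq0 (negPf (Fp_two_neq0 p_pr p_odd)) orbF => /eqP.
have := @translation_fiber p p_pr F setT (fun x => Q x + Tr (c * x) + h) y (Tr (c * y)).
move=> /(_ (fun _ _ => in_setT _)) E.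
have := E _ Tcy 0; rewrite cardsT cardF => <-; last first.
  move=> x _; rewrite mulrDr TrD.
  have -> : Q (x + y) = Q x + Q y + polar Q x y by rewrite /polar; ring.
  have /eqP -> : polar Q x y == 0 by move: Ry; rewrite polarC inE => /forallP.
  by rewrite Qy; ring.
by congr (_ * _)%N; apply: eq_card => x; rewrite !inE.
Qed.

(** For the [p^(m-r)] shifts [c], the target [v - h] runs over all values as [h] does; for any other
    [c], every word has [p^(m-1)] zeros. *)
Lemma codeword_fiber w :
  \sum_c \sum_(h : 'F_p) (weight (codeword m l a b c h) == w)%:R =
  (p ^ (m - r))%:R * (\sum_t (p ^ m - #|[set x | Q x == t]| == w)%N%:R)
  + ((p ^ m)%:R - (p ^ (m - r))%:R) * p%:R * (p ^ m - p ^ m.-1 == w)%N%:R :> rat.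
Proof.
have p_gt0 := prime_gt0 p_pr.
have cS : #|shifts| = (p ^ (m - r))%N.
  have pr0 : (0 < p ^ r)%N by rewrite expn_gt0 p_gt0.
  by apply/eqP; rewrite -(eqn_pmul2r pr0) card_shifts -expnD subnK // radical_le.
rewrite (bigID (mem shifts)) /=; congr (_ + _).
  rewrite -cS mulr_natl -sumr_const; apply: eq_bigr => c /zeros_shift[v vE].
  rewrite (reindex_inj (inv_inj (subKr v))) /=.
  by apply: eq_bigr => t _; rewrite weight_codeword vE subKr.
have -> : (p ^ m)%:R - (p ^ (m - r))%:R = #|~: shifts|%:R :> rat.
  by rewrite -cardF -(cardsC shifts) cS natrD addrC addKr.
have -> : #|~: shifts|%:R * p%:R * (p ^ m - p ^ m.-1 == w)%N%:R =
    \sum_(c in ~: shifts) \sum_(h : 'F_p) (p ^ m - p ^ m.-1 == w)%N%:R :> rat.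
  by rewrite !sumr_const card_Fp // -[RHS]mulr_natl -[X in _ = _ * X]mulr_natl mulrA.
apply: eq_big => [c|c Sc]; first by rewrite in_setC.
apply: eq_bigr => h _; rewrite weight_codeword.
suff -> : #|[set x | Q x + Tr (c * x) + h == 0]| = (p ^ m.-1)%N by [].
apply/eqP; rewrite -(eqn_pmul2l p_gt0) zeros_no_shift //.
by rewrite -expnS prednK // (card_exponent_gt0 cardF).
Qed.

End CodewordFibers.

Definition class_size (T : finType) (P : pred T) (jf : T -> nat) (bf : T -> bool)
    (j : nat) (b : bool) : rat :=
  #|[set x | [&& P x, jf x == j & bf x == b]]|%:R.

Lemma class_sum (T : finType) (P : pred T) (jf : T -> nat) (bf : T -> bool) N
    (H : nat -> bool -> rat) : (forall x, P x -> (jf x < N)%N) ->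
  \sum_(x | P x) H (jf x) (bf x) =
  \sum_(j < N) (class_size P jf bf j true * H j true +
                class_size P jf bf j false * H j false).
Proof.
move=> jfN; pose f x : 'I_N.+1 * bool := (inord (jf x), bf x).
rewrite (partition_big f predT) //=.
rewrite -(pair_bigA _ (fun j b => \sum_(x | P x && (f x == (j, b))) H (jf x) (bf x))) /=.
rewrite big_ord_recr /= [X in _ + X]big1 ?addr0 => [|b _]; last first.
  rewrite big_pred0 // => x; apply/negP => /andP[Px]; rewrite xpair_eqE => /andP[/eqP/(congr1 val)].
  by rewrite /= inordK ?(leqW (jfN _ Px)) // => jx; have := jfN _ Px; rewrite jx ltnn.
apply: eq_bigr => j _; rewrite big_bool.
have E b : \sum_(x | P x && (f x == (widen_ord (leqnSn N) j, b))) H (jf x) (bf x) =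
    class_size P jf bf j b * H j b.
  rewrite /class_size mulr_natl -sumr_const; apply: eq_big => [x|x].
    rewrite inE xpair_eqE -val_eqE /=; case: (boolP (P x)) => //= Px.
    by rewrite inordK ?(leqW (jfN _ Px)).
  move=> /andP[Px]; rewrite xpair_eqE -val_eqE /= inordK ?(leqW (jfN _ Px)) //.
  by case/andP => /eqP -> /eqP ->.
by rewrite !E.
Qed.

(** Both the code and the tables become linear combinations of these indicators, compared
    coefficient by coefficient; coincidences between listed weights then do no harm. *)
Definition at_weight (w : nat) (x : rat) : rat := (x == w%:R)%:R.

(* Here and in odd_rank_count: the number of pairs (c, h) for which the word  *)
(* of (a, b, c, h) has weight w, when the radical of the form of (a, b) has   *)
(* size p^r; if m - r is even, S is the character sum of the form.            *)
Definition even_rank_count (p m r : nat) (S : rat) (w : nat) : rat :=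
  let q := p%:R ^+ m in let q' := p%:R ^+ m.-1 in
  p%:R ^+ (m - r) * (at_weight w (q - q' - (p%:R - 1) * S / p%:R)
                     + (p%:R - 1) * at_weight w (q - q' + S / p%:R))
  + (q - p%:R ^+ (m - r)) * p%:R * at_weight w (q - q').

Definition odd_rank_count (p m r : nat) (w : nat) : rat :=
  let q := p%:R ^+ m in let q' := p%:R ^+ m.-1 in let t := p%:R ^+ (m + r)./2 in
  p%:R ^+ (m - r) * (at_weight w (q - q')
     + (p%:R - 1) / 2%:R * (at_weight w (q - q' + t) + at_weight w (q - q' - t)))
  + (q - p%:R ^+ (m - r)) * p%:R * at_weight w (q - q').

(** * Weights and moments for the family of forms *)

Section FormMoments.

Variables (p m l : nat) (F : finFieldType).
Hypotheses (p_pr : prime p) (p_odd : odd p) (cardF : #|F| = (p ^ m)%N).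
Variable s : {rmorphism F -> F}.
Hypothesis sE : s =1 (fun x => x ^+ (p ^ l)).

Local Notation Tr := (@Defs.Tr p m F).
Local Notation dform := (@dform p m l F).
Local Notation s3 x := (s (s (s x))).
Local Notation q := (p ^ m)%N.

Lemma at_weightE (k n w : nat) : (n <= k)%N ->
  (k - n == w)%N%:R = at_weight w (k%:R - n%:R).
Proof. by move=> le_nk; rewrite /at_weight -natrB // eqr_nat. Qed.

Lemma Fp_sum_const (x : rat) : \sum_(t : 'F_p | t != 0) x = (p%:R - 1) * x.
Proof.
rewrite sumr_const (eq_card (B := predC1 (0 : 'F_p))) // cardC1 card_Fp //.
by rewrite -{2}(prednK (prime_gt0 p_pr)) -natr1 addrK mulr_natl.
Qed.

Lemma flat_weights a b r (S : int) w :
    #|radical (dform a b)| = (p ^ r)%N -> flat (dform a b) S ->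
  \sum_c \sum_(h : 'F_p) (weight (codeword m l a b c h) == w)%:R =
  even_rank_count p m r S%:~R w.
Proof.
move=> cR fS; rewrite (codeword_fiber p_pr p_odd cardF sE cR) /even_rank_count.
have m0 := card_exponent_gt0 cardF; have p0 := prime_gt0 p_pr.
have pn0 : p%:R != 0 :> rat by rewrite pnatr_eq0 -lt0n.
have qE : (p ^ m)%:R = p%:R * p%:R ^+ m.-1 :> rat by rewrite -exprS prednK // natrX.
rewrite at_weightE ?leq_exp2l ?prime_gt1 ?leq_pred // !natrX; congr (_ * _ + _).
have Nt t : #|[set x | dform a b x == t]|%:R =
    p%:R ^+ m.-1 + S%:~R / p%:R * (p%:R * (t == 0)%:R - 1) :> rat.
  have := congr1 (intr : int -> rat) (fS t).
  rewrite rmorphD !rmorphM rmorphB rmorphM !rmorph_nat rmorph1 cardF qE => E.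
  by apply: (mulfI pn0); rewrite E; field.
rewrite (bigD1 0) //= at_weightE -?cardF ?max_card // cardF natrX Nt eqxx.
congr (at_weight w _ + _); first by rewrite /=; field.
rewrite -Fp_sum_const; apply: eq_bigr => t t0.
rewrite -cardF at_weightE ?max_card // cardF natrX Nt (negPf t0).
by congr (at_weight w _); rewrite /=; ring.
Qed.

Lemma odd_rank_weights a b r w :
    #|radical (dform a b)| = (p ^ r)%N -> odd (m + r) ->
  \sum_c \sum_(h : 'F_p) (weight (codeword m l a b c h) == w)%:R =
  odd_rank_count p m r w.
Proof.
move=> cR od; rewrite (codeword_fiber p_pr p_odd cardF sE cR) /odd_rank_count.
have m0 := card_exponent_gt0 cardF.
have V_p := mulrnF_p p_pr cardF; have Qq := quadratic_dform p_pr cardF sE a b.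
pose g (k : int) := at_weight w (p%:R ^+ m - k%:~R).
have [_ /(_ _ g) E] := quadratic_odd p_pr p_odd V_p Qq m0 cardF cR od.
rewrite at_weightE ?leq_exp2l ?prime_gt1 ?leq_pred // !natrX; congr (_ * _ + _).
apply: (@mulfI rat 2%:R) => //.
transitivity (2%:R * \sum_t g #|[set x | dform a b x == t]|%:R).
  congr (_ * _); apply: eq_bigr => t _; rewrite /g rmorph_nat.
  by rewrite -cardF at_weightE ?max_card // cardF natrX.
rewrite E /g !(rmorphD, rmorphB, rmorphN, rmorphXn) !rmorph_nat /= !opprD opprK !addrA.
by field.
Qed.

Lemma zero_form_card : #|radical (dform 0 0)| = (p ^ m)%N.
Proof.
rewrite -cardF -cardsT (radical_dform p_pr cardF sE); congr #|pred_of_set _|.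
by apply/setP => x; rewrite !inE /= !rmorph0 !mul0r !addr0 eqxx.
Qed.

Lemma zero_form_flat : flat (dform 0 0) (p%:R ^+ m).
Proof.
have d0 x : dform 0 0 x = 0.
  by rewrite /dform !mul0r addr0 (addf0 (traceD p_pr cardF)).
move=> t; rewrite cardF natrX; case: (eqVneq t 0) => [->|t0] /=.
  have -> : #|[set x | dform 0 0 x == 0]| = #|F|.
    by rewrite -cardsT; congr #|pred_of_set _|; apply/setP=> x; rewrite !inE d0 eqxx.
  by rewrite cardF natrX; ring.
rewrite (_ : [set x | _] = set0) ?cards0; first by ring.
by apply/setP => x; rewrite !inE d0 eq_sym (negPf t0).
Qed.

Lemma plain_moment :
  \sum_(ab : F * F) (p%:R * #|[set x | dform ab.1 ab.2 x == 0%R]|%:R - q%:R) =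
  (p%:R - 1) * q%:R ^+ 2 :> int.
Proof.
rewrite -cardF (trace_moment p_pr cardF (fun x : F => x ^+ (p ^ (3 * l) + 1))
  (fun x : F => x ^+ (p ^ l + 1))).
rewrite (_ : [set x | _] = [set 0]) ?cards1 ?mulr1 //.
by apply/setP => x; rewrite !inE !expf_eq0 !addn1 /= andbb.
Qed.

(** The ratios [y / x] of nonzero elements on which both power maps agree. There are two of them if
    d' = d and [p^d + 1] if d' = 2d. *)
Definition unit_twist : {set F} := [set z | (s (s z) == z) && (s z * z == 1)].

(** For [z = y / x] the equations read [s z * z = 1] and [s3 z * z = 1]; comparing them and
    cancelling [s] shows that [s^2] fixes [z]. *)
Lemma card_power_pairs :
  #|[set xy : F * F | (xy.1 ^+ (p ^ (3 * l) + 1) - xy.2 ^+ (p ^ (3 * l) + 1) == 0)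
                     && (xy.1 ^+ (p ^ l + 1) - xy.2 ^+ (p ^ l + 1) == 0)]| =
  (1 + q.-1 * #|unit_twist|)%N.
Proof.
have AE x : x ^+ (p ^ (3 * l) + 1) = s3 x * x by rewrite exprD expr1 (s3E sE).
have BE x : x ^+ (p ^ l + 1) = s x * x by rewrite exprD expr1 sE.
have -> : q.-1 = #|[set~ (0 : F)]| by rewrite cardsC1 cardF.
rewrite (_ : [set xy | _] = [set xy | (s3 xy.1 * xy.1 == s3 xy.2 * xy.2) &&
    (s xy.1 * xy.1 == s xy.2 * xy.2)]); last first.
  by apply/setP => xy; rewrite !inE !AE !BE !subr_eq0.
rewrite -cardsX (cardsD1 (0, 0)) inE /= !eqxx; congr (_ + _)%N.
have phi_inj : {in setX [set~ 0] unit_twist &, injective (fun z : F * F => (z.1, z.1 * z.2))}.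
  move=> [x z] [x' z']; rewrite !inE /= => /andP[x0 _] _ [<- /(mulfI x0) ->] //.
rewrite -(card_in_imset phi_inj); apply: eq_card => -[x y].
rewrite !inE xpair_eqE /=.
apply/and3P/imsetP => [[nz /eqP EA /eqP EB]|[[x' z]]].
  have x0 : x != 0.
    apply: contraNneq nz => x0; rewrite x0 eqxx /=.
    by move: EB; rewrite x0 mulr0 => /esym/eqP; rewrite mulf_eq0 fmorph_eq0 orbb.
  exists (x, y / x); last by rewrite /= [x * _]mulrC divfK.
  have yx : y = (y / x) * x by rewrite divfK.
  have Bz : s (y / x) * (y / x) = 1.
    apply: (@mulfI _ (s x * x)); first by rewrite mulf_neq0 ?fmorph_eq0.
    by rewrite mulr1 [RHS]EB [in RHS]yx rmorphM; ring.
  have Az : s3 (y / x) * (y / x) = 1.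
    apply: (@mulfI _ (s3 x * x)); first by rewrite mulf_neq0 ?fmorph_eq0.
    by rewrite mulr1 [RHS]EA [in RHS]yx !rmorphM; ring.
  have z0 : y / x != 0 by apply/eqP => z0; move/eqP: Bz; rewrite z0 mulr0 eq_sym oner_eq0.
  rewrite !inE x0 Bz eqxx andbT /=.
  by apply/eqP/(fmorph_inj s)/(mulIf z0); rewrite Az Bz.
rewrite !inE /= => /and3P[x0 /eqP tz /eqP Bz] [-> ->]; split.
- by rewrite (negPf x0).
- by rewrite !rmorphM tz -mulrACA Bz mulr1.
by rewrite !rmorphM -mulrACA Bz mulr1.
Qed.

(** The moment of [f(x) - f(y)], read through [count_pairs], which expresses the number of its zeros
    by the size of the radical; signs do not enter. *)
Lemma radical_moment :
  (\sum_(ab : F * F) #|radical (dform ab.1 ab.2)| = q * (1 + q.-1 * #|unit_twist|))%N.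
Proof.
have p1 := prime_gt1 p_pr; have p0 := prime_gt0 p_pr.
have TrD := traceD p_pr cardF.
have q0 : (0 < q)%N by rewrite expn_gt0 p0.
have E := trace_moment p_pr cardF
  (fun xy : F * F => xy.1 ^+ (p ^ (3 * l) + 1) - xy.2 ^+ (p ^ (3 * l) + 1))
  (fun xy => xy.1 ^+ (p ^ l + 1) - xy.2 ^+ (p ^ l + 1)).
rewrite card_power_pairs cardF in E.
apply/eqP; rewrite -(eqr_nat int).
have pq0 : (p%:R - 1) * q%:R != 0 :> int.
  by rewrite mulf_neq0 ?pnatr_eq0 -?lt0n // subr_eq0 -[1]/(1%:R) eqr_nat gtn_eqF.
rewrite -(inj_eq (mulfI pq0)); apply/eqP.
transitivity ((p%:R - 1) * (q%:R ^+ 2 * (1 + q.-1 * #|unit_twist|)%:R) : int); last first.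
  by rewrite natrM; ring.
rewrite -E natr_sum mulr_sumr; apply: eq_bigr => -[a b] _ /=.
have V_p := mulrnF_p p_pr cardF; have Qq := quadratic_dform p_pr cardF sE a b.
have /(congr1 (fun n => n%:R : int)) := count_pairs p_pr p_odd V_p Qq.
rewrite natrD !natrM natrB // cardF => Ec.
have -> : [set x : F * F | Tr (a * (x.1 ^+ (p ^ (3 * l) + 1) - x.2 ^+ (p ^ (3 * l) + 1)) +
    b * (x.1 ^+ (p ^ l + 1) - x.2 ^+ (p ^ l + 1))) == 0%R] =
  [set z | dform a b z.1 == dform a b z.2].
  apply/setP => -[x y]; rewrite !inE /= -[RHS]subr_eq0 /dform -(addfB TrD).
  by congr (@Defs.Tr p m F _ == _); ring.
by rewrite card_prod cardF natrM Ec; ring.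
Qed.

End FormMoments.

(** * The case d' = d *)

Lemma flat_unique (p : nat) (V : finZmodType) (f : V -> 'F_p) S S' :
  flat f S -> flat f S' -> S = S'.
Proof.
move=> /(_ 1) E /(_ 1); rewrite E oner_eq0 => /addrI.
by rewrite mulr0 sub0r !mulrN1 => /oppr_inj.
Qed.

Section OddClasses.

Variables (p m l k : nat) (F : finFieldType).
Hypotheses (p_pr : prime p) (p_odd : odd p) (cardF : #|F| = (p ^ m)%N).
Hypothesis (l_gt0 : (0 < l)%N).
Variable s : {rmorphism F -> F}.
Hypothesis sE : s =1 (fun x => x ^+ (p ^ l)).
Local Notation D := (gcdn m (2 * l)).
Hypotheses (k_odd : odd k) (sk : iter k s =1 id) (mE : m = (D * k)%N).

Local Notation dform := (@dform p m l F).
Local Notation s3 x := (s (s (s x))).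
Local Notation q := (p ^ m)%N.

Lemma card_unit_twist_odd : #|unit_twist s| = 2%N.
Proof.
have -> : unit_twist s = [set 1; -1].
  apply/setP => z; rewrite !inE; apply/andP/orP => [[/eqP/(odd_fixed k_odd sk) -> /eqP zz]|].
    by apply/orP; rewrite -subr_eq0 -[_ == -1]subr_eq0 -mulf_eq0 opprK
      -subr_sqr expr2 zz expr1n subrr.
  by case=> /eqP ->; rewrite ?rmorphN1 ?rmorph1 ?mulrNN ?mulr1 !eqxx.
rewrite cards2 -subr_eq0 opprK -(natrD _ 1 1).
by rewrite (F_two_neq0 p_pr p_odd cardF).
Qed.

(** The bit [b] carries the sign in even rank; in odd rank the disjunction leaves it
    unconstrained. *)
Definition odd_class (ab : F * F) (j : nat) (b : bool) : Prop :=
  [/\ (j < 3)%N, #|radical (dform ab.1 ab.2)| = (p ^ (D * j))%N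
    & odd (m + D * j) \/ flat (dform ab.1 ab.2) ((-1) ^+ b * p%:R ^+ (m + D * j)./2)].

Lemma odd_class_exists : exists jf : F * F -> nat, exists bf : F * F -> bool,
  forall ab, ab != (0, 0) -> odd_class ab (jf ab) (bf ab).
Proof.
have m0 := card_exponent_gt0 cardF.
have V_p := mulrnF_p p_pr cardF.
have : forall ab, exists jb : nat * bool, ab != (0, 0) -> odd_class ab jb.1 jb.2.
  case=> a b; case: (eqVneq (a, b) (0, 0)) => [->|ab0]; first by exists (0%N, true).
  have [j j2 cR] := radical_card_odd p_pr p_odd cardF l_gt0 sE k_odd sk ab0.
  have Qq := quadratic_dform p_pr cardF sE a b.
  case: (boolP (odd (m + D * j))) => [od|ev]; first by exists (j, true) => _; split=> //; left.
  have [b' fl] := quadratic_even p_pr p_odd V_p Qq m0 cardF cR ev.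
  by exists (j, b') => _; split=> //; right.
by case/fin_all_exists => f fP; exists (fun ab => (f ab).1), (fun ab => (f ab).2).
Qed.

Variables (jf : F * F -> nat) (bf : F * F -> bool).
Hypothesis jbP : forall ab, ab != (0, 0) -> odd_class ab (jf ab) (bf ab).

Local Notation P := (fun ab : F * F => ab != (0, 0)).
Local Notation n j b := (class_size P jf bf j b).

Lemma odd_class_sum (H : nat -> bool -> rat) :
  \sum_(ab | P ab) H (jf ab) (bf ab) =
  n 0 true * H 0%N true + n 0 false * H 0%N false +
  (n 1 true * H 1%N true + n 1 false * H 1%N false) +
  (n 2 true * H 2 true + n 2 false * H 2 false).
Proof.
have lt3 ab : P ab -> (jf ab < 3)%N by move/jbP => [].
by rewrite (class_sum bf H lt3) !big_ord_recl big_ord0 addr0 addrA.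
Qed.

Lemma odd_classes_total :
  n 0 true + n 0 false + (n 1 true + n 1 false) + (n 2 true + n 2 false) =
  q%:R ^+ 2 - 1.
Proof.
have := odd_class_sum (fun _ _ => 1); rewrite !mulr1 => <-.
rewrite sumr_const (eq_card (B := predC1 ((0, 0) : F * F))) // cardC1 card_prod.
by rewrite cardF -subn1 natrB ?muln_gt0 ?expn_gt0 ?prime_gt0 // natrM.
Qed.

Lemma odd_classes_radical :
  n 0 true + n 0 false + (n 1 true + n 1 false) * p%:R ^+ D
  + (n 2 true + n 2 false) * p%:R ^+ D ^+ 2 = 2%:R * q%:R * (q%:R - 1).
Proof.
have /(congr1 (fun n => n%:R : rat)) := radical_moment p_pr p_odd cardF sE.
rewrite natr_sum (bigD1 (0, 0)) //= (zero_form_card p_pr cardF sE).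
rewrite (eq_bigr (fun ab => p%:R ^+ (D * jf ab))); last first.
  by move=> ab /jbP[_ -> _]; rewrite natrX.
rewrite (odd_class_sum (fun j _ => p%:R ^+ (D * j))) card_unit_twist_odd.
rewrite muln0 muln1 expr0 natrM natrD natrM -subn1 natrB ?expn_gt0 ?prime_gt0 //.
by rewrite exprM => E; apply/eqP; rewrite -(inj_eq (addrI q%:R)); apply/eqP; move: E; nra.
Qed.

Variable e : F.
Hypotheses (e0 : e != 0) (se : s e = e) (e_nsq : forall c, s c = c -> c ^+ 2 != e).

(** A nonzero common zero would give [z = x / y] with [s z * z = s3 z * z = e], hence fixed by [s]
    and with square [e], against the choice of [e]. *)
Lemma twisted_zeros :
  [set z : F * F | (z.1 ^+ (p ^ (3 * l) + 1) - e * z.2 ^+ (p ^ (3 * l) + 1) == 0)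
    && (z.1 ^+ (p ^ l + 1) - e * z.2 ^+ (p ^ l + 1) == 0)] = [set (0, 0)].
Proof.
have AE x : x ^+ (p ^ (3 * l) + 1) = s3 x * x by rewrite exprD expr1 (s3E sE).
have BE x : x ^+ (p ^ l + 1) = s x * x by rewrite exprD expr1 sE.
apply/setP => -[x y]; rewrite !inE /= !AE !BE !subr_eq0 xpair_eqE.
apply/andP/andP => [[/eqP EA /eqP EB]|[/eqP -> /eqP ->]]; last by rewrite !mulr0 eqxx.
case: (eqVneq y 0) EA EB => [-> _|y0 EA EB].
  by rewrite !mulr0 => /eqP; rewrite mulf_eq0 fmorph_eq0 orbb.
have Bz : s (x / y) * (x / y) = e.
  rewrite fmorph_div mulf_div EB mulfK //.
  by rewrite mulf_neq0 ?fmorph_eq0.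
have Az : s3 (x / y) * (x / y) = e.
  rewrite !fmorph_div mulf_div EA mulfK //.
  by rewrite mulf_neq0 ?fmorph_eq0.
have z0 : x / y != 0 by apply/eqP => z0; move: e0; rewrite -Bz z0 mulr0 eqxx.
have sz : s (x / y) = x / y.
  by apply: (odd_fixed k_odd sk); apply: (fmorph_inj s); apply: (mulIf z0); rewrite Az Bz.
by have := e_nsq sz; rewrite expr2 -{1}sz Bz eqxx.
Qed.

(** The zero pair alone accounts for the whole moment, so the sums [(- p^D)^(k + j)] over the other
    pairs cancel; dividing by [(- p^D)^k] leaves the alternating relation. *)
Lemma odd_classes_twisted :
  n 0 true + n 0 false + (n 2 true + n 2 false) * p%:R ^+ D ^+ 2 =
  (n 1 true + n 1 false) * p%:R ^+ D.
Proof.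
have p1 : (p%:R - 1 : int) != 0.
  by rewrite subr_eq0 -[1]/(1%:R) eqr_nat gtn_eqF ?prime_gt1.
have TrD := traceD p_pr cardF.
have := trace_moment p_pr cardF
  (fun z : F * F => z.1 ^+ (p ^ (3 * l) + 1) - e * z.2 ^+ (p ^ (3 * l) + 1))
  (fun z => z.1 ^+ (p ^ l + 1) - e * z.2 ^+ (p ^ l + 1)).
rewrite twisted_zeros cards1 mulr1.
have tE (ab : F * F) : [set z : F * F | Tr p m (
    ab.1 * (z.1 ^+ (p ^ (3 * l) + 1) - e * z.2 ^+ (p ^ (3 * l) + 1)) +
    ab.2 * (z.1 ^+ (p ^ l + 1) - e * z.2 ^+ (p ^ l + 1))) == 0%R] =
  [set z | twisted p m l e ab.1 ab.2 z == 0].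
  apply/setP => z; rewrite !inE /twisted /dirsum /dform -TrD.
  by congr (@Defs.Tr p m F _ == _); ring.
under eq_bigr => ab _ do rewrite tE.
rewrite (bigD1 (0, 0)) //=.
rewrite (eq_bigr (fun ab => (p%:R - 1) * (- p%:R ^+ D) ^+ (k + jf ab))); last first.
  move=> ab /jbP[_ cR _].
  have fl := twisted_flat p_pr p_odd cardF l_gt0 sE k_odd sk mE e0 se e_nsq cR.
  by rewrite (flat_zeros fl) addrC addKr.
have -> : [set z | twisted p m l e 0 0 z == 0] = [set: F * F].
  apply/setP => z; rewrite !inE /twisted /dirsum /dform !mulr0 !mul0r !addr0 (addf0 TrD).
  by rewrite addr0 eqxx.
rewrite cardsT card_prod cardF natrM -mulr_sumr => E.
have {E} : \sum_(ab : F * F | ab != (0%R, 0%R)) (- p%:R ^+ D) ^+ (k + jf ab) = 0 :> int.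
  by apply: (mulfI p1); move: E; set S := \sum_(_ | _) _; nia.
move/(congr1 (intr : int -> rat)); rewrite rmorph_sum /= rmorph0.
under eq_bigr => ab _ do rewrite rmorphXn rmorphN rmorphXn rmorph_nat.
rewrite (odd_class_sum (fun j _ => (- p%:R ^+ D) ^+ (k + j))).
set X := p%:R ^+ D; rewrite addn0 addn1 addn2 !exprS => E.
have X0 : (- X) ^+ k != 0.
  by rewrite expf_neq0 // oppr_eq0 expf_neq0 // pnatr_eq0 -lt0n prime_gt0.
apply: (mulIf X0); apply/eqP; rewrite -subr_eq0 -[X in _ == X]E; apply/eqP.
by ring.
Qed.

(** In odd rank 0 is taken exactly [p^(m-1)] times, so such a form contributes nothing to the plain
    moment. *)
Definition odd_class_value j (b : bool) : rat :=
  if odd (m + D * j) then 0 else (-1) ^+ b * p%:R ^+ (m + D * j)./2.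

Lemma odd_classes_plain :
  n 0 true * odd_class_value 0 true + n 0 false * odd_class_value 0 false +
  (n 1 true * odd_class_value 1 true + n 1 false * odd_class_value 1 false) +
  (n 2 true * odd_class_value 2 true + n 2 false * odd_class_value 2 false) =
  q%:R ^+ 2 - q%:R.
Proof.
have p0 := prime_gt0 p_pr; have m0 := card_exponent_gt0 cardF.
have p1 : (p%:R - 1 : rat) != 0.
  by rewrite subr_eq0 -[1]/(1%:R) eqr_nat gtn_eqF ?prime_gt1.
rewrite -odd_class_sum; apply: (mulfI p1).
have /(congr1 (intr : int -> rat)) := plain_moment l p_pr cardF.
rewrite rmorphM rmorph_sum (bigD1 (0, 0)) //= (flat_zeros (zero_form_flat l p_pr cardF)).
rewrite (eq_bigr (fun ab => (p%:R - 1) * odd_class_value (jf ab) (bf ab))); last first.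
  move=> -[a b] /jbP[_ cR fl]; rewrite /odd_class_value /=.
  case: (boolP (odd _)) fl => [od _|ev [//|fl]]; last first.
    rewrite (flat_zeros fl) cardF addrC addKr rmorphM rmorphB rmorphM rmorphXn rmorphN1.
    by rewrite rmorphXn rmorph_nat rmorph1.
  have V_p := mulrnF_p p_pr cardF; have Qq := quadratic_dform p_pr cardF sE a b.
  have [-> _] := quadratic_odd p_pr p_odd V_p Qq m0 cardF cR od.
  by rewrite -natrM -expnS prednK // subrr rmorph0 mulr0.
rewrite -mulr_sumr cardF => E.
rewrite !(rmorphB, rmorphD, rmorphM, rmorphXn) !rmorph_nat rmorph1 in E.
by rewrite natrX mulrBr [_ ^+ 2]expr2 -E; ring.
Qed.

(** The forms of [(a, b)] and [(- e a, - e b)] add up to the twisted form, whose sum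
    [(- p^D)^(k + j)] is negative since [k + j] is odd. So the two forms have opposite signs. *)
Lemma odd_class_opp j b : ~~ odd (m + D * j) -> ~~ odd j -> n j b <= n j (~~ b).
Proof.
move=> ev evj; pose phi (ab : F * F) := (- e * ab.1, - e * ab.2).
have ne0 : - e != 0 by rewrite oppr_eq0.
have phiI : injective phi by move=> [a b'] [a' b''] [/(mulfI ne0) -> /(mulfI ne0) ->].
rewrite /class_size ler_nat -(card_imset _ phiI); apply: subset_leq_card.
apply/subsetP => _ /imsetP[[a c] ac ->]; move: ac.
rewrite inE => /and3P[ac0 /eqP jac /eqP bac].
have phi0 : phi (a, c) != (0, 0).
  by apply: contraNneq ac0 => E; apply/eqP/phiI; rewrite E /phi !mulr0.
rewrite inE phi0 /=.
have [_ cR fl] := jbP ac0; have [_ cR' fl'] := jbP phi0.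
have sNe : s (- e) = - e by rewrite rmorphN se.
have jE : jf (phi (a, c)) = j.
  move: cR'; rewrite /= (radical_scale p_pr cardF sE _ _ sNe ne0) cR jac => /eqP.
  by rewrite eqn_exp2l ?prime_gt1 // eqn_pmul2l ?(D_gt0 m l_gt0) // => /eqP.
rewrite jE eqxx /=; rewrite jac bac in cR fl; rewrite jE in fl'.
case: fl => [od|fl]; first by rewrite od in ev.
case: fl' => [od|fl']; first by rewrite od in ev.
have tw := twisted_flat p_pr p_odd cardF l_gt0 sE k_odd sk mE e0 se e_nsq cR.
have := flat_unique tw (flat_conv p_pr fl fl').
set X := p%:R ^+ D; set b' := bf _ => E.
have X_gt0 : 0 < X :> int by rewrite exprn_gt0 // ltr0n prime_gt0.
have kj : odd (k + j) by rewrite oddD k_odd.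
have Y_gt0 : 0 < p%:R ^+ (m + D * j)./2 :> int by rewrite exprn_gt0 // ltr0n prime_gt0.
rewrite exprNn -signr_odd kj expr1 mulN1r in E.
case: (eqVneq b' b) => [bb|]; last by case: (b') (b) => [] [].
exfalso; move: E; rewrite bb mulrACA -expr2 sqrr_sign mul1r => E.
have : 0 < X ^+ (k + j) by rewrite exprn_gt0.
by rewrite -[X in _ < X]opprK E oppr_gt0 ltNge mulr_ge0 // ltW.
Qed.

Lemma odd_class_balanced j : ~~ odd (m + D * j) -> ~~ odd j -> n j true = n j false.
Proof.
by move=> ev evj; apply/eqP; rewrite eq_le (odd_class_opp true ev evj) (odd_class_opp false ev evj).
Qed.

End OddClasses.

(** * The case d' = 2d *)

Section EvenExtension.

Variables (p m l d k : nat) (F : finFieldType).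
Hypotheses (p_pr : prime p) (p_odd : odd p) (cardF : #|F| = (p ^ m)%N).
Hypotheses (l_gt0 : (0 < l)%N) (d_gt0 : (0 < d)%N).
Variable s : {rmorphism F -> F}.
Hypothesis sE : s =1 (fun x => x ^+ (p ^ l)).
Hypotheses (DE : gcdn m (2 * l) = (2 * d)%N) (mE : m = (2 * d * k)%N).
Hypothesis s_fixed : forall x, s (s x) = x -> s x = x ^+ (p ^ d).

Local Notation dform := (@dform p m l F).
Local Notation s3 x := (s (s (s x))).
Local Notation q := (p ^ m)%N.
Local Notation Q := (p ^ d)%N.
Local Notation norm x := (x ^+ Q.+1).

Lemma Q_gt1 : (1 < Q)%N.
Proof. by rewrite -(expn0 p) ltn_exp2l ?prime_gt1. Qed.

Lemma Q_fixed x : (s (s x) == x) = (x ^+ (Q * Q) == x).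
Proof.
have := tau_fixed cardF l_gt0 sE; rewrite DE => /setP/(_ x).
by rewrite !inE /= -expnD addnn mul2n.
Qed.

Lemma dvd_q : (Q.+1 * Q.-1 %| #|F|.-1)%N.
Proof.
have -> : (Q.+1 * Q.-1 = (p ^ (2 * d)).-1)%N.
  by rewrite mul2n -addnn expnD; have := Q_gt1; nia.
by rewrite cardF mE (expnM p (2 * d) k) dvdn_pred_predX.
Qed.

Definition norm_one : {set F} := [set u | norm u == 1].

Lemma card_norm_one : #|norm_one| = Q.+1.
Proof. by apply: card_unity_roots; apply: dvdn_trans dvd_q; exact: dvdn_mulr. Qed.

(** Surjectivity of the norm onto the field of [p^d] elements, from cyclicity of the multiplicative
    group of [F]. *)
Lemma norm_root (c : F) : c ^+ Q = c -> c != 0 -> exists z, norm z = c.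
Proof.
move=> cQ c0; have [k' kE] := dvdnP dvd_q.
apply: (@finfield_root F _ (k' * Q.-1)%N); first by rewrite mulnCA kE.
rewrite mulnC exprM; suff -> : c ^+ Q.-1 = 1 by rewrite expr1n.
by apply: (mulfI c0); rewrite -exprS prednK ?mulr1 // ltnW // Q_gt1.
Qed.

Lemma norm_fixed (z : F) : norm z ^+ Q = norm z -> s (s z) = z.
Proof.
move=> nz; apply/eqP; rewrite Q_fixed; apply/eqP.
case: (eqVneq z 0) => [->|z0].
  by rewrite expr0n muln_eq0 orbb gtn_eqF // ltnW // Q_gt1.
have zQ : z ^+ Q != 0 by rewrite expf_neq0.
apply: (mulIf zQ); rewrite -exprS -nz -exprM -exprD; congr (_ ^+ _); lia.
Qed.

Lemma norm_s z : s (s z) = z -> s z * z = norm z.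
Proof. by move/s_fixed => ->; rewrite exprS mulrC. Qed.

Lemma norm_fix z : s (s z) = z -> norm z ^+ Q = norm z.
Proof.
move/eqP; rewrite Q_fixed => /eqP zQ.
by rewrite -exprM mulSn addnC exprD zQ exprS mulrC.
Qed.

Lemma card_norm_fiber (c : F) : c ^+ Q = c ->
  #|[set z : F | norm z == c]| = if c == 0 then 1%N else Q.+1.
Proof.
move=> cQ; case: eqP => [->|/eqP c0].
  rewrite (_ : [set z | _] = [set 0]) ?cards1 //.
  by apply/setP => z; rewrite !inE expf_eq0.
have [z0 z0c] := norm_root cQ c0.
have z00 : z0 != 0 by apply: contraNneq c0 => z00; rewrite -z0c z00 expr0n.
transitivity #|norm_one|; last exact: card_norm_one.
rewrite -[RHS](card_imset _ (mulfI z00)); apply: eq_card => z.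
rewrite !inE; apply/eqP/imsetP => [zc|[u]].
  exists (z / z0); last by rewrite mulrC divfK.
  by rewrite inE expr_div_n zc -z0c divff // expf_neq0.
by rewrite inE => /eqP u1 ->; rewrite exprMn u1 mulr1.
Qed.

Lemma unit_twist_norm : unit_twist s = norm_one.
Proof.
apply/setP => z; rewrite !inE; apply/andP/eqP => [[/eqP tz /eqP]|nz].
  by rewrite norm_s.
have tz : s (s z) = z by apply: norm_fixed; rewrite nz expr1n.
by rewrite tz norm_s // nz !eqxx.
Qed.

Lemma dform_norm_one a b u x : u \in norm_one -> dform a b (u * x) = dform a b x.
Proof.
rewrite -unit_twist_norm inE => /andP[/eqP tu /eqP u1].
rewrite !(dformE _ sE) !rmorphM tu; congr (@Defs.Tr p m F _).
transitivity ((s u * u) * (a * (s3 x * x) + b * (s x * x))); first by ring.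
by rewrite u1 mul1r.
Qed.

(** The [p^d + 1] norm one elements preserve the form and act freely on nonzero vectors, so
    [flat_sign] applies to the form itself. *)
Lemma even_form_flat a b j : #|radical (dform a b)| = (p ^ (2 * d * j))%N ->
  flat (dform a b) ((- p%:R ^+ d) ^+ (k + j)).
Proof.
move=> cR; have m0 := card_exponent_gt0 cardF.
have Qq := quadratic_dform p_pr cardF sE a b.
have ev : ~~ odd (m + 2 * d * j) by rewrite mE -mulnDr -mulnA oddM.
have [b' fl] := quadratic_even p_pr p_odd (mulrnF_p p_pr cardF) Qq m0 cardF cR ev.
have half : ((m + 2 * d * j)./2 = d * (k + j))%N.
  by rewrite mE -mulnDr -mulnA mul2n doubleK.
rewrite half in fl; apply: (flat_sign p_pr p_odd d_gt0 (quadratic0 Qq) _ fl) => t.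
rewrite -card_norm_one; apply: (@free_orbits _ _ _ (fun u x => u * x)).
- move=> u x Uu; rewrite !inE dform_norm_one // => /andP[x0 ->]; rewrite andbT.
  rewrite mulf_neq0 //; apply: contraTneq Uu => ->.
  by rewrite inE expr0n eq_sym oner_eq0.
- by exists 1 => [|x]; rewrite ?mul1r // inE expr1n.
- move=> u v; rewrite !inE => /eqP u1 /eqP v1; exists (u * v) => [|x]; last by rewrite mulrA.
  by rewrite inE exprMn u1 v1 mulr1.
- move=> u; rewrite inE => /eqP u1; exists u^-1 => [|x]; first by rewrite inE exprVn u1 invr1.
  rewrite mulKf //; apply: contra_eq_neq u1 => ->.
  by rewrite expr0n eq_sym oner_eq0.
by move=> x; rewrite inE => /andP[x0 _] u v _ _ /(mulIf x0).
Qed.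

(** For [v = (1, y, z)], both [v] and [s^2 v] are orthogonal to [s v] and [s^3 v]; put
    [(0, a, b) = s^2 v - v]. By [H2] and [H3], [(a, b)] and [(y, z)] are orthogonal to the same
    nonzero vector of the plane, hence proportional ([H4]). Then [H1] makes [(y, z)] orthogonal to
    [(s y, s z)] unless [a = b = 0], while the first hypothesis gives that product the value -1. *)
Lemma isotropic_triple y z : 1 + s y * y + s z * z = 0 -> 1 + s3 y * y + s3 z * z = 0 ->
  s (s y) = y /\ s (s z) = z.
Proof.
move=> E1 E3.
have E1' : 1 + s (s y) * s y + s (s z) * s z = 0.
  by have := congr1 s E1; rewrite !rmorphD !rmorphM rmorph1 rmorph0.
have E1'' : 1 + s3 y * s (s y) + s3 z * s (s z) = 0.
  by have := congr1 s E1'; rewrite !rmorphD !rmorphM rmorph1 rmorph0.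
set a := s (s y) - y; set b := s (s z) - z.
have sa : s a = s3 y - s y by rewrite rmorphB.
have sb : s b = s3 z - s z by rewrite rmorphB.
have H1 : s y * a + s z * b = 0.
  transitivity ((1 + s (s y) * s y + s (s z) * s z) - (1 + s y * y + s z * z)).
    by rewrite /a /b; ring.
  by rewrite E1 E1' subrr.
have H2 : s a * a + s b * b = 0.
  transitivity ((1 + s3 y * s (s y) + s3 z * s (s z)) - (1 + s3 y * y + s3 z * z)
    - (s y * a + s z * b)); first by rewrite sa sb /a /b; ring.
  by rewrite E1'' E3 H1 !subrr.
have H3 : s a * y + s b * z = 0.
  transitivity ((1 + s3 y * y + s3 z * z) - (1 + s y * y + s z * z)).
    by rewrite sa sb; ring.
  by rewrite E1 E3 subrr.
suff [a0 b0] : a = 0 /\ b = 0.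
  by split; apply/eqP; rewrite -subr_eq0; apply/eqP.
case: (eqVneq a 0) => [a0|a0].
  split=> //; move/eqP: H2; rewrite a0 rmorph0 mul0r add0r mulf_eq0 fmorph_eq0 orbb.
  by move/eqP.
case: (eqVneq b 0) => [b0|b0].
  by move/eqP: H2; rewrite b0 rmorph0 mul0r addr0 mulf_eq0 fmorph_eq0 orbb (negPf a0).
have H4 : y * b = z * a.
  have sb0 : s b * b != 0 by rewrite mulf_neq0 ?fmorph_eq0.
  apply: (mulfI sb0).
  have -> : s b * b = - (s a * a) by apply/eqP; rewrite -addr_eq0 addrC H2.
  have -> : - (s a * a) * (y * b) = - (s a * y) * (a * b) by ring.
  have -> : - (s a * y) = s b * z by apply/eqP; rewrite eq_sym -addr_eq0 addrC H3.
  have -> : - (s a * a) = s b * b by apply/eqP; rewrite eq_sym -addr_eq0 addrC H2.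
  by ring.
case/negP: a0; apply/eqP.
transitivity ((1 + s y * y + s z * z) * a - y * (s y * a + s z * b) + s z * (y * b - z * a)).
  by ring.
by rewrite E1 H1 H4 subrr !mulr0 mul0r subr0 addr0.
Qed.

Local Notation pw i x := (x ^+ (p ^ (i * l) + 1)).

Lemma pw3E x : pw 3 x = s3 x * x.
Proof. by rewrite exprD expr1 (s3E sE). Qed.

Lemma pw1E x : x ^+ (p ^ l + 1) = s x * x.
Proof. by rewrite exprD expr1 sE. Qed.

Lemma N1_Q : (-1 : F) ^+ Q = -1.
Proof. by rewrite -signr_odd oddX p_odd orbT expr1. Qed.

(** Scaling one coordinate by an element of norm -1 turns the sums into the differences of
    [card_power_pairs]. *)
Lemma card_isotropic_pairs :
  #|[set yz : F * F | (s3 yz.1 * yz.1 + s3 yz.2 * yz.2 == 0)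
                     && (s yz.1 * yz.1 + s yz.2 * yz.2 == 0)]| =
  (1 + q.-1 * Q.+1)%N.
Proof.
have N10 : -1 != 0 :> F by rewrite oppr_eq0 oner_eq0.
have [i iE] := norm_root N1_Q N10.
have ti : s (s i) = i by apply: norm_fixed; rewrite iE N1_Q.
have si : s i * i = -1 by rewrite norm_s.
have i0 : i != 0 by apply: contraNneq N10 => i0; rewrite -iE i0 expr0n.
rewrite -card_norm_one -unit_twist_norm -(card_power_pairs cardF sE).
pose phi (yz : F * F) := (yz.1, i * yz.2).
have phiI : injective phi by move=> [y z] [y' z'] [-> /(mulfI i0) ->].
rewrite -(on_card_preimset (f := phi)); last by apply: onW_bij; exact: injF_bij.
apply: eq_card => -[y z]; rewrite !inE /= !pw3E !pw1E !rmorphM ti.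
by rewrite ![_ * (i * z)]mulrACA si !mulN1r.
Qed.

(** By [isotropic_triple] the solutions lie in the field of [p^(2d)] elements, where both equations
    become [1 + norm y + norm z = 0]. These are the affine points of the Hermitian curve. *)
Lemma card_affine_isotropic :
  #|[set yz : F * F | (1 + s3 yz.1 * yz.1 + s3 yz.2 * yz.2 == 0)
                     && (1 + s yz.1 * yz.1 + s yz.2 * yz.2 == 0)]| =
  (Q * (Q.+1 * Q.-1))%N.
Proof.
pose E := [set y : F | s (s y) == y].
have cE : #|E| = (Q * Q)%N.
  rewrite -expnD addnn -mul2n -DE -(card_tau_fixed p_pr cardF l_gt0 sE).
  by apply: eq_card => x; rewrite !inE.
have nE y : y \in E -> (- 1 - norm y) ^+ Q = - 1 - norm y.
  rewrite inE => /eqP ty; have QD := expF_frob p_pr cardF d.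
  by rewrite (addfB QD) N1_Q norm_fix.
have -> : #|[set yz : F * F | (1 + s3 yz.1 * yz.1 + s3 yz.2 * yz.2 == 0)
    && (1 + s yz.1 * yz.1 + s yz.2 * yz.2 == 0)]| =
    (\sum_(y in E) #|[set z : F | (norm z == - 1 - norm y)%R]|)%N.
  rewrite -sum1_card (partition_big (fun yz => yz.1) (mem E)) /=; last first.
    by move=> [y z]; rewrite !inE => /andP[/eqP E3 /eqP E1];
      have [/= -> _] := isotropic_triple E1 E3.
  apply: eq_bigr => y Ey; have pI : injective (pair y : F -> F * F) by move=> z z' [].
  rewrite -(card_imset _ pI).
  rewrite -sum1_card; apply: eq_bigl => -[y' z]; rewrite inE /=.
  apply/andP/imsetP => [[/andP[/eqP E3 /eqP E1] /eqP yy]|[z' Ez [-> ->]]].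
    rewrite yy in E1 E3 *; exists z => //; rewrite inE.
    have [ty tz] := isotropic_triple E1 E3; move: E1; rewrite !norm_s // => E1.
    by rewrite -subr_eq0 -[X in _ == X]E1; apply/eqP; ring.
  move: Ey Ez; rewrite !inE => /eqP ty /eqP nz.
  have tz : s (s z') = z' by apply: norm_fixed; rewrite nz nE // inE ty.
  by rewrite ty tz !norm_s // nz eqxx; split=> //; apply/andP; split; apply/eqP; ring.
rewrite (eq_bigr (fun y => if norm y == -1 then 1%N else Q.+1)); last first.
  move=> y Ey; rewrite card_norm_fiber ?nE //.
  by rewrite subr_eq0 eq_sym.
rewrite (bigID (fun y => norm y == -1)) /=.
have c1 : #|[set y in E | norm y == -1]| = Q.+1.
  transitivity #|[set y : F | norm y == -1]|.
    2: by rewrite (card_norm_fiber N1_Q) oppr_eq0 oner_eq0.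
  apply: eq_card => y; rewrite !inE; apply: andb_idl => /eqP ny.
  by apply/eqP/norm_fixed; rewrite ny N1_Q.
have c2 : #|[set y in E | norm y != -1]| = (Q * Q - Q.+1)%N.
  rewrite -cE -[X in (_ - X)%N]c1 -cardsDS; last by apply/subsetP => y; rewrite inE => /andP[].
  by apply: eq_card => y; rewrite !inE; case: (_ == y); rewrite ?andbF ?andbT.
rewrite (eq_bigr (fun=> 1%N)) => [|y /andP[_ ->] //].
rewrite [X in (_ + X)%N](eq_bigr (fun=> Q.+1)) => [|y /andP[_ /negPf ->] //].
rewrite sum1dep_card c1 sum_nat_cond_const.
have -> : #|[set y | (y \in E) && (norm y != -1)]| = (Q * Q - Q.+1)%N by rewrite -c2.
have := Q_gt1; nia.
Qed.

(** The Hermitian curve has [Q^3 + 1] projective points, [Q + 1] of them with first coordinate 0;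
    each gives [q - 1] nonzero vectors. *)
Lemma card_isotropic_triples :
  #|[set z : F * F * F |
      (pw 3 z.1.1 + pw 3 z.1.2 + pw 3 z.2 == 0) &&
      (z.1.1 ^+ (p ^ l + 1) + z.1.2 ^+ (p ^ l + 1) + z.2 ^+ (p ^ l + 1) == 0)]| =
  (1 + q.-1 * (Q ^ 3).+1)%N.
Proof.
have q1 : q.-1 = #|[set~ (0 : F)]| by rewrite cardsC1 cardF.
have -> : (1 + q.-1 * (Q ^ 3).+1 = (1 + q.-1 * Q.+1) + q.-1 * (Q * (Q.+1 * Q.-1)))%N.
  by have := Q_gt1; nia.
rewrite -card_isotropic_pairs -card_affine_isotropic q1.
set B3 := [set yz : F * F | (1 + _ + _ == 0) && _].
rewrite -(cardsID [set z : F * F * F | z.1.1 == 0]); congr (_ + _)%N.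
  have f_inj : injective (fun yz : F * F => (0 : F, yz.1, yz.2)) by move=> [y z] [y' z'] [-> ->].
  rewrite -(card_imset _ f_inj); apply: eq_card => -[[x y] z]; rewrite !inE /= !pw3E !pw1E.
  apply/andP/imsetP => [[E /eqP x0]|[[y' z']]].
    exists (y, z); last by rewrite x0.
    by move: E; rewrite inE x0 /= !mulr0 !add0r.
  by rewrite inE /= => E [-> -> ->]; rewrite eqxx !mulr0 !add0r.
rewrite -cardsX.
pose f (z : F * (F * F)) := (z.1, z.1 * z.2.1, z.1 * z.2.2).
have f_inj : {in setX [set~ 0] B3 &, injective f}.
  move=> [x [y z]] [x' [y' z']]; rewrite 3!inE /= => /andP[x0 _] _.
  by case=> <- /(mulfI x0) -> /(mulfI x0) ->.
rewrite -(card_in_imset f_inj); apply: eq_card => -[[x y] z]; rewrite !inE /= !pw3E !pw1E.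
have scale x' y' z' (t : F -> F) : {morph t : u v / u * v} ->
    t x' * x' + t (x' * y') * (x' * y') + t (x' * z') * (x' * z') =
    (t x' * x') * (1 + t y' * y' + t z' * z').
  by move=> tM; rewrite !tM; ring.
have s3M : {morph (fun x => s3 x) : u v / u * v} by move=> u v; rewrite !rmorphM.
apply/andP/imsetP => [[x0 /andP[E3 E1]]|[[x' [y' z']]]].
  have yE : y = x * (y / x) by rewrite mulrC divfK.
  have zE : z = x * (z / x) by rewrite mulrC divfK.
  exists (x, (y / x, z / x)); last by rewrite /f /= -yE -zE.
  move: E3 E1; rewrite yE zE (scale _ _ _ _ s3M) (scale _ _ _ _ (rmorphM s)) -yE -zE.
  by rewrite !mulf_eq0 !fmorph_eq0 !(negPf x0) /= !inE /= x0 => -> ->.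
rewrite !inE /= => /and3P[x0 /eqP E3 /eqP E1] [-> -> ->].
by rewrite (scale _ _ _ _ s3M) (scale _ _ _ _ (rmorphM s)) E3 E1 !mulr0 eqxx.
Qed.

End EvenExtension.

(** * The moment equations for the four coranks *)

Section EvenClasses.

Variables (p m l d k : nat) (F : finFieldType).
Hypotheses (p_pr : prime p) (p_odd : odd p) (cardF : #|F| = (p ^ m)%N).
Hypotheses (l_gt0 : (0 < l)%N) (d_gt0 : (0 < d)%N).
Variable s : {rmorphism F -> F}.
Hypothesis sE : s =1 (fun x => x ^+ (p ^ l)).
Hypotheses (DE : gcdn m (2 * l) = (2 * d)%N) (mE : m = (2 * d * k)%N).
Hypothesis s_fixed : forall x, s (s x) = x -> s x = x ^+ (p ^ d).

Local Notation dform := (@dform p m l F).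
Local Notation q := (p ^ m)%N.
Local Notation Q := (p%:R ^+ d).

Lemma even_class_exists : exists jf : F * F -> nat,
  forall ab, ab != (0, 0) ->
    (jf ab < 4)%N /\ #|radical (dform ab.1 ab.2)| = (p ^ (2 * d * jf ab))%N.
Proof.
have : forall ab : F * F, exists j : nat, ab != (0, 0) ->
    (j < 4)%N /\ #|radical (dform ab.1 ab.2)| = (p ^ (2 * d * j))%N.
  case=> a b; case: (eqVneq (a, b) (0, 0)) => [->|ab0]; first by exists 0%N.
  have [j j3 cR] := radical_card p_pr cardF l_gt0 sE ab0.
  by exists j => _; rewrite /= cR DE.
exact: fin_all_exists.
Qed.

Variable jf : F * F -> nat.
Hypothesis jP : forall ab, ab != (0, 0) ->
    (jf ab < 4)%N /\ #|radical (dform ab.1 ab.2)| = (p ^ (2 * d * jf ab))%N.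

Local Notation P := (fun ab : F * F => ab != (0, 0)).
Local Notation n j := (class_size P jf (fun=> true) j true).

(** The sign slot of [class_size] is constantly [true], because here the corank determines the
    sign. *)
Lemma even_class_sum (H : nat -> rat) :
  \sum_(ab | P ab) H (jf ab) = n 0 * H 0%N + n 1 * H 1%N + n 2 * H 2%N + n 3 * H 3%N.
Proof.
have lt4 ab : P ab -> (jf ab < 4)%N by move/jP => [].
rewrite (class_sum (fun=> true) (fun j _ => H j) lt4) !big_ord_recl big_ord0 /=.
have n0 j : class_size P jf (fun=> true) j false = 0.
  rewrite /class_size (eq_card0 (A := [set _ | _])) // => x; rewrite inE.
  by rewrite !andbF.
by rewrite !n0 !mul0r !addr0 !addrA.
Qed.

Lemma even_classes_total : n 0 + n 1 + n 2 + n 3 = q%:R ^+ 2 - 1.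
Proof.
have := even_class_sum (fun _ => 1); rewrite !mulr1 => <-.
rewrite sumr_const (eq_card (B := predC1 ((0, 0) : F * F))) // cardC1 card_prod.
by rewrite cardF -subn1 natrB ?muln_gt0 ?expn_gt0 ?prime_gt0 // natrM.
Qed.

Lemma even_flat ab : ab != (0, 0) ->
  flat (dform ab.1 ab.2) ((- Q) ^+ (k + jf ab)).
Proof.
move=> /jP[_ cR].
exact: (even_form_flat p_pr p_odd cardF l_gt0 d_gt0 sE DE mE s_fixed cR).
Qed.

Let p1 : (p%:R - 1 : rat) != 0.
Proof. by rewrite subr_eq0 -[1]/(1%:R) eqr_nat gtn_eqF ?prime_gt1. Qed.

Lemma even_classes_plain :
  n 0 * (- Q) ^+ k + n 1 * (- Q) ^+ k.+1 + n 2 * (- Q) ^+ k.+2 + n 3 * (- Q) ^+ k.+3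
  = q%:R ^+ 2 - q%:R.
Proof.
have := even_class_sum (fun j => (- Q) ^+ (k + j)); rewrite addn0 addn1 addn2 addn3 => <-.
apply: (mulfI p1).
have /(congr1 (intr : int -> rat)) := plain_moment l p_pr cardF.
rewrite rmorphM rmorph_sum (bigD1 (0%R, 0%R)) //= (flat_zeros (zero_form_flat l p_pr cardF)).
rewrite (eq_bigr (fun ab => (p%:R - 1) * (- Q) ^+ (k + jf ab))); last first.
  move=> ab ab0; rewrite (flat_zeros (even_flat ab0)) cardF addrC addKr.
  by rewrite rmorphM rmorphB rmorphXn rmorphN rmorphXn !rmorph_nat rmorph1.
rewrite -mulr_sumr cardF => E.
rewrite !(rmorphB, rmorphD, rmorphM, rmorphXn) !rmorph_nat rmorph1 in E.
by rewrite natrX mulrBr [_ ^+ 2]expr2 -E; ring.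
Qed.

Lemma even_classes_radical :
  n 0 + n 1 * Q ^+ 2 + n 2 * Q ^+ 4 + n 3 * Q ^+ 6 = q%:R * (q%:R - 1) * (Q + 1).
Proof.
have /(congr1 (fun n => n%:R : rat)) := radical_moment p_pr p_odd cardF sE.
rewrite natr_sum (bigD1 (0, 0)) //= (zero_form_card p_pr cardF sE).
rewrite (eq_bigr (fun ab => p%:R ^+ (2 * d * jf ab))); last first.
  by move=> ab /jP[_ ->]; rewrite natrX.
rewrite (even_class_sum (fun j => p%:R ^+ (2 * d * j))).
rewrite (unit_twist_norm p_pr p_odd cardF l_gt0 d_gt0 sE DE mE s_fixed).
rewrite (card_norm_one p_pr p_odd cardF l_gt0 d_gt0 DE mE).
have e2 j : p%:R ^+ (2 * d * j) = Q ^+ (2 * j) :> rat by rewrite -exprM; congr (_ ^+ _); lia.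
rewrite !e2 muln0 muln1 expr0 natrM natrD natrM -subn1 natrB ?expn_gt0 ?prime_gt0 //.
rewrite -[(p ^ d).+1%:R]natr1 (natrX _ _ d) => E.
by apply/eqP; rewrite -(inj_eq (addrI q%:R)); apply/eqP; move: E; rewrite mulr1; set X := Q; nra.
Qed.

(** Three copies of a form have the cube of its character sum, so the third moment counts isotropic
    vectors of length 3. The radical moment plays the part of the second one. *)
Lemma even_classes_cubic :
  n 0 * (- Q) ^+ k ^+ 3 + n 1 * (- Q) ^+ k.+1 ^+ 3 + n 2 * (- Q) ^+ k.+2 ^+ 3
    + n 3 * (- Q) ^+ k.+3 ^+ 3
  = q%:R ^+ 2 * (1 + (q%:R - 1) * (Q ^+ 3 + 1)) - q%:R ^+ 3.
Proof.
have := even_class_sum (fun j => (- Q) ^+ (k + j) ^+ 3).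
rewrite addn0 addn1 addn2 addn3 => <-; apply: (mulfI p1).
have TrD := traceD p_pr cardF.
have /(congr1 (intr : int -> rat)) := trace_moment p_pr cardF
  (fun z : F * F * F => z.1.1 ^+ (p ^ (3 * l) + 1) + z.1.2 ^+ (p ^ (3 * l) + 1)
     + z.2 ^+ (p ^ (3 * l) + 1))
  (fun z => z.1.1 ^+ (p ^ l + 1) + z.1.2 ^+ (p ^ l + 1) + z.2 ^+ (p ^ l + 1)).
rewrite (card_isotropic_triples p_pr p_odd cardF l_gt0 d_gt0 sE DE mE s_fixed).
pose T (ab : F * F) := dirsum (dirsum (dform ab.1 ab.2) (dform ab.1 ab.2)) (dform ab.1 ab.2).
have tE (ab : F * F) : [set z : F * F * F | Tr p m (ab.1 *
      (z.1.1 ^+ (p ^ (3 * l) + 1) + z.1.2 ^+ (p ^ (3 * l) + 1) + z.2 ^+ (p ^ (3 * l) + 1)) +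
    ab.2 * (z.1.1 ^+ (p ^ l + 1) + z.1.2 ^+ (p ^ l + 1) + z.2 ^+ (p ^ l + 1))) == 0%R] =
  [set z | T ab z == 0].
  apply/setP => z; rewrite !inE /T /dirsum /dform -!TrD.
  by congr (@Defs.Tr p m F _ == _); ring.
under eq_bigr => ab _ do rewrite tE.
have Tflat ab S : flat (dform ab.1 ab.2) S -> flat (T ab) (S ^+ 3).
  move=> fl; have := flat_conv p_pr (flat_conv p_pr fl fl) fl.
  by rewrite -[S ^+ 3]/(S * (S * S)) mulrA.
rewrite rmorph_sum (bigD1 (0%R, 0%R)) //=.
rewrite (flat_zeros (Tflat (0%R, 0%R) _ (zero_form_flat l p_pr cardF))).
rewrite (eq_bigr (fun ab => (p%:R - 1) * (- Q) ^+ (k + jf ab) ^+ 3)); last first.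
  move=> ab ab0; rewrite (flat_zeros (Tflat _ _ (even_flat ab0))) addrC addKr.
  by rewrite rmorphM rmorphB rmorphXn rmorphXn rmorphN rmorphXn !rmorph_nat rmorph1.
have addK (u v : int) : u + v - u = v by ring.
rewrite -mulr_sumr addK cardF => E.
rewrite natrD natrM -[(_ ^ 3).+1%:R]natr1 !natrX -subn1 natrB ?expn_gt0 ?prime_gt0 // in E.
rewrite natrX !(rmorphB, rmorphD, rmorphM, rmorphXn) !rmorph_nat !rmorph1 in E.
by rewrite natrX mulrBr -E; ring.
Qed.

End EvenClasses.

(** * The code as a vector space *)

Lemma linear_set_vspace (K : finFieldType) (I : finType) (C : {set {ffun I -> K^o}}) :
    0 \in C -> {in C &, forall x y, x + y \in C} ->
    (forall (t : K) x, x \in C -> t *: x \in C) ->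
  exists V : {vspace {ffun I -> K^o}}, C =i V.
Proof.
move=> C0 CD CZ; exists <<enum C>>%VS => x; apply/idP/idP => [Cx|].
  by rewrite memv_span // mem_enum.
move/(coord_span (X := in_tuple (enum C))) => ->.
apply: (big_ind (fun y => y \in C)) => // i _; apply: CZ.
by rewrite -mem_enum mem_nth.
Qed.

Section Code.

Variables (p m l : nat) (F : finFieldType).
Hypotheses (p_pr : prime p) (p_odd : odd p) (cardF : #|F| = (p ^ m)%N).
Variable s : {rmorphism F -> F}.
Hypothesis sE : s =1 (fun x => x ^+ (p ^ l)).

Local Notation Tr := (@Defs.Tr p m F).
Local Notation dform := (@dform p m l F).

Definition codeword_of (z : (F * F) * (F * 'F_p)) : {ffun F -> ('F_p)^o} :=
  codeword m l z.1.1 z.1.2 z.2.1 z.2.2.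

Lemma codeword_ofD : {morph codeword_of : y z / y + z}.
Proof.
have TrD := traceD p_pr cardF.
case=> [[a b] [c h]] [[a' b'] [c' h']]; apply/ffunP => x; rewrite !ffunE /=.
by rewrite [RHS]addrACA -TrD; congr (@Defs.Tr p m F _ + _); ring.
Qed.

Lemma trace_scale (t : 'F_p) x : Tr ((t : nat)%:R * x) = t * Tr x.
Proof.
by rewrite mulr_natl (addfMn _ (traceD p_pr cardF)) -mulr_natl Fp_nat.
Qed.

Lemma codeword_ofZ (t : 'F_p) z :
  t *: codeword_of z = codeword_of (((t : nat)%:R * z.1.1, (t : nat)%:R * z.1.2),
                                    ((t : nat)%:R * z.2.1, t * z.2.2)).
Proof.
case: z => [[a b] [c h]]; apply/ffunP => x; rewrite !ffunE /= [LHS]mulrDr.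
by rewrite -trace_scale; congr (@Defs.Tr p m F _ + _); ring.
Qed.

Lemma codeDE : codeD p m F l = [set codeword_of z | z : (F * F) * (F * 'F_p)].
Proof.
apply/setP => f; rewrite inE; apply/existsP/imsetP.
  case=> a /existsP[b /existsP[c /existsP[h /eqP ->]]].
  by exists ((a, b), (c, h)).
case=> [[[a b] [c h]] _ ->]; exists a; apply/existsP; exists b; apply/existsP; exists c.
by apply/existsP; exists h.
Qed.

Hypothesis rank_gt0 : forall ab : F * F, ab != (0, 0) ->
  #|radical (dform ab.1 ab.2)| != (p ^ m)%N.

(** If a word vanishes, its quadratic part is affine, with constant and hence zero polar form. The
    radical is then everything, so [a = b = 0], and nondegeneracy of the trace gives [c = 0]. *)
Lemma codeword_of_inj : injective codeword_of.
Proof.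
have TrD := traceD p_pr cardF.
suff ker0 z : codeword_of z = 0 -> z = 0.
  move=> y z yz; apply/eqP; rewrite -subr_eq0; apply/eqP/ker0.
  by rewrite (addfB codeword_ofD) yz subrr.
case: z => [[a b] [c h]] /ffunP z0.
have E x : dform a b x = - (Tr (c * x) + h).
  have := z0 x; rewrite /codeword_of /= (codewordE _ p_pr cardF) ffunE -addrA => /eqP.
  by rewrite addr_eq0 => /eqP.
have Qq := quadratic_dform p_pr cardF sE a b; have [_ QD] := Qq.
have polE x y : polar (dform a b) x y = h.
  by rewrite /polar !E mulrDr TrD; ring.
have h0 : h = 0 by rewrite -(polE 0 0) (addf0 (QD 0)).
have ab0 : (a, b) = (0, 0).
  apply/eqP; apply: contraT => ab0; case/negP: (rank_gt0 ab0); rewrite /= -cardF -cardsT.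
  apply/eqP; congr #|pred_of_set _|; apply/setP => x; rewrite !inE.
  by apply/forallP => y; rewrite polE h0.
case: ab0 => a0 b0; suff c0 : c = 0 by rewrite a0 b0 h0 c0.
apply: (trace_nondeg p_pr cardF) => x; have := E x.
rewrite a0 b0 h0 addr0 /dform !mul0r addr0 (addf0 TrD) => /esym/eqP.
by rewrite oppr_eq0 => /eqP.
Qed.

Lemma card_codeD : #|codeD p m F l| = (p ^ (3 * m + 1))%N.
Proof.
rewrite codeDE (card_imset _ codeword_of_inj) !card_prod cardF card_Fp //.
transitivity (p ^ m * p ^ m * (p ^ m * p ^ 1))%N; first by rewrite expn1.
by rewrite -!expnD; congr (_ ^ _)%N; lia.
Qed.

Lemma codeD_linear : is_linear_code (codeD p m F l) (p ^ m) (3 * m + 1).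
Proof.
split=> //; have [|||V VE] := @linear_set_vspace _ _ (codeD p m F l).
- rewrite codeDE; apply/imsetP; exists 0 => //; exact/esym/(addf0 codeword_ofD).
- rewrite codeDE => _ _ /imsetP[y _ ->] /imsetP[z _ ->].
  by rewrite -codeword_ofD; exact: imset_f.
- move=> t x; rewrite codeDE => /imsetP[z _ ->]; rewrite codeword_ofZ.
  exact: imset_f.
exists V => //; apply/eqP; rewrite -(eqn_exp2l _ _ (prime_gt1 p_pr)) -card_codeD.
by rewrite (eq_card VE) card_vspace card_Fp.
Qed.

Lemma weight_count w :
  #|[set f in codeD p m F l | weight f == w]|%:R =
  \sum_(ab : F * F) \sum_c \sum_(h : 'F_p)
     (weight (codeword m l ab.1 ab.2 c h) == w)%:R :> rat.
Proof.
rewrite card_setE codeDE big_imset /=; last by move=> y z _ _; exact: codeword_of_inj.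
rewrite (eq_bigl predT) //.
rewrite -(pair_bigA _ (fun (ab : F * F) (ch : F * 'F_p) =>
  (weight (codeword m l ab.1 ab.2 ch.1 ch.2) == w)%:R)) /=.
apply: eq_bigr => ab _.
by rewrite -(pair_bigA _ (fun c (h : 'F_p) => (weight (codeword m l ab.1 ab.2 c h) == w)%:R)).
Qed.

End Code.

(** * Comparison with the tables *)

Lemma table_sumE (T : seq (rat * rat)) w :
  \sum_(t <- T | t.1 == w%:R) t.2 = \sum_(t <- T) at_weight w t.1 * t.2.
Proof.
rewrite big_mkcond; apply: eq_bigr => t _.
by rewrite /at_weight; case: eqP; rewrite ?mul1r ?mul0r.
Qed.

(** Rewrites each power in the tables as a monomial in [c^d], [c^h] and [c]. The negative part of
    the exponent is added on the left, so that [lia] can settle the equation. *)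
Lemma pow_split (K : fieldType) (c : K) d h n i j f b e :
  c != 0 -> (n + (b * d + e) = i * d + j * h + f)%N ->
  c ^+ n = c ^+ d ^+ i * c ^+ h ^+ j * c ^+ f / (c ^+ d ^+ b * c ^+ e).
Proof.
move=> c0 E; apply: (mulIf (_ : c ^+ d ^+ b * c ^+ e != 0)).
  by rewrite mulf_neq0 ?expf_neq0.
rewrite divfK ?mulf_neq0 ?expf_neq0 // -!exprM -!exprD; congr (c ^+ _).
by rewrite ![(d * _)%N]mulnC [(h * _)%N]mulnC.
Qed.

Ltac pow d h i j f b e c0 XE YE :=
  rewrite (@pow_split _ _ d h _ i%N j%N f%N b%N e%N c0); [rewrite -?XE -?YE; field | lia].

Section OddTable.

Variables (p d u h m w : nat).
Local Notation c := (p%:R : rat).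
Local Notation q := (c ^+ m).

(** The equations determine the four frequencies, and the table becomes an identity of rational
    functions with the indicators as free variables. As [m] is odd, [Z] enters with
    [Z^2 * c = q]. *)
Lemma table_odd_arith (N0 N2 n1t n1f : rat) :
    (1 < p)%N -> d = (2 * u + 1)%N -> (2 * d <= h)%N -> m = (d + 2 * h)%N ->
    N0 + (n1t + n1f) + N2 = q ^+ 2 - 1 ->
    N0 + (n1t + n1f) * c ^+ d + N2 * c ^+ d ^+ 2 = 2%:R * q * (q - 1) ->
    N0 + N2 * c ^+ d ^+ 2 = (n1t + n1f) * c ^+ d ->
    (n1f - n1t) * c ^+ (d + h) = q ^+ 2 - q ->
  even_rank_count p m m q w + (N0 * odd_rank_count p m 0 w
  + (n1t * even_rank_count p m d (- c ^+ (d + h)) w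
     + n1f * even_rank_count p m d (c ^+ (d + h)) w)
  + N2 * odd_rank_count p m (2 * d) w) =
  \sum_(t <- table_odd p m d | t.1 == w%:R) t.2.
Proof.
move=> p_gt1 dE h_ge mE total rad twist plain.
have c0 : c != 0 by rewrite pnatr_eq0 -lt0n ltnW.
have [X XE] : {X : rat | X = c ^+ d} by exists (c ^+ d).
have [Y YE] : {Y : rat | Y = c ^+ h} by exists (c ^+ h).
have [Z ZE0] : {Z : rat | Z = c ^+ (u + h)} by exists (c ^+ (u + h)).
rewrite -XE in rad twist.
have X0 : X != 0 by rewrite XE expf_neq0.
have Y0 : Y != 0 by rewrite YE expf_neq0.
have X1 : X ^+ 2 - 1 != 0.
  rewrite XE -exprM subr_eq0 -[1]/(1%:R) -natrX eqr_nat gtn_eqF // -(expn0 p) ltn_exp2l //.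
  by rewrite dE; lia.
have qE : q = X * Y ^+ 2 by rewrite mE exprD mulnC exprM XE YE.
rewrite exprD -XE -YE in plain *.
have N1 : n1t + n1f = Y ^+ 2 * (q - 1).
  apply: (mulIf X0); apply: (@mulfI _ 2%:R) => //.
  transitivity (N0 + (n1t + n1f) * X + N2 * X ^+ 2).
    by rewrite addrAC twist; ring.
  by rewrite rad qE; ring.
have dn : n1f - n1t = Y * (q - 1).
  by apply: (mulIf (mulf_neq0 X0 Y0)); rewrite plain qE; ring.
have n1fE : n1f = Y * (Y + 1) * (q - 1) / 2%:R.
  apply: (@mulIf _ 2%:R) => //; rewrite divfK //.
  by transitivity ((n1t + n1f) + (n1f - n1t)); [ring | rewrite N1 dn; ring].
have n1tE : n1t = Y * (Y - 1) * (q - 1) / 2%:R.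
  apply: (@mulIf _ 2%:R) => //; rewrite divfK //.
  by transitivity ((n1t + n1f) - (n1f - n1t)); [ring | rewrite N1 dn; ring].
have N2E : N2 = (q - 1) * (Y ^+ 2 - 1) / (X ^+ 2 - 1).
  apply: (mulIf X1); rewrite divfK //.
  transitivity ((N0 + N2 * X ^+ 2) - (N0 + (n1t + n1f) + N2) + (n1t + n1f)); first by ring.
  by rewrite twist total N1 qE; ring.
have N0E : N0 = q ^+ 2 - 1 - Y ^+ 2 * (q - 1) - N2 by rewrite -total -N1; ring.
have q1E : c ^+ (m - 1) = X * Y ^+ 2 / c
  by pow d h 1%N 2%N 0%N 0%N 1%N c0 XE YE.
have p1E : c ^+ m.-1 = X * Y ^+ 2 / c
  by pow d h 1%N 2%N 0%N 0%N 1%N c0 XE YE.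
pose A x := at_weight w x.
pose Wb := A (X * Y ^+ 2 - X * Y ^+ 2 / c).
pose W0 (e : rat) := A (X * Y ^+ 2 - X * Y ^+ 2 / c + e * Z).
pose W1 (e : rat) := A (X * Y ^+ 2 - X * Y ^+ 2 / c + e * (c - 1) * X * Y / c).
pose W1' (e : rat) := A (X * Y ^+ 2 - X * Y ^+ 2 / c + e * X * Y / c).
pose W2 (e : rat) := A (X * Y ^+ 2 - X * Y ^+ 2 / c + e * X * Z).
have ZE : Z ^+ 2 * c = X * Y ^+ 2.
  by rewrite ZE0 XE YE -!exprM -!exprD -exprSr; congr (c ^+ _); rewrite dE; lia.
have T0 e : at_weight w (c ^+ (m - 1)./2 * (c ^+ (m + 1)./2 - c ^+ (m - 1)./2 + e)) = W0 e.
  have -> : ((m - 1)./2 = u + h)%N by lia.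
  have -> : ((m + 1)./2 = (u + h).+1)%N by lia.
  congr (at_weight w _); rewrite exprS -ZE0 -ZE; field; exact: c0.
have T1 e : at_weight w (c ^+ (m + d - 2)./2 * (c ^+ 1 - 1) * (c ^+ (m - d)./2 + e)) = W1 e.
  have -> : ((m - d)./2 = h)%N by lia.
  have -> : c ^+ (m + d - 2)./2 = X * Y / c
    by pow d h 1%N 1%N 0%N 0%N 1%N c0 XE YE.
  by congr (at_weight w _); rewrite -YE expr1; field.
have T1' e : at_weight w (c ^+ (m + d - 2)./2 *
    (c ^+ (m - d + 2)./2 - c ^+ (m - d)./2 + e)) = W1' e.
  have -> : ((m - d)./2 = h)%N by lia.
  have -> : ((m - d + 2)./2 = h.+1)%N by lia.
  have -> : c ^+ (m + d - 2)./2 = X * Y / c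
    by pow d h 1%N 1%N 0%N 0%N 1%N c0 XE YE.
  by congr (at_weight w _); rewrite exprS -YE; field.
have T2 e : at_weight w (c ^+ (m + 2 * d - 1)./2 *
    (c ^+ (m - 2 * d + 1)./2 - c ^+ (m - 2 * d - 1)./2 + e)) = W2 e.
  have -> : c ^+ (m + 2 * d - 1)./2 = X * Z.
    by rewrite XE ZE0 -exprD; congr (c ^+ _); lia.
  have -> : c ^+ (m - 2 * d - 1)./2 = Z / X.
    rewrite ZE0; apply: (mulIf X0); rewrite divfK // XE -exprD; congr (c ^+ _); lia.
  have -> : c ^+ (m - 2 * d + 1)./2 = Z * c / X.
    rewrite ZE0; apply: (mulIf X0); rewrite divfK // XE -exprD -exprSr; congr (c ^+ _); lia.
  by congr (at_weight w _); rewrite -ZE; field; rewrite X0 c0.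
have T3 (e : rat) : c ^+ (m - 1) * (c ^+ 1 - 1) = X * Y ^+ 2 - X * Y ^+ 2 / c.
  by rewrite q1E; field.
have E1 : c ^+ (2 * m + 2 * d - 1) = X ^+ 4 * Y ^+ 4 / c by pow d h 4%N 4%N 0%N 0%N 1%N c0 XE YE.
have E2 : c ^+ (2 * m + d) = X ^+ 3 * Y ^+ 4 by pow d h 3%N 4%N 0%N 0%N 0%N c0 XE YE.
have E3 : c ^+ (2 * m + d - 1) = X ^+ 3 * Y ^+ 4 / c by pow d h 3%N 4%N 0%N 0%N 1%N c0 XE YE.
have E4 : c ^+ (2 * m) = X ^+ 2 * Y ^+ 4 by pow d h 2%N 4%N 0%N 0%N 0%N c0 XE YE.
have E5 : c ^+ (2 * m - 1) = X ^+ 2 * Y ^+ 4 / c by pow d h 2%N 4%N 0%N 0%N 1%N c0 XE YE.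
have E6 : c ^+ (2 * m - 2 * d) = Y ^+ 4 by pow d h 0%N 4%N 0%N 0%N 0%N c0 XE YE.
have E7 : c ^+ (2 * m - 3 * d) = Y ^+ 4 / X by pow d h 0%N 4%N 0%N 1%N 0%N c0 XE YE.
have E8 : c ^+ (2 * m - 3 * d - 1) = Y ^+ 4 / (X * c).
  by pow d h 0%N 4%N 0%N 1%N 1%N c0 XE YE; rewrite c0 X0.
have E9 : c ^+ (m + 2 * d - 1) = X ^+ 3 * Y ^+ 2 / c by pow d h 3%N 2%N 0%N 0%N 1%N c0 XE YE.
have E10 : c ^+ (m - 2 * d) = Y ^+ 2 / X by pow d h 0%N 2%N 0%N 1%N 0%N c0 XE YE.
have E11 : c ^+ (m - 2 * d - 1) = Y ^+ 2 / (X * c).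
  by pow d h 0%N 2%N 0%N 1%N 1%N c0 XE YE; rewrite c0 X0.
have E12 : c ^+ (2 * d) = X ^+ 2 by pow d h 2%N 0%N 0%N 0%N 0%N c0 XE YE.
have E13 : c ^+ (m + 2 * d) = X ^+ 3 * Y ^+ 2 by pow d h 3%N 2%N 0%N 0%N 0%N c0 XE YE.
have E14 : c ^+ (m - d) = Y ^+ 2 by pow d h 0%N 2%N 0%N 0%N 0%N c0 XE YE.
have E15 : c ^+ (3 * m - 3 * d)./2 = Y ^+ 3 by pow d h 0%N 3%N 0%N 0%N 0%N c0 XE YE.
have E16 : c ^+ (m - d)./2 = Y by pow d h 0%N 1%N 0%N 0%N 0%N c0 XE YE.
have t0 : c ^+ (m + 0)./2 = Z by rewrite ZE0; congr (c ^+ _); lia.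
have t2 : c ^+ (m + 2 * d)./2 = X * Z by rewrite XE ZE0 -exprD; congr (c ^+ _); lia.
have A0 : at_weight w (X * Y ^+ 2 - X * Y ^+ 2 / c - (c - 1) * (X * Y ^+ 2) / c) = at_weight w 0.
  by congr (at_weight w _); field.
have Aq : at_weight w (X * Y ^+ 2 - X * Y ^+ 2 / c + X * Y ^+ 2 / c) = at_weight w (X * Y ^+ 2).
  by congr (at_weight w _); field.
have A1 : at_weight w (X * Y ^+ 2 - X * Y ^+ 2 / c + Z) = W0 1 by rewrite /W0 mul1r.
have A2 : at_weight w (X * Y ^+ 2 - X * Y ^+ 2 / c - Z) = W0 (-1) by rewrite /W0 mulN1r.
have A3 : at_weight w (X * Y ^+ 2 - X * Y ^+ 2 / c + X * Z) = W2 1 by rewrite /W2 mul1r.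
have A4 : at_weight w (X * Y ^+ 2 - X * Y ^+ 2 / c - X * Z) = W2 (-1) by rewrite /W2 mulN1r mulNr.
have A5 : at_weight w (X * Y ^+ 2 - X * Y ^+ 2 / c - (c - 1) * - (X * Y) / c) = W1 1.
  by congr (at_weight w _); field.
have A6 : at_weight w (X * Y ^+ 2 - X * Y ^+ 2 / c - (c - 1) * (X * Y) / c) = W1 (-1).
  by congr (at_weight w _); field.
have A7 : at_weight w (X * Y ^+ 2 - X * Y ^+ 2 / c + - (X * Y) / c) = W1' (-1).
  by congr (at_weight w _); field.
have A8 : at_weight w (X * Y ^+ 2 - X * Y ^+ 2 / c + X * Y / c) = W1' 1.
  by congr (at_weight w _); field.
rewrite table_sumE /table_odd !big_cat !big_map !big_cons !big_nil /= !T3 // !T0 !T1 !T1' !T2.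
rewrite /even_rank_count /odd_rank_count t0 t2 p1E subn0 subnn expr0 !expr1.
rewrite E1 E2 E3 E4 E5 E6 E7 E8 E9 E10 E11 E12 E13 E14 E15 E16 qE.
rewrite A0 Aq A1 A2 A3 A4 A5 A6 A7 A8.
rewrite N0E N2E n1tE n1fE qE.
(* This sign only swaps the two lines of a pair, whose multiplicities are equal. *)
have sgn : ((-1) ^+ (p - 1)./2 = 1 :> rat) \/ ((-1) ^+ (p - 1)./2 = -1 :> rat).
  by rewrite -signr_odd; case: (odd _); [right | left].
case: sgn => ->.
  rewrite mulr1 mul1r; move: (W0 1) (W0 (-1)) (W1 1) (W1 (-1)) (W1' 1) (W1' (-1))
    (W2 1) (W2 (-1)) (at_weight w _) (at_weight w _) (at_weight w _) => *.
  by field; rewrite c0 X0 X1.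
rewrite mulrNN mulr1 mul1r; move: (W0 1) (W0 (-1)) (W1 1) (W1 (-1)) (W1' 1) (W1' (-1))
    (W2 1) (W2 (-1)) (at_weight w _) (at_weight w _) (at_weight w _) => *.
by field; rewrite c0 X0 X1.
Qed.

End OddTable.

Section EvenTable.

Variables (p d u h m w : nat).
Local Notation c := (p%:R : rat).
Local Notation q := (c ^+ m).

(** Every rank is even, so coranks 0 and 2 carry signs as well, half of each kind. The base variable
    is [c^u] with [u = d / 2], since half multiples of [d] occur as exponents. *)
Lemma table_even_arith (N0 N2 n1t n1f : rat) :
    (1 < p)%N -> d = (2 * u)%N -> (0 < d)%N -> (2 * d <= h)%N -> m = (d + 2 * h)%N ->
    N0 + (n1t + n1f) + N2 = q ^+ 2 - 1 ->
    N0 + (n1t + n1f) * c ^+ d + N2 * c ^+ d ^+ 2 = 2%:R * q * (q - 1) ->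
    N0 + N2 * c ^+ d ^+ 2 = (n1t + n1f) * c ^+ d ->
    (n1f - n1t) * c ^+ (d + h) = q ^+ 2 - q ->
  even_rank_count p m m q w +
  (N0 / 2%:R * even_rank_count p m 0 (- c ^+ (u + h)) w
     + N0 / 2%:R * even_rank_count p m 0 (c ^+ (u + h)) w
  + (n1t * even_rank_count p m d (- c ^+ (d + h)) w
     + n1f * even_rank_count p m d (c ^+ (d + h)) w)
  + (N2 / 2%:R * even_rank_count p m (2 * d) (- c ^+ (d + u + h)) w
     + N2 / 2%:R * even_rank_count p m (2 * d) (c ^+ (d + u + h)) w)) =
  \sum_(t <- table_even p m d | t.1 == w%:R) t.2.
Proof.
move=> p_gt1 dE d_gt0 h_ge mE total rad twist plain.
have c0 : c != 0 by rewrite pnatr_eq0 -lt0n ltnW.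
have [Z ZE] : {Z : rat | Z = c ^+ u} by exists (c ^+ u).
have [Y YE] : {Y : rat | Y = c ^+ h} by exists (c ^+ h).
have Z0 : Z != 0 by rewrite ZE expf_neq0.
have Y0 : Y != 0 by rewrite YE expf_neq0.
have XE : c ^+ d = Z ^+ 2 by rewrite ZE -exprM dE mulnC.
have X1 : Z ^+ 4 - 1 != 0.
  rewrite ZE -exprM subr_eq0 -[1]/(1%:R) -natrX eqr_nat gtn_eqF // -(expn0 p) ltn_exp2l //.
  by lia.
have qE : q = Z ^+ 2 * Y ^+ 2 by rewrite mE exprD XE mulnC exprM YE.
rewrite XE in rad twist; rewrite !exprD XE -ZE -YE in plain *.
have N1 : n1t + n1f = Y ^+ 2 * (q - 1).
  apply: (mulIf (mulf_neq0 Z0 Z0)); apply: (@mulfI _ 2%:R) => //.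
  transitivity (N0 + (n1t + n1f) * Z ^+ 2 + N2 * Z ^+ 2 ^+ 2).
    by rewrite addrAC twist; ring.
  by rewrite rad qE; ring.
have dn : n1f - n1t = Y * (q - 1).
  by apply: (mulIf (mulf_neq0 (mulf_neq0 Z0 Z0) Y0)); rewrite -expr2 plain qE; ring.
have n1fE : n1f = Y * (Y + 1) * (q - 1) / 2%:R.
  apply: (@mulIf _ 2%:R) => //; rewrite divfK //.
  by transitivity ((n1t + n1f) + (n1f - n1t)); [ring | rewrite N1 dn; ring].
have n1tE : n1t = Y * (Y - 1) * (q - 1) / 2%:R.
  apply: (@mulIf _ 2%:R) => //; rewrite divfK //.
  by transitivity ((n1t + n1f) - (n1f - n1t)); [ring | rewrite N1 dn; ring].
have N2E : N2 = (q - 1) * (Y ^+ 2 - 1) / (Z ^+ 4 - 1).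
  apply: (mulIf X1); rewrite divfK //.
  transitivity ((N0 + N2 * Z ^+ 2 ^+ 2) - (N0 + (n1t + n1f) + N2) + (n1t + n1f)); first by ring.
  by rewrite twist total N1 qE; ring.
have N0E : N0 = q ^+ 2 - 1 - Y ^+ 2 * (q - 1) - N2 by rewrite -total -N1; ring.
have q1E : c ^+ (m - 1) = Z ^+ 2 * Y ^+ 2 / c by pow u h 2%N 2%N 0%N 0%N 1%N c0 ZE YE.
have p1E : c ^+ m.-1 = Z ^+ 2 * Y ^+ 2 / c by pow u h 2%N 2%N 0%N 0%N 1%N c0 ZE YE.
pose W (x e : rat) := at_weight w (Z ^+ 2 * Y ^+ 2 - Z ^+ 2 * Y ^+ 2 / c + e * (c - 1) * x / c).
pose W' (x e : rat) := at_weight w (Z ^+ 2 * Y ^+ 2 - Z ^+ 2 * Y ^+ 2 / c + e * x / c).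
have sE : (m./2 = u + h)%N by lia.
have Es1 : c ^+ (m./2 - 1) = Z * Y / c by pow u h 1%N 1%N 0%N 0%N 1%N c0 ZE YE.
have Es : c ^+ m./2 = Z * Y by pow u h 1%N 1%N 0%N 0%N 0%N c0 ZE YE.
have Es2 : c ^+ (m./2 + 1) = Z * Y * c by rewrite addn1 exprSr Es.
have E16 : c ^+ (m - d)./2 = Y by pow u h 0%N 1%N 0%N 0%N 0%N c0 ZE YE.
have E17 : c ^+ (m - d + 2)./2 = Y * c by pow u h 0%N 1%N 1%N 0%N 0%N c0 ZE YE.
have E18 : c ^+ (m + d - 2)./2 = Z ^+ 2 * Y / c by pow u h 2%N 1%N 0%N 0%N 1%N c0 ZE YE.
have E19 : c ^+ (m + 2 * d - 2)./2 = Z ^+ 3 * Y / c by pow u h 3%N 1%N 0%N 0%N 1%N c0 ZE YE.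
have E20 : c ^+ (m - 2 * d)./2 = Y / Z by pow u h 0%N 1%N 0%N 1%N 0%N c0 ZE YE.
have E21 : c ^+ (m - 2 * d + 2)./2 = Y * c / Z by pow u h 0%N 1%N 1%N 1%N 0%N c0 ZE YE.
have T0 e : at_weight w (c ^+ (m./2 - 1) * (c ^+ 1 - 1) * (c ^+ m./2 + e)) = W (Z * Y) e.
  by congr (at_weight w _); rewrite Es1 Es expr1; field.
have T0' e : at_weight w (c ^+ (m./2 - 1) * (c ^+ (m./2 + 1) - c ^+ m./2 + e)) = W' (Z * Y) e.
  by congr (at_weight w _); rewrite Es1 Es2 Es; field.
have T1 e : at_weight w (c ^+ (m + d - 2)./2 * (c ^+ 1 - 1) * (c ^+ (m - d)./2 + e)) =
    W (Z ^+ 2 * Y) e.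
  by congr (at_weight w _); rewrite E16 E18 expr1; field.
have T1' e : at_weight w (c ^+ (m + d - 2)./2 *
    (c ^+ (m - d + 2)./2 - c ^+ (m - d)./2 + e)) = W' (Z ^+ 2 * Y) e.
  by congr (at_weight w _); rewrite E16 E17 E18; field.
have T2 e : at_weight w (c ^+ (m + 2 * d - 2)./2 * (c ^+ 1 - 1) * (c ^+ (m - 2 * d)./2 + e)) =
    W (Z ^+ 3 * Y) e.
  by congr (at_weight w _); rewrite E19 E20 expr1; field; rewrite Z0 c0.
have T2' e : at_weight w (c ^+ (m + 2 * d - 2)./2 *
    (c ^+ (m - 2 * d + 2)./2 - c ^+ (m - 2 * d)./2 + e)) = W' (Z ^+ 3 * Y) e.
  by congr (at_weight w _); rewrite E19 E20 E21; field; rewrite Z0 c0.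
have T3 : c ^+ (m - 1) * (c ^+ 1 - 1) = Z ^+ 2 * Y ^+ 2 - Z ^+ 2 * Y ^+ 2 / c.
  by rewrite q1E; field.
have E1 : c ^+ (2 * m - d) = Z ^+ 2 * Y ^+ 4 by pow u h 2%N 4%N 0%N 0%N 0%N c0 ZE YE.
have E6 : c ^+ (2 * m - 2 * d) = Y ^+ 4 by pow u h 0%N 4%N 0%N 0%N 0%N c0 ZE YE.
have E7 : c ^+ (2 * m - 3 * d) = Y ^+ 4 / Z ^+ 2 by pow u h 0%N 4%N 0%N 2%N 0%N c0 ZE YE.
have E10 : c ^+ (m - 2 * d) = Y ^+ 2 / Z ^+ 2 by pow u h 0%N 2%N 0%N 2%N 0%N c0 ZE YE.
have E12 : c ^+ (2 * d) = Z ^+ 4 by pow u h 4%N 0%N 0%N 0%N 0%N c0 ZE YE.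
have E13 : c ^+ (m + 2 * d) = Z ^+ 6 * Y ^+ 2 by pow u h 6%N 2%N 0%N 0%N 0%N c0 ZE YE.
have E14 : c ^+ (m - d) = Y ^+ 2 by pow u h 0%N 2%N 0%N 0%N 0%N c0 ZE YE.
have E15 : c ^+ (3 * m - 3 * d)./2 = Y ^+ 3 by pow u h 0%N 3%N 0%N 0%N 0%N c0 ZE YE.
pose b := Z ^+ 2 * Y ^+ 2 - Z ^+ 2 * Y ^+ 2 / c.
have A0 : at_weight w (b - (c - 1) * (Z ^+ 2 * Y ^+ 2) / c) = at_weight w 0.
  by congr (at_weight w _); rewrite /b; field.
have Aq : at_weight w (b + Z ^+ 2 * Y ^+ 2 / c) = at_weight w (Z ^+ 2 * Y ^+ 2).
  by congr (at_weight w _); rewrite /b; field.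
have AN x : at_weight w (b - (c - 1) * - x / c) = W x 1.
  by congr (at_weight w _); rewrite /b; field.
have AP x : at_weight w (b - (c - 1) * x / c) = W x (-1).
  by congr (at_weight w _); rewrite /b; field.
have AN' x : at_weight w (b + - x / c) = W' x (-1).
  by congr (at_weight w _); rewrite /b; field.
have AP' x : at_weight w (b + x / c) = W' x 1.
  by congr (at_weight w _); rewrite /b; field.
rewrite table_sumE /table_even !big_cat !big_map !big_cons !big_nil /=.
rewrite !T3 // !T0 !T0' !T1 !T1' !T2 !T2'.
rewrite /even_rank_count p1E subn0 subnn expr0 !expr1.
rewrite E1 E6 E7 E10 E12 E13 E14 E15 E16 qE -/b.
rewrite A0 Aq !AN !AP !AN' !AP' -!exprSr.
rewrite N0E N2E n1tE n1fE qE.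
move: (W (Z * Y) 1) (W (Z * Y) (-1)) (W' (Z * Y) 1) (W' (Z * Y) (-1)).
move: (W (Z ^+ 2 * Y) 1) (W (Z ^+ 2 * Y) (-1)) (W' (Z ^+ 2 * Y) 1) (W' (Z ^+ 2 * Y) (-1)).
move: (W (Z ^+ 3 * Y) 1) (W (Z ^+ 3 * Y) (-1)) (W' (Z ^+ 3 * Y) 1) (W' (Z ^+ 3 * Y) (-1)).
move: (at_weight w _) (at_weight w _) (at_weight w _) => *.
by field; rewrite ?c0 ?Z0 X1.
Qed.

End EvenTable.

Section DoubleTable.

Variables (p d k m w : nat).
Local Notation c := (p%:R : rat).
Local Notation q := (c ^+ m).

(** After division by powers of the corank 0 sum, the hypotheses are the moments of order 0 to 3 of
    a distribution on the nodes [(- p^d)^j], a Vandermonde system. *)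
Lemma table_double_arith (n0 n1 n2 n3 : rat) (S := fun j => (- c ^+ d) ^+ (k + j)) :
    (1 < p)%N -> (0 < d)%N -> (3 < k)%N -> m = (2 * d * k)%N ->
    n0 + n1 + n2 + n3 = q ^+ 2 - 1 ->
    n0 * S 0%N + n1 * S 1%N + n2 * S 2 + n3 * S 3 = q ^+ 2 - q ->
    n0 + n1 * c ^+ d ^+ 2 + n2 * c ^+ d ^+ 4 + n3 * c ^+ d ^+ 6 = q * (q - 1) * (c ^+ d + 1) ->
    n0 * S 0%N ^+ 3 + n1 * S 1%N ^+ 3 + n2 * S 2 ^+ 3 + n3 * S 3 ^+ 3 =
      q ^+ 2 * (1 + (q - 1) * (c ^+ d ^+ 3 + 1)) - q ^+ 3 ->
  even_rank_count p m m q w +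
  (n0 * even_rank_count p m 0 (S 0%N) w + n1 * even_rank_count p m (2 * d) (S 1%N) w
   + n2 * even_rank_count p m (4 * d) (S 2) w + n3 * even_rank_count p m (6 * d) (S 3) w) =
  \sum_(t <- table_double p m d | t.1 == w%:R) t.2.
Proof.
move=> p_gt1 d_gt0 k_gt3 mE.
have c0 : c != 0 by rewrite pnatr_eq0 -lt0n ltnW.
(* This is [m / 2 - 3d]: every exponent in the table is then a combination of [h] and [d], up to a
   shift by one. *)
have [h hE] : {h : nat | h = (d * (k - 3))%N} by exists (d * (k - 3))%N.
have h_gt0 : (0 < h)%N by rewrite hE muln_gt0 d_gt0 subn_gt0.
have sE : (d * k = h + 3 * d)%N by rewrite hE mulnBr [(3 * d)%N]mulnC subnK //
   leq_mul2l ltnW // orbT.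
have {hE k_gt3}mE' : m = (2 * h + 6 * d)%N by rewrite mE -mulnA sE; lia.
have muE0 : mu m d = (-1) ^+ k
  by rewrite /mu; congr (_ ^+ _); rewrite mE -mulnA mul2n doubleK mulKn.
move: sE; clear mE => sE.
have [X XE] : {X : rat | X = c ^+ d} by exists (c ^+ d).
have [Y YE] : {Y : rat | Y = c ^+ h} by exists (c ^+ h).
have X0 : X != 0 by rewrite XE expf_neq0.
have Y0 : Y != 0 by rewrite YE expf_neq0.
have E0 : c ^+ (m - 1) = X ^+ 6 * Y ^+ 2 / c by pow d h 6%N 2%N 0%N 0%N 1%N c0 XE YE.
have E1 : c ^+ (m.-1) = X ^+ 6 * Y ^+ 2 / c by pow d h 6%N 2%N 0%N 0%N 1%N c0 XE YE.
have E2 : c ^+ (m./2 - 1) = X ^+ 3 * Y / c by pow d h 3%N 1%N 0%N 0%N 1%N c0 XE YE.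
have E3 : c ^+ (m./2 + 1) = X ^+ 3 * Y * c by pow d h 3%N 1%N 1%N 0%N 0%N c0 XE YE.
have E4 : c ^+ (m./2 + d - 1) = X ^+ 4 * Y / c by pow d h 4%N 1%N 0%N 0%N 1%N c0 XE YE.
have E5 : c ^+ (m./2 - d + 1) = X ^+ 2 * Y * c by pow d h 2%N 1%N 1%N 0%N 0%N c0 XE YE.
have E6 : c ^+ (m./2 - d) = X ^+ 2 * Y by pow d h 2%N 1%N 0%N 0%N 0%N c0 XE YE.
have E7 : c ^+ (m./2 + 2 * d - 1) = X ^+ 5 * Y / c by pow d h 5%N 1%N 0%N 0%N 1%N c0 XE YE.
have E8 : c ^+ (m./2 - 2 * d + 1) = X * Y * c by pow d h 1%N 1%N 1%N 0%N 0%N c0 XE YE.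
have E9 : c ^+ (m./2 - 2 * d) = X * Y by pow d h 1%N 1%N 0%N 0%N 0%N c0 XE YE.
have E10 : c ^+ (m./2 + 3 * d - 1) = X ^+ 6 * Y / c by pow d h 6%N 1%N 0%N 0%N 1%N c0 XE YE.
have E11 : c ^+ (m./2 - 3 * d + 1) = Y * c by pow d h 0%N 1%N 1%N 0%N 0%N c0 XE YE.
have E12 : c ^+ (m./2 - 3 * d) = Y by pow d h 0%N 1%N 0%N 0%N 0%N c0 XE YE.
have E13 : c ^+ (m./2) = X ^+ 3 * Y by pow d h 3%N 1%N 0%N 0%N 0%N c0 XE YE.
have E14 : c ^+ (m - 2 * d) = X ^+ 4 * Y ^+ 2 by pow d h 4%N 2%N 0%N 0%N 0%N c0 XE YE.
have E15 : c ^+ (m - 4 * d) = X ^+ 2 * Y ^+ 2 by pow d h 2%N 2%N 0%N 0%N 0%N c0 XE YE.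
have E16 : c ^+ (m - 6 * d) = Y ^+ 2 by pow d h 0%N 2%N 0%N 0%N 0%N c0 XE YE.
have E17 : c ^+ (3 * m./2 - d) = X ^+ 8 * Y ^+ 3 by pow d h 8%N 3%N 0%N 0%N 0%N c0 XE YE.
have E18 : c ^+ (3 * m./2 - 8 * d) = X * Y ^+ 3 by pow d h 1%N 3%N 0%N 0%N 0%N c0 XE YE.
have E19 : c ^+ (m - d) = X ^+ 5 * Y ^+ 2 by pow d h 5%N 2%N 0%N 0%N 0%N c0 XE YE.
have E20 : c ^+ (2 * m) = X ^+ 12 * Y ^+ 4 by pow d h 12%N 4%N 0%N 0%N 0%N c0 XE YE.
have E21 : c ^+ (2 * m - 9 * d) = X ^+ 3 * Y ^+ 4 by pow d h 3%N 4%N 0%N 0%N 0%N c0 XE YE.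
have E22 : c ^+ (3 * m./2 - 3 * d) = X ^+ 6 * Y ^+ 3 by pow d h 6%N 3%N 0%N 0%N 0%N c0 XE YE.
have E23 : c ^+ (3 * m./2 - 5 * d) = X ^+ 4 * Y ^+ 3 by pow d h 4%N 3%N 0%N 0%N 0%N c0 XE YE.
have E24 : c ^+ (m + 6 * d) = X ^+ 12 * Y ^+ 2 by pow d h 12%N 2%N 0%N 0%N 0%N c0 XE YE.
have E25 : c ^+ (m + 4 * d) = X ^+ 10 * Y ^+ 2 by pow d h 10%N 2%N 0%N 0%N 0%N c0 XE YE.
have E26 : c ^+ (m + d) = X ^+ 7 * Y ^+ 2 by pow d h 7%N 2%N 0%N 0%N 0%N c0 XE YE.
have E27 : c ^+ (m./2 + 5 * d) = X ^+ 8 * Y by pow d h 8%N 1%N 0%N 0%N 0%N c0 XE YE.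
have E28 : c ^+ (m./2 + 4 * d) = X ^+ 7 * Y by pow d h 7%N 1%N 0%N 0%N 0%N c0 XE YE.
have E29 : c ^+ (6 * d) = X ^+ 6 by pow d h 6%N 0%N 0%N 0%N 0%N c0 XE YE.
have E30 : c ^+ (m + 3 * d) = X ^+ 9 * Y ^+ 2 by pow d h 9%N 2%N 0%N 0%N 0%N c0 XE YE.
have E31 : c ^+ (m + 2 * d) = X ^+ 8 * Y ^+ 2 by pow d h 8%N 2%N 0%N 0%N 0%N c0 XE YE.
have E32 : c ^+ (m./2 + 3 * d) = X ^+ 6 * Y by pow d h 6%N 1%N 0%N 0%N 0%N c0 XE YE.
have E33 : c ^+ (3 * d) = X ^+ 3 by pow d h 3%N 0%N 0%N 0%N 0%N c0 XE YE.
have E34 : c ^+ (m./2 + d) = X ^+ 4 * Y by pow d h 4%N 1%N 0%N 0%N 0%N c0 XE YE.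
have E35 : c ^+ (2 * d) = X ^+ 2 by pow d h 2%N 0%N 0%N 0%N 0%N c0 XE YE.
move=> M0 M1 M2 M3.
have X_gt1 : 1 < X by rewrite XE -natrX -[1]/(1%:R) ltr_nat -(expn0 p) ltn_exp2l.
have XP1 : X + 1 != 0 by apply/eqP; nra.
have XM1 : X ^+ 2 - 1 != 0 by apply/eqP; nra.
have X_gt0 : 0 < X by apply: lt_trans X_gt1.
have XP3 : X ^+ 3 + 1 != 0 by rewrite gt_eqF // addr_gt0 ?exprn_gt0.
have qE : q = X ^+ 6 * Y ^+ 2.
  by rewrite mE' exprD XE YE -!exprM mulrC [(d * 6)%N]mulnC [(h * 2)%N]mulnC.
have [M ME] : {M : rat | M = (-1) ^+ k} by exists ((-1) ^+ k).
have muE : mu m d = M by rewrite ME.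
have MM : M = 1 \/ M = -1 by rewrite ME -signr_odd; case: (odd k); [right | left].
have M2E : M ^+ 2 = 1 by case: MM => ->; rewrite ?sqrrN expr1n.
have Sk : (- c ^+ d) ^+ k = M * (X ^+ 3 * Y).
  by rewrite exprNn -ME -exprM sE exprD -YE [(3 * d)%N]mulnC exprM -XE [Y * _]mulrC.
have S0 : S 0%N = M * (X ^+ 3 * Y) by rewrite /S addn0.
have S1 : S 1%N = - (M * (X ^+ 4 * Y)) by rewrite /S exprD Sk -XE; ring.
have S2 : S 2 = M * (X ^+ 5 * Y) by rewrite /S exprD Sk -XE; ring.
have S3 : S 3 = - (M * (X ^+ 6 * Y)) by rewrite /S exprD Sk -XE; ring.
rewrite -XE in M2 M3; rewrite !S0 !S1 !S2 !S3 in M1 M3 *; move: @S S0 S1 S2 S3 => _ _ _ _ _.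
have MM0 : M * (X ^+ 3 * Y) != 0.
  by rewrite !mulf_neq0 ?expf_neq0 // ME signr_eq0.
have {}M1 : n0 - n1 * X + n2 * X ^+ 2 - n3 * X ^+ 3 = M * (X ^+ 3 * Y) * (q - 1).
  apply: (mulfI MM0); transitivity (M ^+ 2 * (q * (q - 1))); last by rewrite qE; ring.
  by rewrite M2E; transitivity (q ^+ 2 - q); [rewrite -M1; ring | ring].
have {}M3 : n0 - n1 * X ^+ 3 + n2 * X ^+ 6 - n3 * X ^+ 9 = M * (X ^+ 3 * Y) * (q - 1) * X ^+ 3.
  have MM3 : (M * (X ^+ 3 * Y)) ^+ 3 != 0 by rewrite expf_neq0.
  apply: (mulfI MM3).
  transitivity ((M ^+ 2) ^+ 2 * (q ^+ 2 * (q - 1) * X ^+ 3)); last by rewrite qE; ring.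
  rewrite M2E expr1n mul1r.
  transitivity (q ^+ 2 * (1 + (q - 1) * (X ^+ 3 + 1)) - q ^+ 3); last by ring.
  by rewrite -M3; ring.
(* The next four identities invert the Vandermonde matrix with nodes 1, [- X], [X^2], [- X^3]. *)
have n0E : n0 = (M * (X ^+ 3 * Y) * (q - 1) * X ^+ 3
    + (X - X ^+ 2 + X ^+ 3) * (q * (q - 1) * (X + 1))
    + (X ^+ 4 - X ^+ 3 - X ^+ 5) * (M * (X ^+ 3 * Y) * (q - 1)) - X ^+ 6 * (q ^+ 2 - 1))
    / ((1 + X) * (1 - X ^+ 2) * (1 + X ^+ 3)).
  rewrite -M3 -M2 -M1 -M0; field.
  by rewrite [1 + X]addrC XP1 [1 + _]addrC XP3 -[1 - _]opprB oppr_eq0 XM1.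
have n1E : n1 = (M * (X ^+ 3 * Y) * (q - 1) * X ^+ 3
    - (1 + X ^+ 2 - X ^+ 3) * (q * (q - 1) * (X + 1))
    + (X ^+ 2 - X ^+ 3 - X ^+ 5) * (M * (X ^+ 3 * Y) * (q - 1)) + X ^+ 5 * (q ^+ 2 - 1))
    / (X ^+ 2 * (X + 1) ^+ 2 * (X ^+ 2 - 1)).
  by rewrite -M3 -M2 -M1 -M0; field; rewrite X0 XP1 XM1.
have n2E : n2 = (M * (X ^+ 3 * Y) * (q - 1) * X ^+ 3
    - (1 - X - X ^+ 3) * (q * (q - 1) * (X + 1))
    + (X ^+ 4 - X - X ^+ 3) * (M * (X ^+ 3 * Y) * (q - 1)) - X ^+ 4 * (q ^+ 2 - 1))
    / (X ^+ 3 * (X + 1) ^+ 2 * (X ^+ 2 - 1)).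
  by rewrite -M3 -M2 -M1 -M0; field; rewrite X0 XP1 XM1.
have n3E : n3 = - (M * (X ^+ 3 * Y) * (q - 1) * X ^+ 3
    - (1 - X + X ^+ 2) * (q * (q - 1) * (X + 1))
    + (X ^+ 2 - X - X ^+ 3) * (M * (X ^+ 3 * Y) * (q - 1)) + X ^+ 3 * (q ^+ 2 - 1))
    / (X ^+ 3 * (X ^+ 3 + 1) * (X ^+ 2 - 1) * (X + 1)).
  by rewrite -M3 -M2 -M1 -M0; field; rewrite X0 XP1 XM1 XP3.
pose W (x e : rat) := at_weight w (X ^+ 6 * Y ^+ 2 - X ^+ 6 * Y ^+ 2 / c + e * (c - 1) * x / c).
pose W' (x e : rat) := at_weight w (X ^+ 6 * Y ^+ 2 - X ^+ 6 * Y ^+ 2 / c + e * x / c).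
have T0 e : at_weight w (c ^+ (m./2 - 1) * (c ^+ 1 - 1) * (c ^+ (m./2) + e)) =
    W (X ^+ 3 * Y) e.
  by congr (at_weight w _); rewrite E2 E13 expr1; field.
have T0' e : at_weight w (c ^+ (m./2 - 1) * (c ^+ (m./2 + 1) - c ^+ (m./2) + e)) =
    W' (X ^+ 3 * Y) e.
  by congr (at_weight w _); rewrite E2 E3 E13; field.
have T1 e : at_weight w (c ^+ (m./2 + d - 1) * (c ^+ 1 - 1) * (c ^+ (m./2 - d) + e)) =
    W (X ^+ 4 * Y) e.
  by congr (at_weight w _); rewrite E4 E6 expr1; field.
have T1' e : at_weight w (c ^+ (m./2 + d - 1) * (c ^+ (m./2 - d + 1) - c ^+ (m./2 - d) + e)) =
    W' (X ^+ 4 * Y) e.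
  by congr (at_weight w _); rewrite E4 E5 E6; field.
have T2 e : at_weight w (c ^+ (m./2 + 2 * d - 1) * (c ^+ 1 - 1) * (c ^+ (m./2 - 2 * d) + e)) =
    W (X ^+ 5 * Y) e.
  by congr (at_weight w _); rewrite E7 E9 expr1; field.
have T2' e : at_weight w (c ^+ (m./2 + 2 * d - 1) * (c ^+ (m./2 - 2 * d + 1) - c ^+ (m./2 - 2 * d) + e)) =
    W' (X ^+ 5 * Y) e.
  by congr (at_weight w _); rewrite E7 E8 E9; field.
have T3 e : at_weight w (c ^+ (m./2 + 3 * d - 1) * (c ^+ 1 - 1) * (c ^+ (m./2 - 3 * d) + e)) =
    W (X ^+ 6 * Y) e.
  by congr (at_weight w _); rewrite E10 E12 expr1; field.
have T3' e : at_weight w (c ^+ (m./2 + 3 * d - 1) * (c ^+ (m./2 - 3 * d + 1) - c ^+ (m./2 - 3 * d) + e)) =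
    W' (X ^+ 6 * Y) e.
  by congr (at_weight w _); rewrite E10 E11 E12; field.
have TB : c ^+ (m - 1) * (c ^+ 1 - 1) = X ^+ 6 * Y ^+ 2 - X ^+ 6 * Y ^+ 2 / c.
  by rewrite E0; field.
pose b := X ^+ 6 * Y ^+ 2 - X ^+ 6 * Y ^+ 2 / c.
have A0 : at_weight w (b - (c - 1) * (X ^+ 6 * Y ^+ 2) / c) = at_weight w 0.
  by congr (at_weight w _); rewrite /b; field.
have Aq : at_weight w (b + X ^+ 6 * Y ^+ 2 / c) = at_weight w (X ^+ 6 * Y ^+ 2).
  by congr (at_weight w _); rewrite /b; field.
have AN x : at_weight w (b - (c - 1) * - (M * x) / c) = W x M.
  by congr (at_weight w _); rewrite /b; field.
have AP x : at_weight w (b - (c - 1) * (M * x) / c) = W x (- M).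
  by congr (at_weight w _); rewrite /b; field.
have AN' x : at_weight w (b + - (M * x) / c) = W' x (- M).
  by congr (at_weight w _); rewrite /b; field.
have AP' x : at_weight w (b + M * x / c) = W' x M.
  by congr (at_weight w _); rewrite /b; field.
rewrite table_sumE /table_double /Q0 /Q1 /Q2 /Q3 !muE !big_cons !big_nil /=.
rewrite !TB // !T0 !T0' !T1 !T1' !T2 !T2' !T3 !T3'.
rewrite /even_rank_count E1 subn0 subnn expr0 !expr1 -XE.
rewrite qE in n0E n1E n2E n3E *.
rewrite ?E0 ?E1 ?E2 ?E3 ?E4 ?E5 ?E6 ?E7 ?E8 ?E9 ?E10 ?E11 ?E12 ?E13
  ?E14 ?E15 ?E16 ?E17 ?E18 ?E19 ?E20 ?E21 ?E22 ?E23 ?E24 ?E25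
  ?E26 ?E27 ?E28 ?E29 ?E30 ?E31 ?E32 ?E33 ?E34 ?E35 -/b.
rewrite A0 Aq !AN !AP !AN' !AP'.
rewrite n0E n1E n2E n3E.
move: (W (X ^+ 3 * Y) (- M)) (W' (X ^+ 3 * Y) M) (W (X ^+ 4 * Y) M) (W' (X ^+ 4 * Y) (- M)).
move: (W (X ^+ 5 * Y) (- M)) (W' (X ^+ 5 * Y) M) (W (X ^+ 6 * Y) M) (W' (X ^+ 6 * Y) (- M)).
move: (at_weight w _) (at_weight w _) (at_weight w _) => *.
have XM1' : 1 - X ^+ 2 != 0 by rewrite -opprB oppr_eq0.
have XP1' : 1 + X != 0 by rewrite addrC.
have XP3' : 1 + X ^+ 3 != 0 by rewrite addrC.
case: MM => ->; field; rewrite ?c0 ?X0 ?XP1 ?XM1 ?XP3 ?XP1' ?XM1' ?XP3' //.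
Qed.

End DoubleTable.

Lemma excluded_ratio (l m a b : nat) : (0 < b)%N ->
  (l%:R : rat) != a%:R * m%:R / b%:R -> (b * l)%N != (a * m)%N.
Proof.
move=> b0; apply: contraNneq => E.
have b0' : b%:R != 0 :> rat by rewrite pnatr_eq0 -lt0n.
by apply/eqP/(mulIf b0'); rewrite divfK // mulrC -!natrM E.
Qed.

(** Write [m = d m'] and [l = d l'] with [m'], [l'] coprime and [l' < m']. An odd [m'] is neither 1
    nor 3. If [m'] is even then [l'] is odd, and [m'] equal to 2, 4 or 6 would make [l / m] an
    excluded fraction. *)
Lemma gcd_double_cases m l (d := gcdn m l) : (0 < l < m)%N ->
    [/\ (6 * l)%N != (1 * m)%N, (4 * l)%N != (1 * m)%N, (2 * l)%N != (1 * m)%N,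
        (4 * l)%N != (3 * m)%N & (6 * l)%N != (5 * m)%N] ->
    m <> (3 * d)%N ->
  (0 < d)%N /\
  ((exists k, [/\ gcdn m (2 * l) = d, m = (d * k)%N, odd k & (5 <= k)%N]) \/
   (exists k l', [/\ gcdn m (2 * l) = (2 * d)%N, m = (2 * d * k)%N, (3 < k)%N,
                     l = (d * l')%N & odd l'])).
Proof.
move=> /andP[l0 lm] [m6 m4 m2 m34 m56] m3.
have d0 : (0 < d)%N by rewrite gcdn_gt0 l0 orbT.
have [m' mE] : exists m', m = (d * m')%N.
  by have /dvdnP[m' E] := dvdn_gcdl m l; exists m'; rewrite mulnC.
have [l' lE] : exists l', l = (d * l')%N.
  by have /dvdnP[l' E] := dvdn_gcdr m l; exists l'; rewrite mulnC.
have co : coprime m' l'.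
  by rewrite /coprime -(eqn_pmul2l d0) muln1 muln_gcdr -mE -lE.
have DE : gcdn m (2 * l) = (d * gcdn m' (2 * l'))%N.
  by rewrite muln_gcdr -mE mulnCA -lE.
have l'0 : (0 < l')%N by move: l0; rewrite lE muln_gt0 d0.
have lm' : (l' < m')%N by move: lm; rewrite lE mE ltn_pmul2l.
have P a b : ((a * l)%N != (b * m)%N) = (a * l' != b * m')%N.
  by rewrite {1}lE {1}mE ![(_ * (d * _))%N]mulnCA eqn_pmul2l.
move: m6 m4 m2 m34 m56; rewrite !P => m6 m4 m2 m34 m56.
have m'3 : m' != 3%N by apply/eqP => E; apply: m3; rewrite mE E mulnC.
split=> //; case: (boolP (odd m')) => [od|ev].
  left; exists m'; split=> //; last by lia.
  have c2 : coprime m' 2 by rewrite coprimen2.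
  by rewrite DE Gauss_gcdr // (eqP co) muln1.
have [k kE] : exists k, m' = (2 * k)%N by exists m'./2; rewrite mul2n even_halfK.
have l'od : odd l'.
  move: co; rewrite kE coprimeMl coprime2n => /andP[] //.
right; exists k, l'; split=> //.
- rewrite DE kE -muln_gcdr.
  by move: co; rewrite kE coprimeMl => /andP[_ /eqP ->]; rewrite muln1 mulnC.
- by rewrite mE kE mulnCA mulnA.
rewrite ltnNge; apply/negP => k3.
have l'3 : ~ (l' = 3%N /\ k = 3%N).
  by case=> l3 k3'; move: co; rewrite kE l3 k3'.
by move: k3 kE m6 m4 m2 m34 m56 lm' l'0 l'od l'3; clear; lia.
Qed.

(** * Assembling the weight distribution *)

Section Distribution.

Variables (p m l d k : nat) (F : finFieldType).
Hypotheses (p_pr : prime p) (p_odd : odd p) (cardF : #|F| = (p ^ m)%N).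
Hypotheses (l_gt0 : (0 < l)%N) (d_gt0 : (0 < d)%N).
Variable s : {rmorphism F -> F}.
Hypothesis sE : s =1 (fun x => x ^+ (p ^ l)).

Local Notation dform := (@dform p m l F).
Local Notation c := (p%:R : rat).

(** The corank is at most 3 over a field over which [F] has dimension greater than 3. *)
Lemma radical_proper : (exists2 D, gcdn m (2 * l) = D & exists2 k, (3 < k)%N & m = (D * k)%N) ->
  forall ab : F * F, ab != (0, 0) -> #|radical (dform ab.1 ab.2)| != (p ^ m)%N.
Proof.
case=> D DE [k' k'3 mE] [a b] ab0 /=.
have [j j3 ->] := radical_card p_pr cardF l_gt0 sE ab0.
have D0 := D_gt0 m l_gt0; rewrite DE in D0 *.
by rewrite eqn_exp2l ?prime_gt1 // [X in _ == X]mE eqn_pmul2l // neq_ltn (leq_ltn_trans j3).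
Qed.

Hypothesis proper : forall ab : F * F, ab != (0, 0) ->
  #|radical (dform ab.1 ab.2)| != (p ^ m)%N.

Lemma weight_count_split w :
  #|[set f in codeD p m F l | weight f == w]|%:R =
  even_rank_count p m m (c ^+ m) w + \sum_(ab : F * F | ab != (0, 0)) \sum_x \sum_(h : 'F_p)
     (weight (codeword m l ab.1 ab.2 x h) == w)%:R.
Proof.
rewrite (weight_count p_pr cardF sE proper) (bigD1 (0, 0)) //=; congr (_ + _).
rewrite (flat_weights p_pr p_odd cardF sE w (zero_form_card p_pr cardF sE)
  (zero_form_flat l p_pr cardF)).
by rewrite rmorphXn rmorph_nat.
Qed.

Section SingleGcd.

Hypotheses (DE : gcdn m (2 * l) = d) (mE : m = (d * k)%N) (k_odd : odd k) (k_ge5 : (5 <= k)%N).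
Hypothesis l_dvd : (d %| l)%N.

Let h := (d * k./2)%N.

Lemma iter_frob_id : iter k s =1 id.
Proof.
move=> x; have iterE n : iter n s x = x ^+ (p ^ (n * l)).
  elim: n => [|n IHn]; first by rewrite mul0n expn0 expr1.
  by rewrite iterS IHn sE -exprM -expnD mulSn addnC.
rewrite iterE; have /dvdnP[l' ->] := l_dvd.
have := fixed_field_iter l' (fixed_field_full cardF x).
by rewrite inE mulnCA [(k * d)%N]mulnC -mE => /eqP.
Qed.

Lemma single_mE : m = (d + 2 * h)%N.
Proof.
rewrite mE -{1}(odd_double_half k) k_odd mulnDr muln1 -mul2n /h.
by rewrite mulnCA.
Qed.

Lemma single_h_ge : (2 * d <= h)%N.
Proof. by rewrite mulnC leq_mul2l (half_leq k_ge5) orbT. Qed.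

Variables (jf : F * F -> nat) (bf : F * F -> bool).
Hypothesis jbP : forall ab, ab != (0, 0) -> odd_class p m l ab (jf ab) (bf ab).
Local Notation n j b := (class_size (fun ab : F * F => ab != (0, 0)) jf bf j b).

Definition class_count (w j : nat) (b : bool) : rat :=
  if odd (m + d * j) then odd_rank_count p m (d * j) w
  else even_rank_count p m (d * j) ((-1) ^+ b * c ^+ (m + d * j)./2) w.

Lemma single_weight_count w :
  #|[set f in codeD p m F l | weight f == w]|%:R =
  even_rank_count p m m (c ^+ m) w
  + (n 0 true * class_count w 0 true + n 0 false * class_count w 0 false
  + (n 1 true * class_count w 1 true + n 1 false * class_count w 1 false)
  + (n 2 true * class_count w 2 true + n 2 false * class_count w 2 false)).
Proof.
rewrite weight_count_split -(odd_class_sum jbP); congr (_ + _).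
apply: eq_bigr => -[a b] /jbP[_]; rewrite /class_count DE /= => cR.
case: (boolP (odd _)) => [od _|ev [//|fl]].
  exact: (odd_rank_weights p_pr p_odd cardF sE).
rewrite (flat_weights p_pr p_odd cardF sE w cR fl) rmorphM rmorphXn rmorphN1.
by rewrite rmorphXn rmorph_nat.
Qed.

End SingleGcd.

End Distribution.

Theorem theorem7 (p m l : nat) (F : finFieldType)
    (p_prime : prime p) (p_odd : odd p) (m_ge6 : (6 <= m)%N)
    (cardF : #|F| = (p ^ m)%N)
    (l_range : (1 <= l <= m - 1)%N)
    (l_excl : (l%:R : rat) \notin
                [:: m%:R / 6; m%:R / 4; m%:R / 2; 3 * m%:R / 4; 5 * m%:R / 6]) :
  let d := gcdn m l in
  let d' := gcdn m (2 * l) in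
  m <> (3 * d)%N ->
  let D := codeD p m F l in
  [/\ is_linear_code D (p ^ m) (3 * m + 1),
      d' = d -> odd d -> has_weight_distribution D (table_odd p m d),
      d' = d -> ~~ odd d -> has_weight_distribution D (table_even p m d)
    & d' = (2 * d)%N -> has_weight_distribution D (table_double p m d)].
Proof.
move=> d d' m3 D.
have l_lt : (0 < l < m)%N by lia.
have l_gt0 : (0 < l)%N by lia.
have excl : [/\ (6 * l)%N != (1 * m)%N, (4 * l)%N != (1 * m)%N, (2 * l)%N != (1 * m)%N,
        (4 * l)%N != (3 * m)%N & (6 * l)%N != (5 * m)%N].
  move: l_excl; rewrite !inE !negb_or => /and5P[e1 e2 e3 e4 e5].
  by split; apply: excluded_ratio; rewrite // mul1r.
have [d_gt0 cases] := gcd_double_cases l_lt excl m3.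
rewrite -/d -/d' in d_gt0 cases.
have [s sE] := frob_rmorphism p_prime cardF l.
have proper : forall ab : F * F, ab != (0, 0) ->
    #|radical (dform p m l ab.1 ab.2)| != (p ^ m)%N.
  apply: (radical_proper p_prime cardF l_gt0 sE); exists d' => //.
  case: cases => [[k [DE mE _ k5]]|[k [l' [DE mE k3 _ _]]]]; exists k => //.
  - exact: leq_trans k5.
  - by rewrite DE.
  by rewrite DE.
have p_gt1 := prime_gt1 p_prime.
split.
- exact: (codeD_linear p_prime p_odd cardF sE proper).
- move=> DE d_odd; case: cases => [[k [_ mE k_odd k5]]|[k [l' [DE' _ _ _ _]]]]; last by lia.
  have sk := iter_frob_id cardF sE mE (dvdn_gcdr m l).
  have [jf [bf jbP]] := odd_class_exists p_prime p_odd cardF l_gt0 sE k_odd sk.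
  have [e [e0 se ens]] := nonsquare_fixed p_prime p_odd cardF s.
  have mE' := single_mE mE k_odd; have h_ge := single_h_ge d k5.
  have total := odd_classes_total p_prime cardF jbP.
  have rad := odd_classes_radical p_prime p_odd cardF sE k_odd sk jbP.
  have mDE : m = (gcdn m (2 * l) * k)%N by rewrite -/d' DE.
  have twist := odd_classes_twisted p_prime p_odd cardF l_gt0 sE k_odd sk mDE jbP e0 se ens.
  have plain := odd_classes_plain p_prime p_odd cardF sE jbP.
  rewrite -/d' DE in rad twist.
  (* Both [m] and [d] are odd, so among the coranks 0, 1, 2 only corank 1 gives an even rank and a
     sign. *)
  have o0 : odd (m + d * 0) by rewrite muln0 addn0 mE oddM d_odd k_odd.
  have o1 : ~~ odd (m + d * 1) by rewrite muln1 oddD d_odd mE oddM d_odd k_odd.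
  have o2 : odd (m + d * 2) by rewrite oddD [(d * 2)%N]mulnC oddM addbF mE oddM d_odd k_odd.
  rewrite /odd_class_value -/d' DE o0 o2 (negPf o1) in plain.
  move=> w; rewrite (single_weight_count p_prime p_odd cardF sE proper DE jbP).
  rewrite /class_count o0 o2 (negPf o1).
  have E1 : ((m + d * 1)./2 = d + d * k./2)%N by rewrite muln1 {1}mE'; lia.
  have dE : d = (2 * d./2 + 1)%N by rewrite -{1}(odd_double_half d) d_odd addnC mul2n.
  rewrite E1 !natrX in plain total rad *.
  rewrite -(table_odd_arith w p_gt1 dE h_ge mE' total rad twist); last first.
    by rewrite -plain expr1 expr0; ring.
  by rewrite muln0 muln1 [(d * 2)%N]mulnC expr1 expr0 mulN1r mul1r; ring.
- move=> DE d_even; case: cases => [[k [_ mE k_odd k5]]|[k [l' [DE' _ _ _ _]]]]; last by lia.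
  have sk := iter_frob_id cardF sE mE (dvdn_gcdr m l).
  have [jf [bf jbP]] := odd_class_exists p_prime p_odd cardF l_gt0 sE k_odd sk.
  have [e [e0 se ens]] := nonsquare_fixed p_prime p_odd cardF s.
  have mE' := single_mE mE k_odd; have h_ge := single_h_ge d k5.
  have total := odd_classes_total p_prime cardF jbP.
  have rad := odd_classes_radical p_prime p_odd cardF sE k_odd sk jbP.
  have mDE : m = (gcdn m (2 * l) * k)%N by rewrite -/d' DE.
  have twist := odd_classes_twisted p_prime p_odd cardF l_gt0 sE k_odd sk mDE jbP e0 se ens.
  have plain := odd_classes_plain p_prime p_odd cardF sE jbP.
  have balanced := odd_class_balanced p_prime p_odd cardF l_gt0 sE k_odd sk mDE jbP e0 se ens.
  (* Now [d] divides [m] and is even, so every rank is even. *)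
  have oj j : ~~ odd (m + d * j) by rewrite oddD mE !oddM (negPf d_even).
  have b0 := balanced 0%N; have b2 := balanced 2.
  rewrite -/d' DE in rad twist b0 b2.
  have {b0} b0 := b0 (oj 0%N) isT; have {b2} b2 := b2 (oj 2) isT.
  rewrite /odd_class_value -/d' DE !(negPf (oj _)) in plain.
  move=> w; rewrite (single_weight_count p_prime p_odd cardF sE proper DE jbP).
  rewrite /class_count !(negPf (oj _)).
  have dE : d = (2 * d./2)%N by rewrite mul2n even_halfK.
  have E0 : ((m + d * 0)./2 = d./2 + d * k./2)%N by rewrite muln0 {1}mE'; lia.
  have E1 : ((m + d * 1)./2 = d + d * k./2)%N by rewrite muln1 {1}mE'; lia.
  have E2 : ((m + d * 2)./2 = d + d./2 + d * k./2)%N by rewrite {1}mE'; lia.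
  rewrite E0 E1 E2 !natrX b0 b2 in plain total rad twist *.
  rewrite -(table_even_arith w p_gt1 dE d_gt0 h_ge mE' total rad twist); last first.
    by rewrite -plain expr1 expr0; ring.
  by rewrite muln0 muln1 [(d * 2)%N]mulnC expr1 expr0 !mulN1r !mul1r; field.
move=> DE; case: cases => [[k [DE' _ _ _]]|[k [l' [_ mE k3 lE l'_odd]]]]; first by lia.
(* As [l = d l'] with [l'] odd, [l] is congruent to [d] modulo [2d], and the elements fixed by [s^2]
   form the field of [p^(2d)] elements. *)
have s_fixed x : s (s x) = x -> s x = x ^+ (p ^ d).
  move=> tx; have : x \in [set x | frob2 s x == x] by rewrite inE /= tx.
  rewrite (tau_fixed cardF l_gt0 sE) -/d' DE => xf.
  have := fixed_field_iter l'./2 xf; rewrite inE => /eqP xl'.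
  rewrite sE lE -{1}(odd_double_half l') l'_odd mulnDr muln1 -mul2n addnC expnD exprM.
  by rewrite mulnCA [(d * _)%N]mulnC mulnCA xl'.
have [jf jP] := even_class_exists p_prime cardF l_gt0 sE DE.
have total := even_classes_total p_prime cardF jP.
have rad := even_classes_radical p_prime p_odd cardF l_gt0 d_gt0 sE DE mE s_fixed jP.
have plain := even_classes_plain p_prime p_odd cardF l_gt0 d_gt0 sE DE mE s_fixed jP.
have cubic := even_classes_cubic p_prime p_odd cardF l_gt0 d_gt0 sE DE mE s_fixed jP.
move=> w; rewrite (weight_count_split p_prime p_odd cardF sE proper).
rewrite (eq_bigr (fun ab => even_rank_count p m (2 * d * jf ab) ((- p%:R ^+ d) ^+ (k + jf ab)) w)).
  rewrite (even_class_sum jP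
    (fun j => even_rank_count p m (2 * d * j) ((- p%:R ^+ d) ^+ (k + j)) w)).
  rewrite !natrX in total rad plain cubic.
  have := table_double_arith w p_gt1 d_gt0 k3 mE total; cbv zeta.
  rewrite addn0 addn1 addn2 addn3 => /(_ plain rad cubic) <-.
  by rewrite muln0 muln1 mulnAC [(2 * d * 3)%N]mulnAC.
move=> [a b] /[dup] /jP[_ cR] ab0.
have fl := even_flat p_prime p_odd cardF l_gt0 d_gt0 sE DE mE s_fixed jP ab0.
rewrite (flat_weights p_prime p_odd cardF sE w cR fl).
by rewrite rmorphXn rmorphN rmorphXn rmorph_nat.
Qed.
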